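(* Let $d\ge2$ and let $p$ be a probability density on $[0,\infty)$ with $0<\int_0^\infty p(r)r^2\,dr<\infty$. Let $\bar p(\mathbf{x})=p(\|\mathbf{x}\|)/A(\|\mathbf{x}\|)$ on $\mathbb{R}^d$, where $A(r)$ is the surface area of the sphere of radius $r$ in $\mathbb{R}^d$, and for a kernel $k$ let $(T_kf)(\mathbf{x})=\int_{\mathbb{R}^d}k(\mathbf{x},\mathbf{z})f(\mathbf{z})\bar p(\mathbf{z})\,d\mathbf{z}$. Let $\kappa_0,\kappa_1:[-1,1]\to\mathbb{R}$ be continuous and such that $(\mathbf{u},\mathbf{v})\mapsto\kappa_i(\mathbf{u}^T\mathbf{v})$ is a positive definite kernel on $\mathbb{S}^{d-1}$, $i=0,1$. Write $r_x=\|\mathbf{x}\|$, $\hat{\mathbf{x}}=\mathbf{x}/r_x$. (1) Let $k_0(\mathbf{x},\mathbf{z})=r_xr_z\kappa_0(\hat{\mathbf{x}}^T\hat{\mathbf{z}})$ (homogeneous of order 1). Then for every spherical harmonic $Y_{k,j}$ of $\mathbb{S}^{d-1}$, the function $\Psi_{k,j}(\mathbf{x})=a\,r_xY_{k,j}(\hat{\mathbf{x}})$ is an eigenfunction of $T_{k_0}$, and for a suitable constant $a>0$ (independent of $k,j$) the family $\{\Psi_{k,j}\}$ is orthonormal in $L^2(\bar p)$, giving $k_0(\mathbf{x},\mathbf{z})=\sum_k\lambda'_k\sum_j\Psi_{k,j}(\mathbf{x})\Psi_{k,j}(\mathbf{z})$. (2) Let $k=k_0+k_1$ with $k_1(\mathbf{x},\mathbf{z})=\kappa_1(\hat{\mathbf{x}}^T\hat{\mathbf{z}})$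 (homogeneous of order 0). Then for every spherical harmonic $Y_{k,j}$, the two-dimensional space $\{(ar_x+b)Y_{k,j}(\hat{\mathbf{x}}):a,b\in\mathbb{R}\}$ is invariant under $T_k$; consequently $T_k$ has eigenfunctions of the form $\Psi(\mathbf{x})=(ar_x+b)Y_{k,j}(\hat{\mathbf{x}})$, and the eigenfunctions of $k$ are of this form.
   Context: Spherical harmonics $Y_{k,j}$, $j=1,\dots,N(d,k)$, form an orthonormal basis (uniform measure on $\mathbb{S}^{d-1}$) of the degree-$k$ spherical harmonics; they are eigenfunctions of every continuous zonal kernel on $\mathbb{S}^{d-1}$. *)

(* Defs.v *)
From HB Require Import structures.
From mathcomp Require Import all_boot all_order all_algebra.
From mathcomp Require Import all_classical all_reals all_analysis.
Set Implicit Arguments. Unset Strict Implicit. Unset Printing Implicit Defensive.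
Import Order.TTheory GRing.Theory Num.Theory.
Import numFieldNormedType.Exports.
Local Open Scope classical_set_scope.
Local Open Scope ring_scope.

Section Defs.
Variable R : realType.

(* Euclidean inner product and Euclidean norm on R^d = 'rV[R]_d
   (the library norm on matrices is the sup norm, hence not used). *)
Definition dotv d (u v : 'rV[R]_d) : R := \sum_(i < d) u 0 i * v 0 i.
Definition enorm d (x : 'rV[R]_d) : R := Num.sqrt (dotv x x).
(* x-hat = x / ||x|| (with the convention 0^-1 = 0, so hat 0 = 0). *)
Definition hatv d (x : 'rV[R]_d) : 'rV[R]_d := (enorm x)^-1 *: x.

(* Lebesgue integral over R^d, as the iterated one-dimensional Lebesgue
   integral (equal to the d-dimensional Lebesgue integral for integrable or
   nonnegative measurable integrands, by Fubini--Tonelli). *)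
Fixpoint iint (d : nat) : ('rV[R]_d -> R) -> \bar R :=
  match d with
  | 0 => fun f => (f 0)%:E
  | d'.+1 => fun f =>
      (\int[@lebesgue_measure R]_(t in [set: R])
         iint (fun v : 'rV[R]_d' => f (row_mx (\row_(_ < 1) t) v)))%E
  end.

Definition ball_vol d : R :=
  fine (iint (fun x : 'rV[R]_d => if enorm x <= 1 then 1 else 0)).
Definition sphere_area d (r : R) : R := d%:R * ball_vol d * r ^+ d.-1.

(* Integral against the normalized uniform (surface) measure on S^{d-1},
   realized as the normalized cone measure: avg_S g = (1/|B|) int_B g(x/|x|) dx. *)
Definition sphere_int d (g : 'rV[R]_d -> R) : \bar R :=
  (iint (fun x : 'rV[R]_d => ((if enorm x <= 1 then 1 else 0) * g (hatv x))%R)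
   * ((ball_vol d)^-1)%:E)%E.

Definition pbar d (p : R -> R) (x : 'rV[R]_d) : R :=
  p (enorm x) / sphere_area d (enorm x).

Definition Top d (p : R -> R) (k : 'rV[R]_d -> 'rV[R]_d -> R)
  (f : 'rV[R]_d -> R) (x : 'rV[R]_d) : \bar R :=
  iint (fun z => k x z * f z * pbar p z).

Definition L2ip d (p : R -> R) (f g : 'rV[R]_d -> R) : \bar R :=
  iint (fun z => f z * g z * pbar p z).

Definition sph_pd d (kappa : R -> R) : Prop :=
  forall (n : nat) (u : 'I_n -> 'rV[R]_d) (c : 'I_n -> R),
    (forall i, enorm (u i) = 1) ->
    0 <= \sum_(i < n) \sum_(j < n) c i * c j * kappa (dotv (u i) (u j)).

Definition homog_poly d (k : nat) (P : 'rV[R]_d -> R) : Prop :=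
  exists c : {ffun 'I_d -> 'I_k.+1} -> R,
    forall x, P x = \sum_(m : {ffun 'I_d -> 'I_k.+1} | (\sum_(i < d) (m i : nat))%N == k)
                      c m * \prod_(i < d) x 0 i ^+ m i.

Definition laplacian d (P : 'rV[R]_d -> R) (x : 'rV[R]_d) : R :=
  \sum_(i < d) derive (fun y => derive P y (delta_mx 0 i)) x (delta_mx 0 i).

Definition sph_harm d (k : nat) (Y : 'rV[R]_d -> R) : Prop :=
  exists P, homog_poly k P /\ (forall x, laplacian P x = 0) /\
            (forall u, enorm u = 1 -> Y u = P u).

Definition sph_harm_basis d (N : nat -> nat) (Y : nat -> nat -> 'rV[R]_d -> R) : Prop :=
  [/\ (forall k j, (j < N k)%N -> sph_harm k (Y k j)),
      (forall k j k' j', (j < N k)%N -> (j' < N k')%N ->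
         sphere_int (fun u => Y k j u * Y k' j' u)
         = (if (k == k') && (j == j') then 1 else 0)%:E) &
      (forall k Z, sph_harm k Z -> exists c : nat -> R,
         forall u, enorm u = 1 -> Z u = \sum_(j < N k) c j * Y k j u)].

End Defs.

Definition radial_sh (R : realType) d (a b : R) (Y : 'rV[R]_d -> R) (x : 'rV[R]_d) : R :=
  ((a * enorm x + b) * Y (hatv x))%R.

(* Main.v *)
Require Import Defs.
From HB Require Import structures.
From mathcomp Require Import all_boot all_order all_algebra.
From mathcomp Require Import all_classical all_reals all_analysis.
From mathcomp Require Import measurable_realfun simple_functions measurable_fun_approximation.
From mathcomp Require Import ring lra.
Set Implicit Arguments. Unset Strict Implicit. Unset Printing Implicit Defensive.
Import Order.TTheory GRing.Theory Num.Theory.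
Import numFieldNormedType.Exports.
Local Open Scope classical_set_scope.
Local Open Scope ring_scope.

(** A kernel [r_x^i r_z^i kappa (x^ . z^)] acts on [phi(r) Y(x^)] through polar
    coordinates: the radial part only contributes moments of [p], the angular part is
    the zonal operator of [kappa] on the sphere.  By Funk-Hecke the latter is a scalar
    [lam_k] on harmonics of degree [k]: averaging [kappa] against the reproducing kernel
    of degree [k] gives, for each pole, a harmonic that is invariant under all
    reflections fixing the pole, hence a polynomial of degree [k] in the cosine which is
    orthogonal to lower degrees, hence a multiple of the zonal harmonic.  Positive
    definiteness gives [lam_k >= 0]; smoothing [kappa] by the zonal polynomials
    [((1 + t) / 2) ^ m], whose multipliers lie in [[0, 1]] and tend to [1], bounds the
    diagonal series and yields the pointwise Mercer expansion.  With the order 0 kernel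
    added, the operator on [(a r + b) Y] is the product of [diag(lam0_k, lam1_k)] and the
    Gram matrix of [(r, 1)] in [L^2(p)], which is diagonalizable in a Gram-orthonormal
    basis. *)

(** * Lebesgue measure on row vectors *)

(** [iint] is an iterated integral attached to no measure, while reflections mix the coordinates. A
    measure [leb] on rows is therefore built whose integral agrees with [iint] on integrable
    functions, and every change of variables is made there.

    [sphere_int] averages over the unit ball along rays. Polar coordinates thus amount to
    identifying the image under [enorm] of a weighted measure, and a measure on the line that is
    finite on rays is determined by them.

    Reflections serve as the symmetry group because a single one exchanges two given distinct
    vectors of equal norm: it carries any pole to any other, and also exchanges two points at equal
    distance from a fixed pole while fixing that pole.

    The hypotheses constrain [Y] on unit vectors only and [kappa] on [[-1, 1]] only, whereas
    [hatv 0 = 0] is not a unit vector. Hence the predicate [sbm], the null-set arguments at the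
    origin, and the exclusion of the origin for the kernel of order 0. For the kernel of order 1 the
    factor [enorm x] settles that point. *)

Definition row_display : measure_display.
Proof. exact: default_measure_display. Qed.

Section measurable_row.
Variables (R : realType) (d : nat).

Let coord (i : 'I_d) (x : 'rV[R]_d) : measurableTypeR R := x 0 i.

Let row_set0 : g_sigma_preimage coord set0.
Proof. exact: sigma_algebra0. Qed.

Let row_setC A : g_sigma_preimage coord A -> g_sigma_preimage coord (~` A).
Proof. exact: sigma_algebraC. Qed.

Let row_bigcup (F : _^nat) : (forall i, g_sigma_preimage coord (F i)) ->
  g_sigma_preimage coord (\bigcup_i (F i)).
Proof. exact: sigma_algebra_bigcup. Qed.

(** The sigma-algebra generated by the coordinates, so that maps into rows are tested
    coordinatewise. *)
HB.instance Definition _ := @isMeasurable.Build row_display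
  ('rV[R]_d) (g_sigma_preimage coord) row_set0 row_setC row_bigcup.

Lemma measurable_row_coord (i : 'I_d) :
  measurable_fun [set: 'rV[R]_d] (fun x => x 0 i : measurableTypeR R).
Proof.
move=> _ B mB; rewrite setTI; apply: sub_sigma_algebra => /=.
rewrite -bigcup_seq/=; exists i => /=; first by rewrite mem_index_enum.
by exists B => //; rewrite setTI.
Qed.

Lemma measurable_fun_row dd (T : measurableType dd) (f : T -> 'rV[R]_d) :
  (forall i, measurable_fun [set: T] (fun t => f t 0 i)) ->
  measurable_fun [set: T] f.
Proof.
move=> mf _ A mA; rewrite setTI.
have : preimage_set_system [set: T] f (g_sigma_preimage coord) `<=` measurable.
  rewrite -g_sigma_preimageE; apply: smallest_sub.
    exact: sigma_algebra_measurable.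
  move=> _ [B + <-]; rewrite -bigcup_seq/= => -[i _ [C mC <-]].
  by rewrite !setTI; have := mf i measurableT C mC; rewrite setTI.
by apply; exists A => //; rewrite setTI.
Qed.

End measurable_row.

(** * Splitting off the first coordinate *)

Section row_cons.
Variable R : realType.

Definition rcns d (t : R) (v : 'rV[R]_d) : 'rV[R]_d.+1 :=
  row_mx (\row_(_ < 1) t) v.
Definition rtl d (x : 'rV[R]_d.+1) : 'rV[R]_d :=
  @rsubmx R 1 1 d (x : 'rV[R]_(1 + d)).

Lemma rcns0 d t (v : 'rV[R]_d) : rcns t v 0 0 = t.
Proof.
rewrite /rcns (_ : (0 : 'I_d.+1) = lshift d (0 : 'I_1)); last exact: val_inj.
by rewrite (@row_mxEl _ 1 1 d) mxE.
Qed.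

Lemma rcnsS d t (v : 'rV[R]_d) i : rcns t v 0 (lift 0 i) = v 0 i.
Proof.
rewrite /rcns (_ : lift 0 i = rshift 1 i); last exact: val_inj.
by rewrite (@row_mxEr _ 1 1 d).
Qed.

Lemma rtlE d (x : 'rV[R]_d.+1) i : rtl x 0 i = x 0 (lift 0 i).
Proof. by rewrite /rtl mxE; congr (x _ _); exact: val_inj. Qed.

Lemma rcns_eta d (x : 'rV[R]_d.+1) : rcns (x 0 0) (rtl x) = x.
Proof.
apply/rowP => i; have [j ->|->] := unliftP 0 i; first by rewrite rcnsS rtlE.
by rewrite rcns0.
Qed.

Lemma rtl_cns d t (v : 'rV[R]_d) : rtl (rcns t v) = v.
Proof. by apply/rowP => i; rewrite rtlE rcnsS. Qed.

Lemma dotv_cns d s t (v w : 'rV[R]_d) :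
  dotv (rcns s v) (rcns t w) = s * t + dotv v w.
Proof.
rewrite /dotv big_ord_recl !rcns0; congr (_ + _).
by apply: eq_bigr => i _; rewrite !rcnsS.
Qed.

Lemma measurable_rcns_fun dd (T : measurableType dd) d (f : T -> R)
    (g : T -> 'rV[R]_d) :
  measurable_fun [set: T] f -> measurable_fun [set: T] g ->
  measurable_fun [set: T] (fun t => rcns (f t) (g t)).
Proof.
move=> mf mg; apply: measurable_fun_row => i.
have [j ->|->] := unliftP 0 i; last first.
  by under eq_fun do rewrite rcns0.
under eq_fun do rewrite rcnsS.
exact: (measurableT_comp (measurable_row_coord j) mg).
Qed.

Lemma measurable_rcns d : measurable_fun
  [set: (measurableTypeR R * 'rV[R]_d)%type] (fun z => rcns z.1 z.2).
Proof. by apply: measurable_rcns_fun. Qed.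

Lemma measurable_rcns1 d t : measurable_fun [set: 'rV[R]_d] (rcns t).
Proof. exact: measurable_rcns_fun. Qed.

Lemma measurable_rtl d : measurable_fun [set: 'rV[R]_d.+1] (@rtl d).
Proof.
apply: measurable_fun_row => i; under eq_fun do rewrite rtlE.
exact: measurable_row_coord.
Qed.

End row_cons.

(** * Construction of the measure and comparison with [iint] *)

Section leb.
Variable R : realType.
Local Open Scope ereal_scope.

Section step.
Variables (d : nat) (m : {sigma_finite_measure set 'rV[R]_d -> \bar R}).

(** Image of a product measure, so that the theorems of Fubini and Tonelli transfer to rows. *)
Definition leb_succ : set 'rV[R]_d.+1 -> \bar R :=
  pushforward (@lebesgue_measure R \x m)
    (fun z : measurableTypeR R * 'rV[R]_d => rcns z.1 z.2).


Let leb_succ0 : leb_succ set0 = 0.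
Proof. by rewrite /leb_succ /pushforward preimage_set0 measure0. Qed.

Let leb_succ_ge0 A : 0 <= leb_succ A.
Proof. by rewrite /leb_succ /pushforward; exact: measure_ge0. Qed.

Let mpre A : measurable A ->
  measurable ((fun z : measurableTypeR R * 'rV[R]_d => rcns z.1 z.2) @^-1` A).
Proof. by move=> mA; rewrite -[X in measurable X]setTI; exact: measurable_rcns. Qed.

Let leb_succ_sigma_additive : semi_sigma_additive leb_succ.
Proof.
move=> F mF tF mUF; rewrite /leb_succ /pushforward preimage_bigcup.
apply: measure_semi_sigma_additive.
- by move=> n; exact: mpre.
- apply/trivIsetP => /= i j _ _ ij; rewrite -preimage_setI.
  by move/trivIsetP : tF => /(_ _ _ _ _ ij) ->//; rewrite preimage_set0.
- by rewrite -preimage_bigcup; exact: mpre.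
Qed.

HB.instance Definition _ := isMeasure.Build _ _ _ leb_succ
  leb_succ0 leb_succ_ge0 leb_succ_sigma_additive.

Let leb_succ_sigma_finite : sigma_finite setT leb_succ.
Proof.
have /sigma_finiteP[F [TF ndF Foo]] := sigma_finiteT (@lebesgue_measure R).
have /sigma_finiteP[G [TG ndG Goo]] := sigma_finiteT m.
exists (fun n => [set x : 'rV[R]_d.+1 | F n (x 0%R 0%R) /\ G n (rtl x)]).
  apply/seteqP; split => // x _.
  have [n _ Fn] : (\bigcup_n F n) (x 0%R 0%R) by rewrite -TF.
  have [k _ Gk] : (\bigcup_n G n) (rtl x) by rewrite -TG.
  exists (maxn n k) => //; split.
  - by move: Fn; exact/subsetPset/ndF/leq_maxl.
  - by move: Gk; exact/subsetPset/ndG/leq_maxr.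
move=> k; have [mF Fk] := Foo k; have [mG Gk] := Goo k; split.
  apply: measurableI.
  - by rewrite -[X in measurable X]setTI; exact: measurable_row_coord.
  - by rewrite -[X in measurable X]setTI; exact: measurable_rtl.
rewrite /leb_succ /pushforward (_ : _ @^-1` _ = F k `*` G k).
  by rewrite product_measure1E// lte_mul_pinfty// ge0_fin_numE.
by apply/seteqP; split => -[t v] /=; rewrite rcns0 rtl_cns.
Qed.
HB.instance Definition _ := Measure_isSigmaFinite.Build _ _ _ leb_succ
  leb_succ_sigma_finite.

Lemma ge0_integral_leb_succ (f : 'rV[R]_d.+1 -> \bar R) :
  measurable_fun setT f -> (forall x, 0 <= f x) ->
  \int[leb_succ]_x f x = \int[@lebesgue_measure R]_t \int[m]_v f (rcns t v).
Proof.
move=> mf f0; rewrite /leb_succ (ge0_integral_pushforward (@measurable_rcns R d))//=.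
rewrite preimage_setT.
apply: (@fubini_tonelli1 _ _ (measurableTypeR R) 'rV[R]_d R lebesgue_measure m
  (f \o (fun z => rcns z.1 z.2))) => [|x] /=.
  by apply: (measurableT_comp mf); exact: measurable_rcns.
exact: f0.
Qed.

Lemma integrable_leb_succ (f : 'rV[R]_d.+1 -> \bar R) :
  leb_succ.-integrable setT f ->
  (@lebesgue_measure R \x m).-integrable setT
    (fun z : measurableTypeR R * 'rV[R]_d => f (rcns z.1 z.2)).
Proof.
move=> /integrableP[mf foo]; apply/integrableP; split.
  by apply: (measurableT_comp mf); exact: measurable_rcns.
apply: le_lt_trans foo; rewrite [leRHS](ge0_integral_pushforward (@measurable_rcns R d))//=.
exact: measurableT_comp.
Qed.

Lemma integral_leb_succ (f : 'rV[R]_d.+1 -> \bar R) :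
  leb_succ.-integrable setT f ->
  \int[leb_succ]_x f x = \int[@lebesgue_measure R]_t \int[m]_v f (rcns t v).
Proof.
move=> fi; have := integral12_prod_meas1 (integrable_leb_succ fi); rewrite /fubini_F => ->.
rewrite [LHS]integralE [RHS]integralE; congr (_ - _).
- rewrite /leb_succ (ge0_integral_pushforward (@measurable_rcns R d))//=.
    by rewrite preimage_setT; apply: eq_integral => z _; rewrite /= !funeposE.
  by apply: measurable_funepos; case/integrableP: fi.
- rewrite /leb_succ (ge0_integral_pushforward (@measurable_rcns R d))//=.
    by rewrite preimage_setT; apply: eq_integral => z _; rewrite /= !funenegE.
  by apply: measurable_funeneg; case/integrableP: fi.
Qed.

End step.

Definition leb0 : set 'rV[R]_0 -> \bar R := \d_(0 : 'rV[R]_0)%R.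
HB.instance Definition _ := Measure.on leb0.
Let leb0_sigma_finite : sigma_finite setT leb0.
Proof.
exists (fun=> setT); first by rewrite bigcup_const.
by move=> _; split => //; rewrite /leb0 diracT ltry.
Qed.
HB.instance Definition _ := Measure_isSigmaFinite.Build _ _ _ leb0
  leb0_sigma_finite.

(** The recursion returns a bundled sigma-finite measure because each step forms a product with the
    previous one and applies Fubini to it. *)
Fixpoint leb (d : nat) : {sigma_finite_measure set 'rV[R]_d -> \bar R} :=
  match d return {sigma_finite_measure set 'rV[R]_d -> \bar R} with
  | 0%N => leb0
  | d'.+1 => leb_succ (leb d')
  end.

(** Slices of an integrable function are integrable only almost everywhere; on the other slices
    [iint] and the integral may differ. Comparing the outer integrals in [iintE] then asks for
    measurability of the slice function, which holds without integrability: each integral is a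
    difference of two Tonelli integrals. *)
Lemma measurable_iint dd (T : measurableType dd) d (f : T -> 'rV[R]_d -> R) :
  measurable_fun [set: (T * 'rV[R]_d)%type] (fun z => f z.1 z.2) ->
  measurable_fun setT (fun p => iint (f p)).
Proof.
elim: d dd T f => [|d IH] dd T f mf /=.
  apply/measurable_EFinP.
  apply: (measurableT_comp mf (f := fun z => f z.1 z.2) (g := fun p => (p, 0%R))).
  by apply: measurable_fun_pair.
pose g (z : T * measurableTypeR R) := iint (fun v => f z.1 (rcns z.2 v)).
have mg : measurable_fun setT g.
  apply: (IH _ _ (fun (z : T * measurableTypeR R) v => f z.1 (rcns z.2 v))).
  apply: (measurableT_comp mf (f := fun z => f z.1 z.2)
    (g := fun q => (q.1.1, rcns q.1.2 q.2))).
  apply: measurable_fun_pair; first exact: measurableT_comp.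
  by apply: measurable_rcns_fun => //; exact: measurableT_comp.
rewrite (_ : (fun p => _) = (fun p => \int[lebesgue_measure]_t g^\+ (p, t)) \-
  (fun p => \int[lebesgue_measure]_t g^\- (p, t))).
  apply: emeasurable_funB.
  - apply: (measurable_fun_fubini_tonelli_F (m2 := lebesgue_measure) g^\+) => //.
    exact: measurable_funepos.
  - apply: (measurable_fun_fubini_tonelli_F (m2 := lebesgue_measure) g^\-) => //.
    exact: measurable_funeneg.
apply/funext => p; rewrite integralE; congr (_ - _).
- by apply: eq_integral => t _; rewrite !funeposE.
- by apply: eq_integral => t _; rewrite !funenegE.
Qed.

Lemma iintE d (f : 'rV[R]_d -> R) : (leb d).-integrable setT (EFin \o f) ->
  iint f = \int[leb d]_x (f x)%:E.
Proof.
elim: d f => [|d IH] f fi.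
  rewrite /= /leb0 integral_dirac//; last by case/integrableP: fi.
  by rewrite diracT mul1e.
have /integrableP[/measurable_EFinP mf _] := fi.
rewrite [RHS]integral_leb_succ//= -/(leb d).
apply: ae_eq_integral => //.
- apply: (@measurable_iint _ (measurableTypeR R) d (fun t v => f (rcns t v))).
  by apply: (measurableT_comp mf); exact: measurable_rcns.
- have := integrable_leb_succ fi => /measurable_fubini_F.
  by apply.
- have := ae_integrable1 (integrable_leb_succ fi).
  by apply: filterS => t /= fti _; rewrite IH.
Qed.

End leb.

(** * Euclidean geometry and invariance under reflections *)

Section euclid.
Variables (R : realType) (d : nat).
Implicit Types (x y z u v w : 'rV[R]_d) (a : R).

Lemma dotvC x y : dotv x y = dotv y x.
Proof. by apply: eq_bigr => i _; rewrite mulrC. Qed.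

Lemma dotvDl x y z : dotv (x + y) z = dotv x z + dotv y z.
Proof. by rewrite -big_split; apply: eq_bigr => i _; rewrite mxE mulrDl. Qed.

Lemma dotvZl a x y : dotv (a *: x) y = a * dotv x y.
Proof. by rewrite mulr_sumr; apply: eq_bigr => i _; rewrite mxE mulrA. Qed.

Lemma dotvDr x y z : dotv x (y + z) = dotv x y + dotv x z.
Proof. by rewrite dotvC dotvDl !(dotvC x). Qed.

Lemma dotvZr a x y : dotv x (a *: y) = a * dotv x y.
Proof. by rewrite dotvC dotvZl dotvC. Qed.

Lemma dotvNl x y : dotv (- x) y = - dotv x y.
Proof. by rewrite -scaleN1r dotvZl mulN1r. Qed.

Lemma dotvNr x y : dotv x (- y) = - dotv x y.
Proof. by rewrite dotvC dotvNl dotvC. Qed.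

Lemma dotvBl x y z : dotv (x - y) z = dotv x z - dotv y z.
Proof. by rewrite dotvDl dotvNl. Qed.

Lemma dotvBr x y z : dotv x (y - z) = dotv x y - dotv x z.
Proof. by rewrite dotvDr dotvNr. Qed.

Lemma dot0v x : dotv 0 x = 0.
Proof. by rewrite -(scale0r 0) dotvZl mul0r. Qed.

Lemma dotv_ge0 x : 0 <= dotv x x.
Proof. by apply: sumr_ge0 => i _; rewrite -expr2 sqr_ge0. Qed.

Lemma dotv_eq0 x : dotv x x = 0 -> x = 0.
Proof.
move=> /eqP; rewrite psumr_eq0 => [/allP x0|i _]; last by rewrite -expr2 sqr_ge0.
apply/rowP => i; rewrite mxE; have := x0 i (mem_index_enum _).
by rewrite -expr2 sqrf_eq0 => /eqP.
Qed.

Lemma enorm_ge0 x : 0 <= enorm x.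
Proof. exact: sqrtr_ge0. Qed.

Lemma sqr_enorm x : enorm x ^+ 2 = dotv x x.
Proof. by rewrite sqr_sqrtr ?dotv_ge0. Qed.

Lemma enorm0 : enorm (0 : 'rV[R]_d) = 0.
Proof. by rewrite /enorm dot0v sqrtr0. Qed.

Lemma enorm0_eq0 x : enorm x = 0 -> x = 0.
Proof. by move=> x0; apply: dotv_eq0; rewrite -sqr_enorm x0 expr0n. Qed.

Lemma enorm_eq0 x : (enorm x == 0) = (x == 0).
Proof. by apply/eqP/eqP => [/enorm0_eq0//|->]; exact: enorm0. Qed.

Lemma enorm_gt0 x : (0 < enorm x) = (x != 0).
Proof. by rewrite lt_neqAle enorm_ge0 andbT eq_sym enorm_eq0. Qed.

Lemma enormZ a x : enorm (a *: x) = `|a| * enorm x.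
Proof.
by rewrite /enorm dotvZl dotvZr mulrA -expr2 sqrtrM ?sqr_ge0// sqrtr_sqr.
Qed.

Lemma enorm_hat x : x != 0 -> enorm (hatv x) = 1.
Proof.
move=> x0; rewrite enormZ ger0_norm ?invr_ge0 ?enorm_ge0//.
by rewrite mulVf// enorm_eq0.
Qed.

Lemma dotvv u : enorm u = 1 -> dotv u u = 1.
Proof. by move=> u1; rewrite -sqr_enorm u1 expr1n. Qed.

Lemma dotvv_enorm u : dotv u u = 1 -> enorm u = 1.
Proof. by rewrite /enorm => ->; rewrite sqrtr1. Qed.

Lemma dotv_le1 u v : enorm u = 1 -> enorm v = 1 -> -1 <= dotv u v <= 1.
Proof.
move=> /dotvv uu /dotvv vv.
have := dotv_ge0 (u - v); have := dotv_ge0 (u + v).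
rewrite !(dotvDl, dotvDr, dotvNl, dotvNr) (dotvC v u) uu vv => h1 h2.
by apply/andP; split; lra.
Qed.

(** For unit [n], the reflection in the hyperplane orthogonal to [n]. *)
Definition refl (n x : 'rV[R]_d) : 'rV[R]_d := x - (2 * dotv x n) *: n.

Lemma dotv_refl n x y : enorm n = 1 -> dotv (refl n x) (refl n y) = dotv x y.
Proof.
move=> /dotvv nn; rewrite /refl !(dotvBl, dotvBr, dotvZl, dotvZr) nn (dotvC n y).
ring.
Qed.

Lemma enorm_refl n x : enorm n = 1 -> enorm (refl n x) = enorm x.
Proof. by move=> n1; rewrite /enorm dotv_refl. Qed.

Lemma reflK n x : enorm n = 1 -> refl n (refl n x) = x.
Proof.
move=> /dotvv nn; rewrite /refl dotvBl dotvZl nn.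
by apply/rowP => i; rewrite !mxE; ring.
Qed.

Lemma refl_linear n a x y : refl n (a *: x + y) = a *: refl n x + refl n y.
Proof. by rewrite /refl dotvDl dotvZl; apply/rowP => i; rewrite !mxE; ring. Qed.

Lemma refl_fix n x : dotv x n = 0 -> refl n x = x.
Proof. by rewrite /refl => ->; rewrite mulr0 scale0r subr0. Qed.

(** [u - v] is normal to the bisecting hyperplane; equal norms give [2 * dotv u (u - v) = dotv (u -
    v) (u - v)]. *)
Lemma refl_swap u v : dotv u u = dotv v v -> u != v -> refl (hatv (u - v)) u = v.
Proof.
move=> uv nuv; have uv0 : u - v != 0 by rewrite subr_eq0.
have e0 : enorm (u - v) != 0 by rewrite enorm_eq0.
rewrite /refl /hatv dotvZr scalerA.
have -> : 2 * ((enorm (u - v))^-1 * dotv u (u - v)) * (enorm (u - v))^-1 = 1.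
  have -> : 2 * ((enorm (u - v))^-1 * dotv u (u - v)) * (enorm (u - v))^-1 =
     2 * dotv u (u - v) / enorm (u - v) ^+ 2 by field.
  rewrite sqr_enorm (_ : 2 * _ = dotv (u - v) (u - v)).
    by rewrite divff// -sqr_enorm expf_neq0.
  by rewrite !(dotvDl, dotvDr, dotvNl, dotvNr) (dotvC v u) uv; ring.
by rewrite scale1r opprB addrC subrK.
Qed.

End euclid.

(** * Transformations that preserve or scale the measure *)

Section invariance.
Variable R : realType.
Local Notation mu := (@lebesgue_measure R).

Section ereal_part.
Local Open Scope ereal_scope.

Definition pushm d1 d2 (T1 : measurableType d1) (T2 : measurableType d2)
    (m : {measure set T1 -> \bar R}) (f : T1 -> T2)
    (mf : measurable_fun [set: T1] f) : {measure set T2 -> \bar R} :=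
  measure_function_pushforward__canonical__measure_function_Measure m mf.

Let affine (r a : R) (t : measurableTypeR R) : measurableTypeR R := (r * t + a)%R.

Let measurable_affine r a : measurable_fun setT (affine r a).
Proof. by apply: measurable_funD => //; exact: measurable_funM. Qed.

(** The rescaled image measure agrees with Lebesgue measure on half-open intervals, which
    characterizes the latter. *)
Lemma lebesgue_measure_affine (r a : R) A : (0 < r)%R -> measurable A ->
  mu A = r%:E * mu ((fun t => r * t + a)%R @^-1` A).
Proof.
move=> r0 mA.
have := @lebesgue_measure_unique R
  (mscale (NngNum (ltW r0)) (pushm mu (measurable_affine r a))).
apply => // _ [[x y]] _ <- /=.
rewrite /mscale /= /pushforward.
rewrite (_ : affine r a @^-1` _ = `]((x - a) / r)%R, ((y - a) / r)%R]%classic); last first.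
  apply/seteqP; split => t /=; rewrite !in_itv/= /affine ltr_pdivrMr//
    ler_pdivlMr// ltrBlDr lerBrDr mulrC//.
rewrite !lebesgue_measure_itv/= !lte_fin ltr_pM2r ?invr_gt0// ltrD2r.
case: ifPn => _; last by rewrite mule0.
by rewrite -!EFinB -EFinM; congr EFin; field; rewrite gt_eqF.
Qed.

Lemma ge0_integral_affine (r a : R) (f : R -> \bar R) : (0 < r)%R ->
  measurable_fun setT f -> (forall x, 0 <= f x) ->
  \int[mu]_t f t = r%:E * \int[mu]_t f (r * t + a)%R.
Proof.
move=> r0 mf f0.
rewrite (eq_measure_integral
  (mscale (NngNum (ltW r0)) (pushm mu (measurable_affine r a)))).
  rewrite ge0_integral_mscale//; congr (_ * _).
  by rewrite (ge0_integral_pushforward (measurable_affine r a))// preimage_setT.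
by move=> A mA _; exact: (lebesgue_measure_affine a r0 mA).
Qed.

Lemma ge0_integral_translate (a : R) (f : R -> \bar R) :
  measurable_fun setT f -> (forall x, 0 <= f x) ->
  \int[mu]_t f (t + a)%R = \int[mu]_t f t.
Proof.
move=> mf f0; rewrite (ge0_integral_affine a ltr01 mf f0) mul1e.
by under [in RHS]eq_integral do rewrite mul1r.
Qed.

Lemma ge0_integral_opp (f : R -> \bar R) :
  measurable_fun setT f -> (forall x, 0 <= f x) ->
  \int[mu]_t f (- t)%R = \int[mu]_t f t.
Proof.
move=> mf f0.
have mN : measurable_fun [set: measurableTypeR R] (-%R : _ -> measurableTypeR R).
  exact: oppr_measurable.
transitivity (\int[pushm mu mN]_t f t).
  by rewrite (ge0_integral_pushforward mN)// preimage_setT.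
by apply: eq_measure_integral => A mA _; exact: lebesgue_measureN.
Qed.

Lemma ge0_integral_lebS d (f : 'rV[R]_d.+1 -> \bar R) :
  measurable_fun setT f -> (forall x, 0 <= f x) ->
  \int[leb R d.+1]_x f x = \int[mu]_t \int[leb R d]_v f (rcns t v).
Proof. exact: ge0_integral_leb_succ. Qed.

Lemma measurable_cns_fst d (f : 'rV[R]_d.+1 -> \bar R) v :
  measurable_fun setT f -> measurable_fun setT (fun t : R => f (rcns t v)).
Proof.
by move=> mf; apply: (measurableT_comp mf); apply: measurable_rcns_fun.
Qed.

Lemma measurable_cns_snd d (f : 'rV[R]_d.+1 -> \bar R) t :
  measurable_fun setT f -> measurable_fun setT (fun v => f (rcns t v)).
Proof.
by move=> mf; apply: (measurableT_comp mf); exact: measurable_rcns1.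
Qed.

Lemma ge0_integral_lebS_swap d (f : 'rV[R]_d.+1 -> \bar R) :
  measurable_fun setT f -> (forall x, 0 <= f x) ->
  \int[leb R d.+1]_x f x = \int[leb R d]_v \int[mu]_t f (rcns t v).
Proof.
move=> mf f0; rewrite ge0_integral_lebS//.
apply: (@fubini_tonelli _ _ (measurableTypeR R) 'rV[R]_d R mu (leb R d)
  (f \o (fun z => rcns z.1 z.2))) => [|x] /=; last exact: f0.
by apply: (measurableT_comp mf); exact: measurable_rcns.
Qed.

(** Restricted to nonnegative integrands, so that Tonelli always applies; signed ones are split into
    two parts where they occur. *)
Definition lpres d (Q : 'rV[R]_d -> 'rV[R]_d) :=
  measurable_fun setT Q /\ forall f : 'rV[R]_d -> \bar R,
    measurable_fun setT f -> (forall x, 0 <= f x) ->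
    \int[leb R d]_x f (Q x) = \int[leb R d]_x f x.

Lemma lpres_comp d (P Q : 'rV[R]_d -> 'rV[R]_d) :
  lpres P -> lpres Q -> lpres (P \o Q).
Proof.
move=> [mP hP] [mQ hQ]; split; first exact: measurableT_comp.
move=> f mf f0; rewrite -[RHS]hP// -[RHS]hQ//.
exact: measurableT_comp.
Qed.

Lemma lpres_id d : lpres (@id 'rV[R]_d).
Proof. by split. Qed.

Lemma lpres_lift d (Q : 'rV[R]_d -> 'rV[R]_d) :
  lpres Q -> lpres (fun x : 'rV[R]_d.+1 => rcns (x 0%R 0%R) (Q (rtl x))).
Proof.
move=> [mQ hQ]; set P := (X in lpres X).
have mP : measurable_fun setT P.
  apply: measurable_rcns_fun; first exact: measurable_row_coord.
  by apply: (measurableT_comp mQ); exact: measurable_rtl.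
split=> // f mf f0.
have mfP : measurable_fun setT (fun x => f (P x)) by exact: measurableT_comp.
rewrite (ge0_integral_lebS mf f0) (ge0_integral_lebS mfP (fun x => f0 _)).
apply: eq_integral => t _; rewrite -[RHS]hQ//; last exact: measurable_cns_snd.
by apply: eq_integral => v _; rewrite /P rcns0 rtl_cns.
Qed.

Lemma lpres_flip d : lpres (fun x : 'rV[R]_d.+1 => rcns (- x 0 0)%R (rtl x)).
Proof.
set P := (X in lpres X).
have mP : measurable_fun setT P.
  apply: measurable_rcns_fun; last exact: measurable_rtl.
  by apply: measurableT_comp => //; exact: measurable_row_coord.
split=> // f mf f0.
have mfP : measurable_fun setT (fun x => f (P x)) by exact: measurableT_comp.
rewrite (ge0_integral_lebS_swap mf f0) (ge0_integral_lebS_swap mfP (fun x => f0 _)).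
apply: eq_integral => v _.
rewrite -[RHS]ge0_integral_opp//; last exact: measurable_cns_fst.
by apply: eq_integral => t _; rewrite /P rcns0 rtl_cns.
Qed.

(** With the tail fixed this is a translation of the first coordinate, hence the integration over
    that coordinate first. *)
Lemma lpres_shear1 d (l : 'rV[R]_d -> R) : measurable_fun setT l ->
  lpres (fun x : 'rV[R]_d.+1 => rcns (x 0 0 + l (rtl x))%R (rtl x)).
Proof.
move=> ml; set P := (X in lpres X).
have mP : measurable_fun setT P.
  apply: measurable_rcns_fun; last exact: measurable_rtl.
  apply: measurable_funD; first exact: measurable_row_coord.
  by apply: measurableT_comp => //; exact: measurable_rtl.
split=> // f mf f0.
have mfP : measurable_fun setT (fun x => f (P x)) by exact: measurableT_comp.
rewrite (ge0_integral_lebS_swap mf f0) (ge0_integral_lebS_swap mfP (fun x => f0 _)).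
apply: eq_integral => v _.
rewrite -[RHS](ge0_integral_translate (l v))//; last exact: measurable_cns_fst.
by apply: eq_integral => t _; rewrite /P rcns0 rtl_cns.
Qed.

(** With the first coordinate fixed at [t], this is [lpres_shear1] on the tail with the constant
    shift [c * t]. *)
Lemma lpres_shear2 d (c : R) : lpres (fun x : 'rV[R]_d.+2 =>
  rcns (x 0 0)%R (rcns (rtl x 0 0 + c * x 0 0)%R (rtl (rtl x)))).
Proof.
set P := (X in lpres X).
have mr0 : measurable_fun setT (fun x : 'rV[R]_d.+2 => rtl x 0%R 0%R).
  exact: (measurableT_comp (@measurable_row_coord R d.+1 0%R) (@measurable_rtl R d.+1)).
have mP : measurable_fun setT P.
  apply: measurable_rcns_fun; first exact: measurable_row_coord.
  apply: measurable_rcns_fun.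
    apply: measurable_funD => //; apply: measurable_funM => //.
    exact: measurable_row_coord.
  exact: (measurableT_comp (@measurable_rtl R d) (@measurable_rtl R d.+1)).
split=> // f mf f0.
have mfP : measurable_fun setT (fun x => f (P x)) by exact: measurableT_comp.
rewrite (ge0_integral_lebS mf f0) (ge0_integral_lebS mfP (fun x => f0 _)).
apply: eq_integral => t _.
have [_ /(_ (fun v => f (rcns t v)))] :=
  @lpres_shear1 d (cst (c * t)%R) (measurable_cst _).
move=> <-//; last exact: measurable_cns_snd.
by apply: eq_integral => v _; rewrite /P rcns0 rtl_cns.
Qed.

Definition rot2 d (c s : R) (x : 'rV[R]_d.+2) : 'rV[R]_d.+2 :=
  rcns (c * x 0 0 - s * rtl x 0 0)%R
    (rcns (s * x 0 0 + c * rtl x 0 0)%R (rtl (rtl x))).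

(* A plane rotation is a product of three shears. *)
Lemma lpres_rot2 d (c s : R) : s != 0%R -> (c ^+ 2 + s ^+ 2 = 1)%R ->
  lpres (@rot2 d c s).
Proof.
(* For [c] and [s] the cosine and sine of an angle, [a] is minus the tangent of the half angle. *)
move=> s0 cs; pose a := ((c - 1) / s)%R.
have ml : measurable_fun setT (fun v : 'rV[R]_d.+1 => a * v 0 0)%R.
  by apply: measurable_funM => //; exact: measurable_row_coord.
have := lpres_comp (lpres_shear1 ml) (lpres_comp (lpres_shear2 d s) (lpres_shear1 ml)).
congr lpres; apply/funext => x /=; rewrite /rot2 !(rcns0, rtl_cns).
have as1 : (a * s = c - 1)%R by rewrite /a; field.
have ac1 : (a * (c + 1) = - s)%R.
  transitivity ((c ^+ 2 - 1) / s)%R; first by rewrite /a; field.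
  by rewrite -cs; field.
congr rcns; last congr rcns.
- transitivity ((1 + a * s) * x 0 0 + (a * (1 + a * s) + a) * rtl x 0 0)%R.
    by ring.
  rewrite as1 (_ : a * (1 + (c - 1)) + a = a * (c + 1))%R; last by ring.
  by rewrite ac1; ring.
- transitivity (s * x 0 0 + (1 + a * s) * rtl x 0 0)%R; first by ring.
  by rewrite as1; ring.
Qed.

End ereal_part.

(** What conjugating a reflection uses: [Q] preserves the inner product and the measure, [Q'] is a
    linear measurable left inverse. *)
Definition oisom d (Q Q' : 'rV[R]_d -> 'rV[R]_d) :=
  [/\ cancel Q Q', forall x y, dotv (Q x) (Q y) = dotv x y,
      forall a x y, Q' (a *: x + y) = a *: Q' x + Q' y,
      lpres Q & measurable_fun setT Q'].

Lemma oisom_comp d (P P' Q Q' : 'rV[R]_d -> 'rV[R]_d) :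
  oisom P P' -> oisom Q Q' -> oisom (P \o Q) (Q' \o P').
Proof.
move=> [P1 P2 P3 P4 P5] [Q1 Q2 Q3 Q4 Q5]; split => /=.
- by move=> x /=; rewrite P1 Q1.
- by move=> x y; rewrite P2 Q2.
- by move=> a x y; rewrite P3 Q3.
- exact: lpres_comp.
- exact: measurableT_comp.
Qed.

Lemma rcns_linear d a s t (v w : 'rV[R]_d) :
  a *: rcns s v + rcns t w = rcns (a * s + t) (a *: v + w).
Proof.
apply/rowP => i; rewrite [LHS]mxE [X in X + _]mxE.
have [j ->|->] := unliftP 0 i; last by rewrite !rcns0.
by rewrite !rcnsS [RHS]mxE [X in _ = X + _]mxE.
Qed.

Lemma rcnsZ d a t (v : 'rV[R]_d) : a *: rcns t v = rcns (a * t) (a *: v).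
Proof.
apply/rowP => i; rewrite [LHS]mxE.
by have [j ->|->] := unliftP 0 i; rewrite ?rcns0 ?rcnsS ?mxE.
Qed.

Lemma rtl_linear d a (x y : 'rV[R]_d.+1) : rtl (a *: x + y) = a *: rtl x + rtl y.
Proof. by rewrite /rtl linearP. Qed.

Lemma oisom_lift d (Q Q' : 'rV[R]_d -> 'rV[R]_d) : oisom Q Q' ->
  oisom (fun x : 'rV[R]_d.+1 => rcns (x 0 0) (Q (rtl x)))
        (fun x : 'rV[R]_d.+1 => rcns (x 0 0) (Q' (rtl x))).
Proof.
move=> [Q1 Q2 Q3 Q4 Q5]; split.
- by move=> x; rewrite rcns0 rtl_cns Q1 rcns_eta.
- by move=> x y; rewrite dotv_cns Q2 -dotv_cns !rcns_eta.
- by move=> a x y; rewrite rtl_linear Q3 rcns_linear !mxE.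
- exact: lpres_lift.
- apply: measurable_rcns_fun; first exact: measurable_row_coord.
  by apply: (measurableT_comp Q5); exact: measurable_rtl.
Qed.

Lemma oisom_flip d : oisom (fun x : 'rV[R]_d.+1 => rcns (- x 0 0) (rtl x))
   (fun x : 'rV[R]_d.+1 => rcns (- x 0 0) (rtl x)).
Proof.
have := lpres_flip d; set P := (X in lpres X) => lP; split => //.
- by move=> x; rewrite /P rcns0 rtl_cns opprK rcns_eta.
- by move=> x y; rewrite /P dotv_cns mulrNN -dotv_cns !rcns_eta.
- move=> a x y; rewrite /P rtl_linear rcns_linear !mxE; congr rcns; ring.
- by case: lP.
Qed.

Lemma oisom_id d : oisom (@id 'rV[R]_d) id.
Proof. by split => //; exact: lpres_id. Qed.

Lemma dotv_eta d (x y : 'rV[R]_d.+1) :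
  dotv x y = x 0 0 * y 0 0 + dotv (rtl x) (rtl y).
Proof. by rewrite -dotv_cns !rcns_eta. Qed.

Lemma oisom_rot2 d (c s : R) : s != 0 -> c ^+ 2 + s ^+ 2 = 1 ->
  oisom (@rot2 d c s) (@rot2 d c (- s)).
Proof.
move=> s0 cs; split.
- move=> x; rewrite /rot2 !(rcns0, rtl_cns).
  rewrite -[RHS]rcns_eta -[rtl x in RHS]rcns_eta; congr rcns; last congr rcns.
  + rewrite (_ : _ - _ = (c ^+ 2 + s ^+ 2) * x 0 0); last by ring.
    by rewrite cs mul1r.
  + rewrite (_ : _ + _ = (c ^+ 2 + s ^+ 2) * rtl x 0 0); last by ring.
    by rewrite cs mul1r.
- move=> x y; rewrite /rot2 !dotv_cns [RHS]dotv_eta [X in _ = _ + X]dotv_eta.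
  rewrite !addrA; congr (_ + _).
  transitivity ((c ^+ 2 + s ^+ 2) * (x 0 0 * y 0 0 + rtl x 0 0 * rtl y 0 0)).
    by ring.
  by rewrite cs mul1r.
- move=> a x y; rewrite /rot2 !rcns_linear !rtl_linear !mxE.
  by congr rcns; last congr rcns; ring.
- exact: lpres_rot2.
- by have [] : lpres (@rot2 d c (- s)) by apply: lpres_rot2; rewrite ?oppr_eq0// sqrrN.
Qed.

(** By induction the tail is aligned with its own first axis; a rotation in the plane of the first
    two coordinates then absorbs it. If the tail is already zero, only a sign may have to be
    flipped. *)
Lemma oisom_to_axis d (u : 'rV[R]_d.+1) :
  exists Q Q', oisom Q Q' /\ Q u = rcns (enorm u) 0.
Proof.
have axis e (w : 'rV[R]_e.+1) : rtl w = 0 ->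
    exists Q Q', oisom Q Q' /\ Q w = rcns (enorm w) 0.
  move=> w0; have ew : enorm w = `|w 0 0|.
    rewrite /enorm -{1 2}(rcns_eta w) dotv_cns w0 dot0v addr0 -expr2.
    by rewrite sqrtr_sqr.
  have [w00|w00] := leP 0 (w 0 0).
    exists id, id; split; first exact: oisom_id.
    by rewrite ew ger0_norm// -{1}(rcns_eta w) w0.
  have := oisom_flip e; set P := (X in oisom X X) => oP; exists P, P; split=> //.
  by rewrite /P w0 ew ltr0_norm.
elim: d u => [|d IH] u; first by apply: axis; apply/rowP => -[].
have [v0|v0] := eqVneq (rtl u) 0; first exact: axis.
have [Q [Q' [oQ Qv]]] := IH (rtl u).
set t := u 0 0; set s := enorm (rtl u).
have s0 : 0 < s by rewrite enorm_gt0.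
have ru2 : enorm u ^+ 2 = t ^+ 2 + s ^+ 2.
  by rewrite !sqr_enorm -{1 2}(rcns_eta u) dotv_cns expr2.
have r0 : 0 < enorm u.
  by rewrite -(@pmulr_lgt0 _ (enorm u)) -?expr2 ?ru2;
    [rewrite ltr_wpDl ?sqr_ge0 ?exprn_gt0| rewrite enorm_gt0; apply: contra_neq v0 => ->;
     apply/rowP => i; rewrite rtlE !mxE].
have r0' : enorm u != 0 by rewrite gt_eqF.
have cs : (t / enorm u) ^+ 2 + (- (s / enorm u)) ^+ 2 = 1.
  rewrite sqrrN !expr_div_n -mulrDl -ru2 divff// expf_neq0//.
have sr : - (s / enorm u) != 0.
  by rewrite oppr_eq0 mulf_neq0 ?invr_eq0 ?gt_eqF.
eexists; eexists; split.
  exact: (oisom_comp (oisom_rot2 d sr cs) (oisom_lift oQ)).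
rewrite /= Qv /rot2 !(rcns0, rtl_cns) -/s -/t; congr rcns.
  transitivity ((t ^+ 2 + s ^+ 2) / enorm u); first by field.
  by rewrite -ru2 expr2 mulfK.
apply/rowP => i; rewrite [RHS]mxE; have [j ->|->] := unliftP 0 i.
  by rewrite rcnsS mxE.
by rewrite rcns0; field.
Qed.

(** An isometry taking [n] to the first axis conjugates the reflection to a change of sign of one
    coordinate. *)
Lemma lpres_refl d (n : 'rV[R]_d) : enorm n = 1 -> lpres (refl n).
Proof.
case: d n => [|d] n n1.
  move: n1 => /dotvv; rewrite /dotv big_ord0 => /esym/eqP; rewrite oner_eq0 //.
have [Q [Q' [[Q1 Q2 Q3 [mQ Q4] Q5] Qn]]] := oisom_to_axis n.
have := lpres_flip d; set F := (X in lpres X) => -[mF F4].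
have reflE x : refl n x = Q' (F (Q x)).
  have -> : F (Q x) = (- 2 * dotv x n) *: Q n + Q x.
    rewrite Qn n1 -(rcns_eta (Q x)) rcns_linear scaler0 add0r /F rcns0 rtl_cns.
    congr rcns; rewrite -Q2 Qn n1 -[in dotv _ _](rcns_eta (Q x)) dotv_cns.
    by rewrite (dotvC _ 0) dot0v; ring.
  by rewrite Q3 !Q1 /refl addrC mulNr scaleNr.
have -> : refl n = Q' \o F \o Q by apply/funext => x; rewrite reflE.
split; first by apply: measurableT_comp => //; exact: measurableT_comp.
move=> f mf f0; rewrite /=.
have mf' : measurable_fun setT (f \o Q') by exact: measurableT_comp.
have mf'' : measurable_fun setT (f \o Q' \o F) by exact: measurableT_comp.
(* Only [Q] is known to preserve the measure, so the remaining [Q'] is removed by reinserting [Q]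
   and cancelling. *)
rewrite [LHS](Q4 (f \o Q' \o F) mf'' (fun x => f0 _)) [LHS](F4 (f \o Q') mf' (fun x => f0 _)).
rewrite -[LHS](Q4 (f \o Q') mf' (fun x => f0 _)).
by apply: eq_integral => x _ /=; rewrite Q1.
Qed.

Local Open Scope ereal_scope.
Lemma ge0_integral_leb_scale d (r : R) (f : 'rV[R]_d -> \bar R) : (0 < r)%R ->
  measurable_fun setT f -> (forall x, 0 <= f x) ->
  \int[leb R d]_x f x = (r ^+ d)%:E * \int[leb R d]_x f (r *: x)%R.
Proof.
move=> r0; elim: d f => [|d IH] f mf f0.
  rewrite expr0 mul1e; apply: eq_integral => x _; congr f.
  by apply/rowP => -[].
have mscale : measurable_fun setT (fun x : 'rV[R]_d.+1 => (r *: x)%R).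
  apply: measurable_fun_row => i; under eq_fun do rewrite mxE.
  by apply: measurable_funM => //; exact: measurable_row_coord.
have mfs : measurable_fun setT (fun x : 'rV[R]_d.+1 => f (r *: x)%R) by exact: measurableT_comp.
rewrite (ge0_integral_lebS mf f0) (ge0_integral_lebS mfs (fun x => f0 _)).
have mg : measurable_fun setT (fun t => \int[leb R d]_v f (rcns t v)).
  apply: (@measurable_fun_fubini_tonelli_F _ _ (measurableTypeR R) 'rV[R]_d R
    (leb R d) (f \o (fun z => rcns z.1 z.2))) => [|x] /=; last exact: f0.
  by apply: (measurableT_comp mf); exact: measurable_rcns.
rewrite (ge0_integral_affine 0%R r0 mg); last by move=> t; exact: integral_ge0.
rewrite exprS EFinM -muleA; congr (_ * _).
have mh : measurable_fun setT (fun t => \int[leb R d]_v f (r *: rcns t v)%R).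
  apply: (@measurable_fun_fubini_tonelli_F _ _ (measurableTypeR R) 'rV[R]_d R
    (leb R d) ((fun x : 'rV[R]_d.+1 => f (r *: x)%R) \o (fun z => rcns z.1 z.2))) => [|x] /=; last exact: f0.
  by apply: (measurableT_comp mfs); exact: measurable_rcns.
rewrite -ge0_integralZl//=; last 2 first.
- by move=> t _; exact: integral_ge0.
- by rewrite lee_fin exprn_ge0// ltW.
apply: eq_integral => t _; rewrite addr0 IH//; last exact: measurable_cns_snd.
congr (_ * _); apply: eq_integral => v _; congr f.
by rewrite rcnsZ.
Qed.

End invariance.

(** * Densities, boxes and polar coordinates *)

Section density.
Local Open Scope ereal_scope.
Context dd (T : measurableType dd) (R : realType).
Variables (mu : {measure set T -> \bar R}) (w : T -> R).
Hypotheses (mw : measurable_fun setT w) (w0 : forall x, (0 <= w x)%R).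

(** The proofs about [w] are arguments so that the measure structure can be inferred from the
    term. *)
Definition mden of measurable_fun setT w & (forall x, (0 <= w x)%R) :=
  fun A : set T => \int[mu]_(x in A) (w x)%:E.

Let mden0 : mden mw w0 set0 = 0.
Proof. by rewrite /mden integral_set0. Qed.

Let mden_ge0 A : 0 <= mden mw w0 A.
Proof. by apply: integral_ge0 => x _; rewrite lee_fin. Qed.

Let mden_sigma_additive : semi_sigma_additive (mden mw w0).
Proof.
move=> F mF tF mUF; rewrite /mden/= ge0_integral_bigcup//.
- by apply: is_cvg_ereal_nneg_natsum_cond => n _ _; exact: mden_ge0.
- by apply: measurable_funTS; exact/measurable_EFinP.
- by move=> x _; rewrite lee_fin.
Qed.

HB.instance Definition _ := isMeasure.Build _ _ _ (mden mw w0)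
  mden0 mden_ge0 mden_sigma_additive.

Import HBNNSimple.

(** Monotone approximation by simple functions reduces the claim to indicators, where it is the
    definition of [mden]. *)
Lemma ge0_integral_mden (f : T -> \bar R) :
  measurable_fun setT f -> (forall x, 0 <= f x) ->
  \int[mden mw w0]_x f x = \int[mu]_x (f x * (w x)%:E).
Proof.
move=> mf f0; pose h := nnsfun_approx measurableT mf.
have mw' : measurable_fun setT (EFin \o w) by exact/measurable_EFinP.
have mh n : measurable_fun setT (fun x => (h n x)%:E).
  exact/measurable_EFinP/measurable_funP.
have ch x : (fun n => (h n x)%:E) @ \oo --> f x.
  by apply: cvg_nnsfun_approx => // y _; exact: f0.
have ndh x : {homo (fun n => (h n x)%:E) : n m / (n <= m)%N >-> n <= m}.
  by move=> m n mn; rewrite lee_fin; exact/lefP/nd_nnsfun_approx.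
have h0 n x : 0 <= (h n x)%:E by rewrite lee_fin.
transitivity (limn (fun n => \int[mden mw w0]_x (h n x)%:E)).
  rewrite -monotone_convergence//.
  by apply: eq_integral => y _; apply/esym/cvg_lim => //; exact: ch.
transitivity (limn (fun n => \int[mu]_x ((h n x)%:E * (w x)%:E))); last first.
  rewrite -monotone_convergence//.
  - apply: eq_integral => y _; apply/cvg_lim => //.
    by apply: cvgeZr => //; exact: ch.
  - by move=> n; exact: emeasurable_funM.
  - by move=> n x _; rewrite mule_ge0 ?lee_fin.
  - by move=> x _ m n mn; rewrite lee_wpmul2r ?lee_fin//; exact: ndh.
congr (limn _); apply/funext => n.
transitivity (\int[mden mw w0]_x
   (\sum_(y \in range (h n)) (y * \1_(h n @^-1` [set y]) x)%:E)).
  by apply: eq_integral => t tE; rewrite /= fimfunE -fsumEFin.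
have indich r : measurable_fun setT (fun x => (r * \1_(h n @^-1` [set r]) x)%:E).
  by apply: (measurable_comp measurableT) => //; exact: measurable_funM.
rewrite ge0_integral_fsum//; last by move=> m y Ey; exact: nnfun_muleindic_ge0.
apply/esym; transitivity (\int[mu]_x (\sum_(y \in range (h n))
    (y * \1_(h n @^-1` [set y]) x)%:E * (w x)%:E)).
  apply: eq_integral => x xE.
  rewrite -ge0_mule_fsuml => [|y]; last exact: nnfun_muleindic_ge0.
  by rewrite fsumEFin // -(fimfunE _ x).
rewrite ge0_integral_fsum//; last 2 first.
  - by move=> y; apply: emeasurable_funM.
  - move=> m y Ey; apply: mule_ge0; last by rewrite lee_fin.
    exact: nnfun_muleindic_ge0.
apply: eq_fsbigr => r rhn.
under [RHS]eq_integral do rewrite EFinM.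
rewrite integralZl_indic_nnsfun => //.
under eq_integral do rewrite EFinM -muleA.
rewrite ge0_integralZl//.
- under eq_integral do rewrite muleC.
  rewrite (eq_integral ((EFin \o w) \_ (h n @^-1` [set r]))); last first.
    by move=> x xE; rewrite epatch_indic.
  by rewrite -integral_mkcond integral_indic// setIT.
- by apply: emeasurable_funM => //; exact/measurable_EFinP.
- by move=> t Et; rewrite mule_ge0 ?lee_fin.
- by move: rhn; rewrite inE => -[t _ <-]; rewrite lee_fin.
Qed.

End density.

(** * Measurability of norm and direction *)

Section measurable_row_functions.
Variable R : realType.

Lemma measurable_invr : measurable_fun [set: R] (fun x : R => x^-1).
Proof.
have -> : (fun x : R => x^-1) = fun x => if x == 0 then 0 else x^-1.
  by apply/funext => x; case: eqP => // ->; rewrite invr0.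
apply: measurable_fun_if => //; first exact: measurable_fun_eqr.
rewrite setTI (_ : _ @^-1` _ = [set x : R | x != 0]); last first.
  by apply/seteqP; split => x /=; case: eqP.
apply: open_continuous_measurable_fun; first exact: open_neq.
by move=> x; rewrite inE/= => x0; apply: inv_continuous.
Qed.

Variable d : nat.

Lemma measurable_dotv (u : 'rV[R]_d) : measurable_fun setT (dotv u).
Proof.
apply: measurable_sum => i; apply: measurable_funM => //.
exact: measurable_row_coord.
Qed.

Lemma measurable_enorm : measurable_fun setT (@enorm R d).
Proof.
have ms : measurable_fun setT (@Num.sqrt R).
  by apply: continuous_measurable_fun; exact: sqrt_continuous.
apply: (measurableT_comp ms).
by apply: measurable_sum => i; apply: measurable_funM; exact: measurable_row_coord.
Qed.

Lemma measurable_hatv : measurable_fun setT (@hatv R d).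
Proof.
apply: measurable_fun_row => i; under eq_fun do rewrite mxE.
apply: measurable_funM; last exact: measurable_row_coord.
exact: (measurableT_comp measurable_invr measurable_enorm).
Qed.

Lemma hatvZ (r : R) (x : 'rV[R]_d) : 0 < r -> hatv (r *: x) = hatv x.
Proof.
move=> r0; rewrite /hatv enormZ gtr0_norm// invfM scalerA.
by rewrite mulrAC mulVf ?mul1r// gt_eqF.
Qed.

End measurable_row_functions.

(** * Volume of cubes *)

Section box.
Variable R : realType.
Local Open Scope ereal_scope.

(** Comparison with cubes yields finiteness and positivity of the ball volume, nullity of the origin
    and positive mass of cones over caps. *)
Definition box d (c : 'rV[R]_d) (e : R) : set 'rV[R]_d :=
  [set x | forall i, (`|x 0 i - c 0 i| <= e)%R].

Lemma measurable_box d (c : 'rV[R]_d) e : measurable (box c e).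
Proof.
have -> : box c e = \bigcap_(i in [set: 'I_d]) [set x | (`|x 0 i - c 0 i| <= e)%R].
  by apply/seteqP; split => x xb i //=; exact: xb.
apply: fin_bigcap_measurable => [|i _]; first exact: finite_finset.
rewrite -[X in measurable X]setTI.
have mf : measurable_fun setT (fun x : 'rV[R]_d => (`|x 0 i - c 0 i| <= e)%R).
  apply: measurable_fun_ler => //; apply: measurableT_comp => //.
  by apply: measurable_funB => //; exact: measurable_row_coord.
have := mf measurableT [set true] I; congr (measurable (_ `&` _)).
Qed.

Lemma leb_box d (c : 'rV[R]_d) e : (0 <= e)%R ->
  leb R d (box c e) = ((e *+ 2) ^+ d)%:E.
Proof.
move=> e0; elim: d c => [|d IH] c.
  have -> : box c e = setT by apply/seteqP; split => // x _ [].
  by rewrite /= /leb0 diracT expr0.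
rewrite /= /leb_succ /pushforward (_ : _ @^-1` _ =
  `[(c 0 0 - e)%R, (c 0 0 + e)%R] `*` box (rtl c) e); last first.
  apply/seteqP; split => -[t v] /=.
    move=> h; split.
      by have := h 0%R; rewrite rcns0 in_itv/= ler_distl.
    by move=> i; have := h (lift 0%R i); rewrite rcnsS rtlE.
  move=> [ht hv] i; have [j ->|->] := unliftP 0%R i.
    by rewrite rcnsS -rtlE.
  by rewrite rcns0; move: ht; rewrite in_itv/= ler_distl.
rewrite product_measure1E//=; last exact: measurable_box.
rewrite IH lebesgue_measure_itv/= lte_fin; case: ifPn => [_|].
  by rewrite -EFinB -EFinM exprS; congr (_ * _)%:E; ring.
rewrite -leNgt => h; have -> : e = 0%R by apply/eqP; rewrite eq_le e0 andbT; lra.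
by rewrite mul0e mul0rn expr0n.
Qed.

End box.

(** * Polar coordinates for functions constant along rays *)

Section polar.
Variables (R : realType) (d : nat).
Hypothesis d0 : (0 < d)%N.
Local Notation mu := (@lebesgue_measure R).
Local Open Scope ereal_scope.

Lemma measure_eq_rays (m1 m2 : {measure set (measurableTypeR R) -> \bar R}) :
  (forall r : R, m1 `]-oo, r[%classic = m2 `]-oo, r[%classic) ->
  (forall r : R, m1 `]-oo, r[%classic < +oo) ->
  forall A, measurable A -> m1 A = m2 A.
Proof.
move=> m12 m1oo A mA.
apply: (@measure_unique _ R (measurableTypeR R) (@RGenInftyO.G R)
  (fun n => `]-oo, (n%:R : R)[%classic)) => //.
- exact: RGenInftyO.measurableE.
- move=> _ _ [x ->] [y ->]; exists (Num.min x y).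
  by apply/seteqP; split => z /=; rewrite !in_itv/= lt_min; [case=> -> ->|move=> /andP[]].
- by move=> i; exists i%:R.
- apply/seteqP; split => // x _; exists (Num.bound `|x|) => //=.
  by rewrite in_itv/= (le_lt_trans (ler_norm x))// archi_boundP.
- by move=> _ [x ->]; exact: m12.
Qed.

Lemma integral_ray_pow (r : R) : (0 <= r)%R ->
  \int[mu]_(t in `[0%R, r]) (d%:R * t ^+ d.-1)%:E = (r ^+ d)%:E.
Proof.
rewrite le_eqVlt => /orP[/eqP <-|r0].
  by rewrite set_itv1 integral_set1 expr0n gtn_eqF.
rewrite (@continuous_FTC2 _ _ (fun t : R => t ^+ d)%R)//.
- by rewrite expr0n gtn_eqF// sube0.
- apply: continuous_subspaceT => x; apply: cvgM; first exact: cvg_cst.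
  exact: exprn_continuous.
- split.
  + by move=> x _; exact: exprn_derivable.
  + by apply: cvg_at_right_filter; exact: exprn_continuous.
  + by apply: cvg_at_left_filter; exact: exprn_continuous.
- by move=> x _; rewrite exp_derive1.
Qed.

Variable G : 'rV[R]_d -> R.
Hypotheses (mG : measurable_fun setT G) (G0 : forall x, (0 <= G x)%R)
  (GZ : forall r x, (0 < r)%R -> G (r *: x)%R = G x)
  (Gb : exists C : R, forall x, (G x <= C)%R).

(** The open ball is the preimage of an open ray under [enorm], the shape required by
    [measure_eq_rays]; [cball_mass] passes to the closed ball of [sphere_int]. *)
Definition bmass : \bar R := \int[leb R d]_(x in [set x | (enorm x < 1)%R]) (G x)%:E.

Lemma measurable_ball (r : R) : measurable [set x : 'rV[R]_d | (enorm x < r)%R].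
Proof.
rewrite -[X in measurable X]setTI.
have mf : measurable_fun setT (fun x : 'rV[R]_d => (enorm x < r)%R).
  by apply: measurable_fun_ltr => //; exact: measurable_enorm.
have := mf measurableT [set true] I; congr (measurable (_ `&` _)).
Qed.

Lemma measurable_cball (r : R) : measurable [set x : 'rV[R]_d | (enorm x <= r)%R].
Proof.
rewrite -[X in measurable X]setTI.
have mf : measurable_fun setT (fun x : 'rV[R]_d => (enorm x <= r)%R).
  by apply: measurable_fun_ler => //; exact: measurable_enorm.
have := mf measurableT [set true] I; congr (measurable (_ `&` _)).
Qed.

Lemma coord_le_enorm (x : 'rV[R]_d) i : (`|x 0 i| <= enorm x)%R.
Proof.
rewrite -sqrtr_sqr ler_wsqrtr// /dotv (bigD1 i)//= expr2 lerDl.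
by apply: sumr_ge0 => j _; rewrite -expr2 sqr_ge0.
Qed.

Lemma leb_cball1 : leb R d [set x : 'rV[R]_d | (enorm x <= 1)%R] < +oo.
Proof.
apply: (@le_lt_trans _ _ (leb R d (box 0%R 1%R))).
  apply: le_measure; rewrite ?inE; [exact: measurable_cball|exact: measurable_box|].
  by move=> x /= x1 i; rewrite mxE subr0 (le_trans (coord_le_enorm _ _)).
by rewrite leb_box// ltry.
Qed.

Lemma bmass_fin : bmass < +oo.
Proof.
have [C GC] := Gb.
apply: (@le_lt_trans _ _ (C%:E * leb R d [set x : 'rV[R]_d | (enorm x <= 1)%R])).
  rewrite -integral_cst; last exact: measurable_cball.
  apply: (@le_trans _ _ (\int[leb R d]_(x in [set x | (enorm x < 1)%R]) C%:E)).
    apply: ge0_le_integral => //; first exact: measurable_ball.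
    - by move=> x _; rewrite lee_fin.
    - by apply: measurable_funTS; exact/measurable_EFinP.
    - by move=> x _; rewrite lee_fin.
  apply: ge0_subset_integral => //; [exact: measurable_ball|exact: measurable_cball| |].
  - by move=> x _; rewrite lee_fin (le_trans (G0 x)).
  - by move=> x /= /ltW.
rewrite lte_mul_pinfty//; first by rewrite lee_fin (le_trans (G0 0%R)).
exact: leb_cball1.
Qed.

Lemma ball_scale (r : R) : (0 < r)%R ->
  \int[leb R d]_(x in [set x | (enorm x < r)%R]) (G x)%:E = (r ^+ d)%:E * bmass.
Proof.
move=> r0; rewrite /bmass integral_mkcond [in RHS]integral_mkcond.
rewrite (ge0_integral_leb_scale r0); last 2 first.
- apply/(measurable_restrictT _ (measurable_ball _)).
  by apply: measurable_funTS; exact/measurable_EFinP.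
- by move=> x; rewrite /patch; case: ifP => // _; rewrite lee_fin.
congr (_ * _); apply: eq_integral => x _; rewrite /patch GZ//.
congr (if _ then _ else _); apply: asbool_equiv_eq => /=.
by rewrite enormZ gtr0_norm// -{2}(mulr1 r) ltr_pM2l.
Qed.

Let c : R := fine bmass.
Let c0 : (0 <= c)%R.
Proof. by apply: fine_ge0; apply: integral_ge0 => x _; rewrite lee_fin. Qed.
Let cE : bmass = c%:E.
Proof.
rewrite /c fineK// ge0_fin_numE ?bmass_fin//.
by apply: integral_ge0 => x _; rewrite lee_fin.
Qed.

(** Expected density of the image under [enorm] of the measure [G dx]: the derivative of
    [c * t ^+ d] on the half-line. *)
Let w2 (t : R) : R := if (0 <= t)%R then (c * (d%:R * t ^+ d.-1))%R else 0%R.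

Let mw2 : measurable_fun [set: measurableTypeR R] w2.
Proof.
apply: measurable_fun_ifT => //; first exact: measurable_fun_ler.
by do 2 apply: measurable_funM => //.
Qed.

Let w20 t : (0 <= w2 t)%R.
Proof. by rewrite /w2; case: ifP => // t0; rewrite !mulr_ge0// exprn_ge0. Qed.

Let menorm : measurable_fun setT (@enorm R d : _ -> measurableTypeR R).
Proof. exact: measurable_enorm. Qed.

Let m1 : {measure set (measurableTypeR R) -> \bar R} :=
  pushm (mden (leb R d) mG G0) menorm.
Let m2 : {measure set (measurableTypeR R) -> \bar R} := mden mu mw2 w20.

Let w2_itv (D : set (measurableTypeR R)) (r : R) : measurable D ->
  D `&` [set t | (0 <= t)%R] = `[0%R, r]%classic ->
  m2 D = c%:E * \int[mu]_(t in `[0%R, r]) (d%:R * t ^+ d.-1)%:E.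
Proof.
move=> mD Dr; rewrite /m2 /= /mden.
have Dr' t : D t -> (0 <= t)%R -> `[0%R, r]%classic t by move=> *; rewrite -Dr.
rewrite -ge0_integralZl//=; last 2 first.
- by apply: measurable_funTS; apply/measurable_EFinP; apply: measurable_funM => //.
- by move=> t; rewrite in_itv/= => /andP[t0 _]; rewrite lee_fin mulr_ge0// exprn_ge0.
rewrite [RHS]integral_mkcond [LHS]integral_mkcond; apply: eq_integral => t _.
rewrite /patch; case: ifPn => tD; case: ifPn => tI //; rewrite /w2.
- move: tI; rewrite inE/= in_itv/= => /andP[t0 _].
  by rewrite t0 EFinM.
- case: ifPn => // t0; move: tI; rewrite notin_setE => -[].
  by apply: Dr' => //; rewrite inE in tD.
- by move: tI tD; rewrite inE -Dr notin_setE => -[].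
Qed.

(** An open ray up to [r > 0] has mass [c * r ^+ d] for both: on the left by the scaling of balls,
    on the right by the fundamental theorem of calculus. *)
Let m12 A : measurable A -> m1 A = m2 A.
Proof.
have e r : m1 `]-oo, r[%classic = if (0 < r)%R then (r ^+ d)%:E * bmass else 0.
  rewrite /m1 /= /pushforward /mden.
  have -> : @enorm R d @^-1` `]-oo, r[%classic = [set x | (enorm x < r)%R].
    by apply/seteqP; split => x /=; rewrite in_itv.
  have [r0|r0] := ltP; first exact: ball_scale.
  rewrite (_ : [set x | _] = set0) ?integral_set0//.
  apply/seteqP; split => x //= xr.
  by have := lt_le_trans xr r0; rewrite ltNge enorm_ge0.
apply: measure_eq_rays => r; last first.
  by rewrite e; case: ifP => // r0; rewrite cE -EFinM ltry.
rewrite e; case: ifPn => r0; last first.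
  rewrite /m2 /= /mden integral_mkcond; apply/esym; rewrite -[RHS](integral0 mu setT).
  apply: eq_integral => t _; rewrite /patch; case: ifPn => //.
  rewrite inE/= in_itv/= /w2 => tr; rewrite ifF//; apply/negbTE; rewrite -ltNge.
  by rewrite (lt_le_trans tr)// leNgt.
have -> : m2 `]-oo, r[%classic = m2 `]-oo, r]%classic.
  rewrite /m2 /= /mden; apply: integral_itv_bndo_bndc.
  by apply/measurable_EFinP; exact: (measurable_funTS mw2).
rewrite (@w2_itv _ r)//; first by rewrite integral_ray_pow ?(ltW r0)// cE muleC.
by apply/seteqP; split => t /=; rewrite !in_itv/=; [case=> -> ->|move=> /andP[-> ->]].
Qed.

(** The image measure has a density, so it does not charge the point 1. *)
Lemma cball_mass : \int[leb R d]_(x in [set x | (enorm x <= 1)%R]) (G x)%:E = bmass.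
Proof.
transitivity (m1 `]-oo, 1%R]%classic).
  rewrite /m1 /= /pushforward /mden.
  have -> : (@enorm R d) @^-1` `]-oo, 1%R]%classic = [set x | (enorm x <= 1)%R].
    by apply/seteqP; split => x /=; rewrite in_itv.
  by [].
rewrite m12// (@w2_itv _ 1%R)//.
  by rewrite integral_ray_pow// expr1n mule1 cE.
by apply/seteqP; split => t /=; rewrite !in_itv/=; [case=> -> ->|move=> /andP[-> ->]].
Qed.

Lemma ge0_polar (h : R -> R) : measurable_fun setT h -> (forall t, (0 <= h t)%R) ->
  \int[leb R d]_x (h (enorm x) * G x)%:E =
  \int[mu]_(t in `[0%R, +oo[) (h t * (d%:R * t ^+ d.-1))%:E * bmass.
Proof.
move=> mh h0.
have mh' : measurable_fun setT (EFin \o h) by exact/measurable_EFinP.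
transitivity (\int[m1]_t (h t)%:E).
  rewrite /m1 (ge0_integral_pushforward menorm)//; last first.
    by move=> t _; rewrite lee_fin.
  rewrite preimage_setT ge0_integral_mden//.
  - by apply: measurableT_comp => //; exact: measurable_enorm.
  - by move=> t; rewrite lee_fin.
transitivity (\int[m2]_t (h t)%:E).
  by apply: eq_measure_integral => A mA _; exact: m12.
rewrite ge0_integral_mden//.
have mhd : measurable_fun setT (fun t : R => h t * (d%:R * t ^+ d.-1))%R.
  by apply: measurable_funM => //; apply: measurable_funM.
rewrite cE muleC -ge0_integralZl//; last 2 first.
- by apply: measurable_funTS; exact/measurable_EFinP.
- move=> t /=; rewrite in_itv/= andbT => t0.
  by rewrite lee_fin !mulr_ge0// exprn_ge0.
rewrite [RHS]integral_mkcond; apply: eq_integral => t _; rewrite /patch mem_setE.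
rewrite in_itv/= andbT /w2; case: ifP => _; last by rewrite mule0.
by rewrite -!EFinM; congr EFin; ring.
Qed.

End polar.

(** * Averages over the sphere *)

Section sphere_average.
Variables (R : realType) (d : nat).
Hypothesis d0 : (0 < d)%N.
Local Notation mu := (@lebesgue_measure R).
Implicit Types g : 'rV[R]_d -> R.

(** Bounded and measurable on the sphere. Off the sphere [g] may be anything, so measurability is
    asked of a representative [G]. *)
Definition sbm g := (exists2 G, measurable_fun setT G & forall u, enorm u = 1 -> g u = G u) /\
  exists C, forall u, enorm u = 1 -> `|g u| <= C.

Definition savg g : R := fine (sphere_int g).

Let B := [set x : 'rV[R]_d | enorm x <= 1].
Let mB : measurable B. Proof. exact: measurable_cball. Qed.

Let memB x : (x \in B) = (enorm x <= 1).
Proof. by apply/idP/idP; rewrite inE. Qed.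

(** [hatv] takes values in the sphere except at the origin, where [g 0] is unrelated to the
    representative and gets its own branch. *)
Lemma sbm_hat_measurable g : sbm g -> measurable_fun setT (g \o @hatv R d).
Proof.
move=> [[G mG gG] _].
have -> : g \o @hatv R d = fun x => if enorm x == 0 then g 0 else G (hatv x).
  apply/funext => x /=; case: ifPn => [|x0].
    by rewrite enorm_eq0 => /eqP ->; rewrite /hatv scaler0.
  by rewrite gG// enorm_hat// -enorm_eq0.
apply: measurable_fun_ifT => //.
  by apply: measurable_fun_eqr => //; exact: measurable_enorm.
exact: (measurableT_comp mG (@measurable_hatv R d)).
Qed.

Lemma sbm_hat_bounded g : sbm g -> exists C, forall x, `|g (hatv x)| <= C.
Proof.
move=> [_ [C gC]]; exists (Num.max C `|g 0|) => x; rewrite le_max.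
have [->|x0] := eqVneq x 0; first by rewrite /hatv scaler0 lexx orbT.
by rewrite gC// enorm_hat.
Qed.

Lemma enorm_box (x : 'rV[R]_d) (e : R) : 0 <= e ->
  box 0 (e / d%:R) x -> enorm x <= e.
Proof.
move=> e0 xb; have dp : (0 : R) < d%:R by rewrite ltr0n.
rewrite -(ler_sqr (x := enorm x)) ?nnegrE ?enorm_ge0// sqr_enorm.
apply: (@le_trans _ _ (\sum_(i < d) (e / d%:R) ^+ 2)).
  apply: ler_sum => i _; rewrite -expr2 -[leLHS]real_normK ?num_real//.
  rewrite lerXn2r ?nnegrE//; first by rewrite divr_ge0// ltW.
  by have := xb i; rewrite mxE subr0.
rewrite sumr_const card_ord -[leLHS]mulr_natr expr_div_n.
have -> : e ^+ 2 / d%:R ^+ 2 * d%:R = e ^+ 2 / d%:R :> R.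
  by field; rewrite gt_eqF.
by rewrite ler_pdivrMr// ler_peMr ?sqr_ge0// ler1n.
Qed.

Lemma leb_point0 : leb R d [set 0] = 0%E.
Proof.
have -> : [set 0] = box (0 : 'rV[R]_d) 0.
  apply/seteqP; split => [x -> i|x xb]; first by rewrite !mxE subr0 normr0.
  by apply/rowP => i; rewrite mxE; have := xb i; rewrite mxE subr0 normr_le0 => /eqP.
by rewrite leb_box// mul0rn expr0n gtn_eqF.
Qed.

Lemma bounded_integrable (f : 'rV[R]_d -> R) (C : R) : measurable_fun setT f ->
  (forall x, B x -> `|f x| <= C) -> (leb R d).-integrable B (EFin \o f).
Proof.
move=> mf fC.
apply: (@le_integrable _ _ _ (leb R d) B mB _ (cst C%:E)).
- by apply: measurable_funTS; exact/measurable_EFinP.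
- by move=> x Bx /=; rewrite lee_fin (le_trans (fC _ Bx))// ler_norm.
- apply/integrableP; split => //; rewrite /= integral_cst// lte_mul_pinfty//.
  exact: leb_cball1.
Qed.

Lemma indic_ballE (f : 'rV[R]_d -> R) :
  (fun x => ((if enorm x <= 1 then 1 else 0) * f x)%:E) = (EFin \o f) \_ B.
Proof.
apply/funext => x; rewrite /patch memB.
by case: ifP => _; rewrite /= ?mul1r ?mul0r.
Qed.

Lemma iint_ballE (f : 'rV[R]_d -> R) (C : R) : measurable_fun setT f ->
  (forall x, B x -> `|f x| <= C) ->
  iint (fun x => (if enorm x <= 1 then 1 else 0) * f x) =
  (\int[leb R d]_(x in B) f x)%:E.
Proof.
move=> mf fC; rewrite iintE.
  rewrite indic_ballE -integral_mkcond /Rintegral fineK//.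
  exact/integrable_fin_num/(bounded_integrable mf fC).
have := bounded_integrable mf fC; rewrite (integrable_mkcond _ mB).
by rewrite -indic_ballE.
Qed.

Lemma ball_volE : ball_vol R d = fine (leb R d B).
Proof.
rewrite /ball_vol (_ : (fun x => _) =
   fun x : 'rV[R]_d => (if enorm x <= 1 then 1 else 0) * cst 1 x).
  rewrite (@iint_ballE _ 1)//; last by move=> x _; rewrite normr1.
  by rewrite Rintegral_cst// mul1r.
by apply/funext => x; rewrite mulr1.
Qed.

Lemma ball_vol_gt0 : 0 < ball_vol R d.
Proof.
have dp : (0 : R) < d%:R by rewrite ltr0n.
rewrite ball_volE fine_gt0// leb_cball1 andbT.
apply: (@lt_le_trans _ _ (leb R d (box 0 (1 / d%:R)))).
  by rewrite leb_box ?divr_ge0// lte_fin exprn_gt0// pmulrn_lgt0// divr_gt0.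
apply: le_measure; rewrite ?inE//; first exact: measurable_box.
by move=> x; exact: enorm_box.
Qed.
Hint Resolve ball_vol_gt0 : core.

Lemma sphere_intE g : sbm g ->
  sphere_int g = ((\int[leb R d]_(x in B) g (hatv x)) / ball_vol R d)%:E.
Proof.
move=> gs; have [C gC] := sbm_hat_bounded gs.
rewrite /sphere_int (iint_ballE (sbm_hat_measurable gs) (fun x _ => gC x)).
by rewrite -EFinM.
Qed.

Lemma savgE g : sbm g ->
  savg g = (\int[leb R d]_(x in B) g (hatv x)) / ball_vol R d.
Proof. by move=> gs; rewrite /savg sphere_intE. Qed.

Lemma sbm_integrable g : sbm g -> (leb R d).-integrable B (EFin \o (g \o @hatv R d)).
Proof.
move=> gs; have [C gC] := sbm_hat_bounded gs.
exact: (bounded_integrable (sbm_hat_measurable gs) (fun x _ => gC x)).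
Qed.

Lemma sbm_ext g g' : (forall u, enorm u = 1 -> g u = g' u) -> sbm g -> sbm g'.
Proof.
move=> gg' [[G mG gG] [C gC]]; split; first by exists G => // u u1; rewrite -gg'// gG.
by exists C => u u1; rewrite -gg'// gC.
Qed.

(** The two integrands over the ball can differ at the origin only, a null set. *)
Lemma savg_ext g g' : (forall u, enorm u = 1 -> g u = g' u) -> sbm g ->
  savg g = savg g'.
Proof.
move=> gg' gs; have gs' := sbm_ext gg' gs.
rewrite !savgE//; congr (_ / _); rewrite /Rintegral; congr fine.
have m g1 : sbm g1 -> measurable_fun B (EFin \o (g1 \o @hatv R d)).
  by move=> ?; apply: measurable_funTS; apply/measurable_EFinP; exact: sbm_hat_measurable.
apply: ae_eq_integral => //; [exact: (m _ gs)|exact: (m _ gs')|].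
exists [set 0]; split; [|exact: leb_point0|].
  have -> : [set 0] = box (0 : 'rV[R]_d) 0; last exact: measurable_box.
  apply/seteqP; split => [x -> i|x xb]; first by rewrite !mxE subr0 normr0.
  by apply/rowP => i; rewrite mxE; have := xb i; rewrite mxE subr0 normr_le0 => /eqP.
move=> x /=; apply: contra_notP => x0 _; congr EFin; apply: gg'.
by apply: enorm_hat; apply/eqP.
Qed.

Lemma sbm_cst c : sbm (cst c).
Proof. by split; [exists (cst c)|exists `|c|]. Qed.

Lemma sbmD g g' : sbm g -> sbm g' -> sbm (fun u => g u + g' u).
Proof.
move=> [[G mG gG] [C gC]] [[G' mG' gG'] [C' gC']]; split.
  by exists (fun u => G u + G' u); [exact: measurable_funD|move=> u u1; rewrite gG// gG'].
by exists (C + C') => u u1; rewrite (le_trans (ler_normD _ _))// lerD ?gC ?gC'.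
Qed.

Lemma sbmM g g' : sbm g -> sbm g' -> sbm (fun u => g u * g' u).
Proof.
move=> [[G mG gG] [C gC]] [[G' mG' gG'] [C' gC']]; split.
  by exists (fun u => G u * G' u); [exact: measurable_funM|move=> u u1; rewrite gG// gG'].
by exists (C * C') => u u1; rewrite normrM ler_pM ?gC ?gC'.
Qed.

Lemma sbmZ c g : sbm g -> sbm (fun u => c * g u).
Proof. exact: (sbmM (sbm_cst c)). Qed.

Lemma sbm_norm g : sbm g -> sbm (fun u => `|g u|).
Proof.
move=> [[G mG gG] [C gC]]; split.
  by exists (fun u => `|G u|); [exact: measurableT_comp|move=> u u1; rewrite gG].
by exists C => u u1; rewrite normr_id gC.
Qed.

Lemma sbm_sum (I : Type) (r : seq I) (P : pred I) (g : I -> 'rV[R]_d -> R) :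
  (forall i, P i -> sbm (g i)) -> sbm (fun u => \sum_(i <- r | P i) g i u).
Proof.
move=> gs; elim: r => [|i r IH].
  by apply: sbm_ext (sbm_cst 0) => u _; rewrite big_nil.
have [Pi|Pi] := boolP (P i).
  by apply: sbm_ext (sbmD (gs i Pi) IH) => u _; rewrite big_cons Pi.
by apply: sbm_ext IH => u _; rewrite big_cons (negbTE Pi).
Qed.

Lemma coord_le_enorm1 (u : 'rV[R]_d) i : enorm u = 1 -> `|u 0 i| <= 1.
Proof. by move=> <-; exact: coord_le_enorm. Qed.

Lemma sbm_coord i : sbm (fun u => u 0 i).
Proof.
split; first by exists (fun u : 'rV[R]_d => u 0 i) => //; exact: measurable_row_coord.
by exists 1 => u; exact: coord_le_enorm1.
Qed.

(** The representative uses the extension of [kappa] by 0 outside [[-1, 1]]; the bound comes from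
    the extreme value theorem. *)
Lemma sbm_zonal (kappa : R -> R) (u : 'rV[R]_d) : enorm u = 1 ->
  {within `[-1, 1], continuous kappa} -> sbm (fun v => kappa (dotv u v)).
Proof.
move=> u1 ck.
have mk : measurable_fun setT (kappa \_ `[-1, 1]).
  apply/(measurable_restrictT _ (measurable_itv _)).
  exact: subspace_continuous_measurable_fun.
split.
  exists (fun v => (kappa \_ `[-1, 1]) (dotv u v)).
    by apply: (measurableT_comp mk); exact: measurable_dotv.
  by move=> v v1; rewrite patchE mem_set//= in_itv/=; exact: dotv_le1.
have le11 : (-1 : R) <= 1 by lra.
have [a aI amax] := EVT_max le11 ck; have [b bI bmin] := EVT_min le11 ck.
exists (`|kappa a| + `|kappa b|) => v v1.
have vI : dotv u v \in `[-1, 1] by rewrite in_itv/=; exact: dotv_le1.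
have := amax _ vI; have := bmin _ vI => h1 h2.
rewrite ler_norml; apply/andP; split.
- have := ler_norm (- kappa b); rewrite normrN; have := normr_ge0 (kappa a); lra.
- have := ler_norm (kappa a); have := normr_ge0 (kappa b); lra.
Qed.

Lemma sbm_refl n g : enorm n = 1 -> sbm g -> sbm (fun u => g (refl n u)).
Proof.
move=> n1 [[G mG gG] [C gC]]; have [mr _] := lpres_refl n1; split.
  exists (G \o refl n); first exact: measurableT_comp.
  by move=> u u1 /=; rewrite gG// enorm_refl.
by exists C => u u1; rewrite gC// enorm_refl.
Qed.

Lemma savgD g g' : sbm g -> sbm g' -> savg (fun u => g u + g' u) = savg g + savg g'.
Proof.
move=> gs gs'; rewrite !savgE//; last exact: sbmD.
by rewrite -mulrDl RintegralD//; exact: sbm_integrable.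
Qed.

Lemma savgZ c g : sbm g -> savg (fun u => c * g u) = c * savg g.
Proof.
move=> gs; rewrite !savgE//; last exact: sbmZ.
by rewrite mulrA RintegralZl//; exact: sbm_integrable.
Qed.

Lemma savg_cst c : savg (cst c) = c.
Proof.
rewrite savgE; last exact: sbm_cst.
by rewrite Rintegral_cst// -ball_volE mulfK// gt_eqF.
Qed.

Lemma savg_sum (I : Type) (r : seq I) (g : I -> 'rV[R]_d -> R) :
  (forall i, sbm (g i)) ->
  savg (fun u => \sum_(i <- r) g i u) = \sum_(i <- r) savg (g i).
Proof.
move=> gs; elim: r => [|i r IH].
  rewrite big_nil -[RHS](savg_cst 0); apply: savg_ext => [u _|].
    by rewrite big_nil.
  by apply: sbm_ext (sbm_cst 0) => u _; rewrite big_nil.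
have ss := sbm_sum r (P := xpredT) (fun i _ => gs i).
rewrite big_cons -IH -savgD//; apply: savg_ext => [u _|]; first by rewrite big_cons.
by apply: sbm_ext (sbmD (gs i) ss) => u _; rewrite big_cons.
Qed.

Lemma savg_ge0 g : sbm g -> (forall u, enorm u = 1 -> 0 <= g u) -> 0 <= savg g.
Proof.
move=> gs g0; have -> : savg g = savg (fun u => `|g u|).
  by apply: savg_ext => // u u1; rewrite ger0_norm// g0.
rewrite savgE; last exact: sbm_norm.
by rewrite divr_ge0// ?(ltW ball_vol_gt0)//; apply: Rintegral_ge0.
Qed.

Lemma savgB g g' : sbm g -> sbm g' -> savg (fun u => g u - g' u) = savg g - savg g'.
Proof.
move=> gs gs'; have gs'' := sbmZ (-1) gs'.
rewrite -[- savg g']mulN1r -(savgZ _ gs') -savgD//.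
by apply: savg_ext => [u _|]; [rewrite mulN1r|apply: sbm_ext (sbmD gs gs'') => u _; rewrite mulN1r].
Qed.

Lemma savg_le g g' : sbm g -> sbm g' -> (forall u, enorm u = 1 -> g u <= g' u) ->
  savg g <= savg g'.
Proof.
move=> gs gs' gg'; rewrite -subr_ge0 -savgB//; apply: savg_ge0.
  apply: sbm_ext (sbmD gs' (sbmZ (-1) gs)) => u _; by rewrite mulN1r.
by move=> u u1; rewrite subr_ge0 gg'.
Qed.

Lemma savg_norm g : sbm g -> `|savg g| <= savg (fun u => `|g u|).
Proof.
move=> gs; have ngs := sbm_norm gs; rewrite ler_norml; apply/andP; split.
  rewrite -mulN1r -savgZ//; apply: savg_le => //; first exact: sbmZ.
  by move=> u _; rewrite mulN1r lerNl -normrN ler_norm.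
by apply: savg_le => // u _; exact: ler_norm.
Qed.

Lemma hatv_refl (n x : 'rV[R]_d) : enorm n = 1 -> hatv (refl n x) = refl n (hatv x).
Proof.
move=> n1; rewrite /hatv enorm_refl// -[(enorm x)^-1 *: x]addr0 refl_linear.
by rewrite [X in _ = _ + X]refl_fix ?addr0// dot0v.
Qed.

Lemma savg_refl n g : enorm n = 1 -> sbm g -> savg (fun u => g (refl n u)) = savg g.
Proof.
move=> n1 gs; have rs := sbm_refl n1 gs; rewrite !savgE//; congr (_ / _).
rewrite [LHS]Rintegral_mkcond [RHS]Rintegral_mkcond /Rintegral; congr fine.
have [mr hr] := lpres_refl n1.
set f := EFin \o ((fun x => g (hatv x)) \_ B).
have mf : measurable_fun setT f.
  apply/measurable_EFinP; apply/(measurable_restrictT _ mB).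
  by apply: measurable_funTS; exact: sbm_hat_measurable.
transitivity (\int[leb R d]_x f (refl n x))%E.
  apply: eq_integral => x _; rewrite /f /= !patchE -hatv_refl//.
  by rewrite !memB enorm_refl.
rewrite [LHS]integralE [RHS]integralE; congr (_ - _)%E.
- transitivity (\int[leb R d]_x (f^\+)%E (refl n x))%E.
    by apply: eq_integral => x _; rewrite !funeposE.
  by apply: hr => //; exact: measurable_funepos.
- transitivity (\int[leb R d]_x (f^\-)%E (refl n x))%E.
    by apply: eq_integral => x _; rewrite !funenegE.
  by apply: hr => //; exact: measurable_funeneg.
Qed.

Lemma dotv_le_enorm (x y : 'rV[R]_d) : `|dotv x y| <= enorm x * enorm y.
Proof.
have [->|x0] := eqVneq x 0; first by rewrite dot0v normr0 mulr_ge0// enorm_ge0.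
have [->|y0] := eqVneq y 0.
  by rewrite dotvC dot0v normr0 mulr_ge0// enorm_ge0.
have := dotv_le1 (enorm_hat x0) (enorm_hat y0).
rewrite -ler_norml /hatv dotvZl dotvZr !normrM !normfV !(ger0_norm (enorm_ge0 _)).
have xy0 : 0 < enorm x * enorm y by rewrite mulr_gt0 ?enorm_gt0.
by rewrite mulrA -invfM ler_pdivrMl// mulr1.
Qed.

(* A box around [u0 / 2] lies inside the cone over a cap around [u0]. *)
Lemma savg_gt0 g (u0 : 'rV[R]_d) (dl c : R) : sbm g -> enorm u0 = 1 ->
  (forall u, enorm u = 1 -> 0 <= g u) -> 0 < c -> 0 < dl ->
  (forall u, enorm u = 1 -> 1 - dl <= dotv u0 u -> c <= g u) -> 0 < savg g.
Proof.
move=> gs u01 g0 c0 dl0 gc.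
have dp : (0 : R) < d%:R by rewrite ltr0n.
(* [4 * e <= dl] gives [(1 - dl) * (1/2 + e) <= 1/2 - e], hence the bound on the cosine; [e <= 1/4]
   keeps the cube in the unit ball and away from the origin. *)
pose e := Num.min (dl / 4) (1 / 4); have e0 : 0 < e.
  by rewrite lt_min !divr_gt0.
have ed : 4 * e <= dl.
  have : e <= dl / 4 by rewrite ge_min lexx.
  lra.
have e4 : e <= 1 / 4 by rewrite ge_min lexx orbT.
pose D := box (2^-1 *: u0) (e / d%:R).
have mD : measurable D by exact: measurable_box.
have Dx x : D x -> [/\ x != 0, enorm x <= 1 & 1 - dl <= dotv u0 (hatv x)].
  move=> Dx; set y := x - 2^-1 *: u0.
  have yE : enorm y <= e.
    apply: enorm_box; first exact: ltW.
    by move=> i; have := Dx i; rewrite /y !mxE subr0.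
  have xE : x = 2^-1 *: u0 + y by rewrite /y addrC subrK.
  clearbody y.
  have uy : `|dotv u0 y| <= e.
    by rewrite (le_trans (dotv_le_enorm _ _))// u01 mul1r.
  have ux : dotv u0 x = 2^-1 + dotv u0 y by rewrite xE dotvDr dotvZr dotvv// mulr1.
  move: uy; rewrite ler_norml => /andP[uy1 uy2].
  have yy : dotv y y <= e ^+ 2.
    by rewrite -sqr_enorm lerXn2r ?nnegrE ?enorm_ge0// ltW.
  have xx : enorm x <= 2^-1 + e.
    rewrite -(ler_sqr (x := enorm x)) ?nnegrE ?enorm_ge0//; last by lra.
    rewrite sqr_enorm xE !(dotvDl, dotvDr, dotvZl, dotvZr) (dotvC y u0) dotvv//.
    nra.
  have x0 : x != 0.
    apply: contraTneq isT => x0; move: ux; rewrite x0 dotvC dot0v; lra.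
  have ex : 0 < enorm x by rewrite enorm_gt0.
  split => //; first by lra.
  rewrite dotvZr mulrC ler_pdivlMr// ux; nra.
have gD x : D x -> c <= g (hatv x) by move=> /Dx[x0 _ h]; rewrite gc// enorm_hat.
have DB : D `<=` B by move=> x /Dx[].
have cD : 0 < (\int[leb R d]_(x in D) c).
  have lD : leb R d D = ((e / d%:R *+ 2) ^+ d)%:E.
    by apply: leb_box; rewrite divr_ge0 ?ltW.
  rewrite Rintegral_cst// mulr_gt0//; rewrite [ltRHS](congr1 fine lD) /=.
  by rewrite exprn_gt0// pmulrn_lgt0// divr_gt0.
have ns := sbm_norm gs.
have -> : savg g = savg (fun u => `|g u|).
  by apply: savg_ext => // u u1; rewrite ger0_norm// g0.
rewrite savgE// divr_gt0//; apply: (lt_le_trans cD).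
apply: (@le_trans _ _ (\int[leb R d]_(x in D) `|g (hatv x)|)).
  apply: le_Rintegral => //.
  - by apply: (@integrableS _ _ _ _ B) => //; apply: (@bounded_integrable (cst c) `|c|).
  - by apply: (@integrableS _ _ _ _ B) => //; exact: (sbm_integrable ns).
  - by move=> x /gD h; rewrite (le_trans h)// ler_norm.
have h0 : (leb R d).-integrable B (EFin \o (fun x => `|g (hatv x)|)).
  exact: (sbm_integrable ns).
rewrite /Rintegral fine_le//.
- exact/integrable_fin_num/(integrableS mB mD DB h0).
- exact/integrable_fin_num/h0.
- apply: ge0_subset_integral => //.
  by case/integrableP: h0.
Qed.

(** * Integrals of radial times angular functions *)

Lemma sphere_areaM (t : R) : sphere_area d t = ball_vol R d * (d%:R * t ^+ d.-1).
Proof. by rewrite /sphere_area; ring. Qed.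

Lemma measurable_sphere_area : measurable_fun setT (@sphere_area R d).
Proof.
rewrite (_ : @sphere_area R d = fun t => ball_vol R d * (d%:R * t ^+ d.-1)).
  by do 2 apply: measurable_funM => //.
by apply/funext => t; exact: sphere_areaM.
Qed.

Let rint (psi : R -> R) g x := psi (enorm x) / sphere_area d (enorm x) * g (hatv x).

Let measurable_rint (psi : R -> R) g : measurable_fun setT psi -> sbm g ->
  measurable_fun setT (rint psi g).
Proof.
move=> mp gs; apply: measurable_funM; last exact: sbm_hat_measurable.
apply: measurable_funM; first exact: (measurableT_comp mp (@measurable_enorm R d)).
apply: (measurableT_comp (@measurable_invr R)).
exact: (measurableT_comp measurable_sphere_area (@measurable_enorm R d)).
Qed.

(** Dividing by [sphere_area] cancels both the polar Jacobian and the ball volume, leaving the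
    integral of [psi] on the half-line. *)
Let ge0_rint (psi : R -> R) g : measurable_fun setT psi -> (forall t, 0 <= psi t) -> sbm g ->
  (forall u, 0 <= g u) ->
  (\int[leb R d]_x (rint psi g x)%:E =
   \int[mu]_(t in `[0%R, +oo[) (psi t)%:E * (savg g)%:E)%E.
Proof.
move=> mp p0 gs g0.
(* [sphere_area] can be negative at negative [t], while [ge0_polar] wants a nonnegative radial
   factor; the cut changes the integrand at most at the origin. *)
pose h (t : R) := if 0 < t then psi t / sphere_area d t else 0.
have A0 (t : R) : 0 <= t -> 0 <= sphere_area d t.
  by move=> t0; rewrite sphere_areaM mulr_ge0 ?(ltW ball_vol_gt0)// mulr_ge0// exprn_ge0.
have h0 t : 0 <= h t.
  by rewrite /h; case: ifP => // t0; rewrite divr_ge0// A0// ltW.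
have mh : measurable_fun setT h.
  apply: measurable_fun_ifT => //; first exact: measurable_fun_ltr.
  apply: measurable_funM => //.
  exact: (measurableT_comp (@measurable_invr R) measurable_sphere_area).
have mgh := sbm_hat_measurable gs.
have [C gC] := sbm_hat_bounded gs.
have bm : bmass (g \o @hatv R d) = (ball_vol R d * savg g)%:E.
  rewrite -(cball_mass d0 mgh) => [|x|r x r0|]; rewrite /= ?g0//.
  - rewrite savgE// mulrCA divff ?gt_eqF// mulr1 /Rintegral fineK//.
    exact/integrable_fin_num/(sbm_integrable gs).
  - by rewrite hatvZ.
  - by exists C => x; rewrite (le_trans _ (gC x))// ler_norm.
transitivity (\int[leb R d]_x (h (enorm x) * (g \o @hatv R d) x)%:E)%E.
  apply: ae_eq_integral => //.
  - by apply/measurable_EFinP; exact: measurable_rint.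
  - apply/measurable_EFinP; apply: measurable_funM => //.
    exact: (measurableT_comp mh (@measurable_enorm R d)).
  - exists [set 0]; split; [|exact: leb_point0|].
      have -> : [set 0] = box (0 : 'rV[R]_d) 0; last exact: measurable_box.
      apply/seteqP; split => [x -> i|x xb]; first by rewrite !mxE subr0 normr0.
      by apply/rowP => i; rewrite mxE; have := xb i; rewrite mxE subr0 normr_le0 => /eqP.
    move=> x /=; apply: contra_notP => /eqP x0 _.
    by rewrite /h enorm_gt0 x0.
rewrite (ge0_polar d0 mgh)//; first last.
- by exists C => x; rewrite (le_trans _ (gC x))// ler_norm.
- by move=> r x r0 /=; rewrite hatvZ.
- by move=> x /=; exact: g0.
rewrite bm EFinM muleA; congr (_ * _)%E.
have mhd : measurable_fun setT (fun t : R => h t * (d%:R * t ^+ d.-1)).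
  by apply: measurable_funM => //; apply: measurable_funM.
rewrite -[LHS]ge0_integralZr//; last 3 first.
- by apply: measurable_funTS; exact/measurable_EFinP.
- by move=> t /=; rewrite in_itv/= andbT => t0; rewrite lee_fin mulr_ge0// mulr_ge0// exprn_ge0.
- by rewrite lee_fin ltW.
(* The endpoint 0 is dropped so that [sphere_area d t] is invertible. *)
rewrite -[LHS]integral_itv_obnd_cbnd -1?[RHS]integral_itv_obnd_cbnd; first last.
- by apply: measurable_funTS; apply/measurable_EFinP; apply: measurable_funM.
- by apply: measurable_funTS; exact/measurable_EFinP.
apply: eq_integral => t; rewrite inE/= in_itv/= andbT => t0.
rewrite /h t0 -EFinM sphere_areaM; congr EFin.
by field; rewrite !gt_eqF ?exprn_gt0// ltr0n.
Qed.

Let integrable_rint (psi : R -> R) g : measurable_fun setT psi ->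
  mu.-integrable `[0%R, +oo[ (EFin \o psi) -> sbm g ->
  (leb R d).-integrable setT (EFin \o rint psi g).
Proof.
move=> mp ip gs; apply/integrableP; split.
  by apply/measurable_EFinP; exact: measurable_rint.
have -> : (\int[leb R d]_x `|(EFin \o rint psi g) x| =
  \int[leb R d]_x (rint (fun t => `|psi t|) (fun u => `|g u|) x)%:E)%E.
  apply: eq_integral => x _ /=; rewrite /rint !normrM normfV; congr (EFin (_ / _ * _)).
  rewrite ger0_norm// sphere_areaM mulr_ge0 ?(ltW ball_vol_gt0)// mulr_ge0//.
  by rewrite exprn_ge0// enorm_ge0.
rewrite ge0_rint//; [|exact: measurableT_comp|exact: sbm_norm].
case/integrableP: ip => _ /= ip; rewrite lte_mul_pinfty//.
- by apply: integral_ge0 => t _; rewrite lee_fin.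
- by rewrite ge0_fin_numE// integral_ge0// => t _; rewrite lee_fin.
- exact: ltry.
Qed.

Let Rge0_rint (psi : R -> R) g : measurable_fun setT psi -> (forall t, 0 <= psi t) -> 
  mu.-integrable `[0%R, +oo[ (EFin \o psi) -> sbm g ->
  (forall u, 0 <= g u) ->
  \int[leb R d]_x rint psi g x = (\int[mu]_(t in `[0%R, +oo[) psi t) * savg g.
Proof.
move=> mp p0 ip gs g0; rewrite /Rintegral ge0_rint//.
by rewrite fineM//; exact: integrable_fin_num.
Qed.

Let Rint_ge0psi (psi : R -> R) g : measurable_fun setT psi -> (forall t, 0 <= psi t) -> 
  mu.-integrable `[0%R, +oo[ (EFin \o psi) -> sbm g ->
  \int[leb R d]_x rint psi g x = (\int[mu]_(t in `[0%R, +oo[) psi t) * savg g.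
Proof.
move=> mp p0 ip gs; have [C gC] := sbm_hat_bounded gs.
(* A shift makes [g] nonnegative at every [hatv x]; the absolute value extends this to all vectors,
   where [g] itself is not controlled. *)
pose g1 u := `|g u + C|; have g1s : sbm g1.
  by apply: sbm_norm; apply: sbmD => //; exact: sbm_cst.
have C0 : 0 <= C by rewrite (le_trans _ (gC 0)).
have gE x : g (hatv x) = g1 (hatv x) - cst C (hatv x).
  rewrite /g1 ger0_norm ?addrK//; have := gC x; rewrite ler_norml => /andP[h _].
  by rewrite -lerBlDr sub0r.
have -> : savg g = savg g1 - savg (cst C).
  rewrite -savgB//; last exact: sbm_cst.
  apply: savg_ext => // u u1; have := gE u; rewrite /hatv u1 invr1 scale1r //.
have cs := sbm_cst C.
have g10 u : 0 <= g1 u by exact: normr_ge0.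
rewrite mulrBr -(Rge0_rint mp p0 ip g1s g10) -(Rge0_rint mp p0 ip cs (fun=> C0)).
rewrite -RintegralB//; [|exact: integrable_rint..].
by apply: eq_Rintegral => x _; rewrite /rint gE mulrBr.
Qed.

Let patched (psi : R -> R) g : mu.-integrable `[0%R, +oo[ (EFin \o psi) -> sbm g ->
  let psi' := psi \_ `[0%R, +oo[ in
  [/\ measurable_fun setT psi', mu.-integrable `[0%R, +oo[ (EFin \o psi'),
      forall t, 0 <= t -> psi' t = psi t &
      (fun x => psi (enorm x) / sphere_area d (enorm x) * g (hatv x)) = rint psi' g].
Proof.
move=> ip gs psi'.
have mp : measurable_fun setT psi'.
  apply/(measurable_restrictT _ (measurable_itv _)); apply/measurable_EFinP.
  by case/integrableP: ip.
have pE t : 0 <= t -> psi' t = psi t.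
  by move=> t0; rewrite /psi' patchE mem_set//= in_itv/= t0.
split=> //.
  apply: eq_integrable ip => // t; rewrite inE/= in_itv/= andbT => t0.
  by rewrite /= pE.
by apply/funext => x; rewrite /rint pE// enorm_ge0.
Qed.

Lemma polar_integrable (psi : R -> R) g :
  mu.-integrable `[0%R, +oo[ (EFin \o psi) -> sbm g ->
  (leb R d).-integrable setT
    (EFin \o (fun x => psi (enorm x) / sphere_area d (enorm x) * g (hatv x))).
Proof.
by move=> ip gs; have [mp ip' _ ->] := patched ip gs; exact: integrable_rint.
Qed.

(** The bridge from [Top] and [L2ip] to moments of [p] times spherical averages; a signed [psi] is
    split into its two parts. *)
Lemma polar_iint (psi : R -> R) g : mu.-integrable `[0%R, +oo[ (EFin \o psi) -> sbm g ->
  iint (fun x => psi (enorm x) / sphere_area d (enorm x) * g (hatv x)) =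
  ((\int[mu]_(t in `[0%R, +oo[) psi t) * savg g)%:E.
Proof.
move=> ip gs; have [mp ip' pE ->] := patched ip gs; set psi' := patch _ _ _ in mp ip' pE *.
rewrite iintE; last exact: integrable_rint.
have -> : \int[mu]_(t in `[0%R, +oo[) psi t = \int[mu]_(t in `[0%R, +oo[) psi' t.
  by apply: eq_Rintegral => t; rewrite inE/= in_itv/= andbT => t0; rewrite pE.
rewrite -[LHS]fineK; last by apply: integrable_fin_num => //; exact: integrable_rint.
congr EFin; rewrite -[LHS]/(\int[leb R d]_x rint psi' g x).
pose pp := (psi' ^\+)%R; pose pn := (psi' ^\-)%R.
have mpp : measurable_fun setT pp by exact: measurable_funrpos.
have mpn : measurable_fun setT pn by exact: measurable_funrneg.
have ipp : mu.-integrable `[0%R, +oo[ (EFin \o pp) by exact: integrable_funrpos.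
have ipn : mu.-integrable `[0%R, +oo[ (EFin \o pn) by exact: integrable_funrneg.
have ppn t : psi' t = pp t - pn t by have /(congr1 (fun f => f t)) := funrposBneg psi'.
transitivity (\int[leb R d]_x (rint pp g x - rint pn g x)).
  by apply: eq_Rintegral => x _; rewrite /rint ppn !mulrBl.
rewrite RintegralB//; [|exact: integrable_rint..].
rewrite !Rint_ge0psi//; [|exact: funrneg_ge0|exact: funrpos_ge0].
rewrite -mulrBl -RintegralB//; congr (_ * _).
by apply: eq_Rintegral => t _; rewrite -ppn.
Qed.

End sphere_average.

(** * Homogeneous polynomials and harmonic decomposition *)

Section homogeneous.
Variables (R : realType) (d : nat).
Implicit Types (P Q f g Y : 'rV[R]_d -> R) (x y v : 'rV[R]_d).

(** An inductive counterpart of [homog_poly], equivalent to it: closure under products, derivatives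
    and linear substitutions becomes a structural induction instead of a computation on
    coefficients. *)
Inductive hpoly : nat -> ('rV[R]_d -> R) -> Prop :=
| hpoly0 k : hpoly k (fun=> 0)
| hpolyC c : hpoly 0 (fun=> c)
| hpolyD k f g : hpoly k f -> hpoly k g -> hpoly k (fun x => f x + g x)
| hpolyX k i f : hpoly k f -> hpoly k.+1 (fun x => x 0 i * f x).

Lemma hpoly_ext k f g : f =1 g -> hpoly k f -> hpoly k g.
Proof. by move=> /funext ->. Qed.

Lemma hpolyZ k c f : hpoly k f -> hpoly k (fun x => c * f x).
Proof.
elim=> {k f} [k|c'|k f g _ hf _ hg|k i f _ hf].
- by apply: hpoly_ext (hpoly0 k) => x; rewrite mulr0.
- exact: (hpolyC (c * c')).
- by apply: hpoly_ext (hpolyD hf hg) => x; rewrite mulrDr.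
- by apply: hpoly_ext (hpolyX i hf) => x; rewrite mulrCA.
Qed.

Lemma hpolyB k f g : hpoly k f -> hpoly k g -> hpoly k (fun x => f x - g x).
Proof.
move=> hf /(hpolyZ (-1)) hg; apply: hpoly_ext (hpolyD hf hg) => x.
by rewrite mulN1r.
Qed.

Lemma hpoly_sum (I : Type) (r : seq I) (p : pred I) k (f : I -> 'rV[R]_d -> R) :
  (forall i, p i -> hpoly k (f i)) -> hpoly k (fun x => \sum_(i <- r | p i) f i x).
Proof.
move=> hf; elim: r => [|i r IH].
  by apply: hpoly_ext (hpoly0 k) => x; rewrite big_nil.
have [pi|pi] := boolP (p i).
  by apply: hpoly_ext (hpolyD (hf i pi) IH) => x; rewrite big_cons pi.
by apply: hpoly_ext IH => x; rewrite big_cons (negbTE pi).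
Qed.

Lemma hpolyM k l f g : hpoly k f -> hpoly l g -> hpoly (k + l) (fun x => f x * g x).
Proof.
move=> hf hg; elim: hf => {k f} [k|c|k f f' _ hf _ hf'|k i f _ hf].
- by apply: hpoly_ext (hpoly0 _) => x; rewrite mul0r.
- exact: hpolyZ.
- by apply: hpoly_ext (hpolyD hf hf') => x; rewrite mulrDl.
- by apply: hpoly_ext (hpolyX i hf) => x; rewrite mulrA.
Qed.

Lemma hpoly_coord i : hpoly 1 (fun x => x 0 i).
Proof. by apply: hpoly_ext (hpolyX i (hpolyC 1)) => x; rewrite mulr1. Qed.

Lemma hpoly_exp k n f : hpoly k f -> hpoly (k * n) (fun x => f x ^+ n).
Proof.
move=> hf; elim: n => [|n IH]; first by rewrite muln0; exact: hpolyC.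
by rewrite mulnS; apply: hpoly_ext (hpolyM hf IH) => x; rewrite exprS.
Qed.

Lemma hpoly_dotv u : hpoly 1 (dotv u).
Proof. by apply: hpoly_sum => i _; apply: hpolyZ; exact: hpoly_coord. Qed.

Definition sqn x : R := dotv x x.

Lemma hpoly_sqn : hpoly 2 sqn.
Proof. by apply: hpoly_sum => i _; exact: (hpolyX i (hpoly_coord i)). Qed.

Lemma homog_poly_hpoly k P : homog_poly k P -> hpoly k P.
Proof.
move=> [c Pc]; have -> := funext Pc.
apply: hpoly_sum => m /eqP mk; apply: hpolyZ; rewrite -{1}mk.
elim: (index_enum _) => [|i r IH].
  rewrite big_nil; apply: hpoly_ext (hpolyC 1) => x; by rewrite big_nil.
rewrite big_cons; have hi := hpoly_exp (m i) (hpoly_coord i); rewrite mul1n in hi.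
by apply: hpoly_ext (hpolyM hi IH) => x; rewrite big_cons.
Qed.

Lemma hpoly_homog_poly k P : hpoly k P -> homog_poly k P.
Proof.
elim=> {k P} [k|c|k f g _ [c hc] _ [c' hc']|k i f _ [c hc]].
- exists (fun=> 0) => x; rewrite big1// => m _; by rewrite mul0r.
- exists (fun=> c) => x; rewrite (bigD1 [ffun=> ord0])/=; last first.
    by rewrite big1// => i _; rewrite ffunE.
  rewrite !big1 ?mulr1 ?addr0// => [m /andP[/eqP m0 /negP mn]|i _]; last first.
    by rewrite ffunE expr0.
  exfalso; apply: mn; apply/eqP/ffunP => i; rewrite ffunE; apply/val_inj => /=.
  by case: (m i) => -[].
- exists (fun m => c m + c' m) => x; rewrite hc hc' -big_split/=.
  by apply: eq_bigr => m _; rewrite mulrDl.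
- pose up (m : {ffun 'I_d -> 'I_k.+1}) : {ffun 'I_d -> 'I_k.+2} :=
    [ffun j => inord (m j + (j == i))%N].
  have upE (m : {ffun 'I_d -> 'I_k.+1}) j : (\sum_(i < d) (m i : nat))%N == k -> up m j = (m j + (j == i))%N :> nat.
    move=> /eqP mk; rewrite ffunE inordK// ltnS.
    by case: (j == i); rewrite ?addn1 ?addn0 ?ltn_ord// ltnW.
  (* [up] multiplies a monomial by the variable [i]; the coefficient at [m'] collects those of its
     preimages. *)
  exists (fun m' => \sum_(m : {ffun 'I_d -> 'I_k.+1} | ((\sum_(i < d) (m i : nat))%N == k) && (m' == up m)) c m).
  move=> x; rewrite hc mulr_sumr.
  under [RHS]eq_bigr do rewrite mulr_suml.
  rewrite (exchange_big_dep (fun m : {ffun 'I_d -> 'I_k.+1} =>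
    (\sum_(i < d) (m i : nat))%N == k))/=; last by move=> m' m _ /andP[].
  apply: eq_bigr => m mk; rewrite (big_pred1 (up m)) => [|m']/=.
    rewrite mulrCA; congr (_ * _); rewrite [RHS](bigD1 i)//= [in LHS](bigD1 i)//=.
    rewrite upE// eqxx addn1 exprS mulrA; congr (_ * _).
    by apply: eq_bigr => j ji; rewrite upE// (negbTE ji) addn0.
  rewrite mk/=; have [->|_] := eqVneq m' (up m); last by rewrite andbF.
  rewrite andbT; under eq_bigr do rewrite upE//.
  rewrite big_split/= (eqP mk) (bigD1 i)//= eqxx big1 ?addn0 ?addn1 ?eqxx// => j /negbTE ->//.
Qed.

(** * Derivatives of homogeneous polynomials and the Laplacian *)

Lemma is_derive_coord x v i : is_derive x v (fun y : 'rV[R]_d => y 0 i) (v 0 i).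
Proof.
have h : (fun h : R => h^-1 *: ((h *: v + x) 0 i - x 0 i)) @ 0^' --> v 0 i.
  apply: cvg_near_cst; near=> t.
  rewrite !mxE addrK [_ *: _]mulrA mulVf ?mul1r//.
  by near: t; exact: nbhs_dnbhs_neq.
by split; [exact: cvgP h|exact: cvg_lim h].
Unshelve. all: by end_near. Qed.

Definition pd (i : 'I_d) P : 'rV[R]_d -> R := fun y => 'D_(delta_mx 0 i) P y.

(** Differentiability, the degree of the partial derivatives and Euler's identity concern one
    gradient [G], built along a single induction. In degree 0 there is no lower degree, so [G] is
    required to vanish. *)
Lemma hpoly_gradient k P : hpoly k P -> exists G : 'I_d -> 'rV[R]_d -> R,
  [/\ forall i, (if k is k'.+1 then hpoly k' (G i) else forall x, G i x = 0),
      forall x v, is_derive x v P (\sum_i v 0 i * G i x) &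
      forall x, \sum_i x 0 i * G i x = k%:R * P x].
Proof.
elim=> {k P} [k|c|k f g _ [G [G1 G2 G3]] _ [G' [G'1 G'2 G'3]]|k i f hf [G [G1 G2 G3]]].
- exists (fun _ _ => 0); split => [i|x v|x].
  + by case: k => // k; exact: hpoly0.
  + by rewrite big1 => [|i _]; [exact: is_derive_cst|rewrite mulr0].
  + by rewrite big1 => [|i _]; rewrite !mulr0.
- exists (fun _ _ => 0); split => [//|x v|x].
  + by rewrite big1 => [|i _]; [exact: is_derive_cst|rewrite mulr0].
  + by rewrite big1 => [|i _]; rewrite ?mulr0 ?mul0r.
- exists (fun i x => G i x + G' i x); split => [i|x v|x].
  + case: k G1 G'1 {G3 G'3} => [|k] G1 G'1 => [x|]; first by rewrite G1 G'1 addr0.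
    exact: hpolyD.
  + have := is_deriveD (G2 x v) (G'2 x v).
    by rewrite -big_split/=; under eq_bigr do rewrite -mulrDr.
  + by under eq_bigr do rewrite mulrDr; rewrite big_split/= G3 G'3 mulrDr.
- exists (fun j x => (j == i)%:R * f x + x 0 i * G j x); split => [j|x v|x].
  + apply: hpolyD; first exact: hpolyZ.
    case: k hf G1 {G2 G3} => [|k] hf G1; last exact: hpolyX.
    by apply: hpoly_ext (hpoly0 0) => x; rewrite G1 mulr0.
  + have h := is_deriveM (is_derive_coord x v i) (G2 x v).
    suff -> : \sum_j v 0 j * ((j == i)%:R * f x + x 0 i * G j x) =
      x 0 i *: (\sum_j v 0 j * G j x) + f x *: v 0 i by exact: h.
    under eq_bigr do rewrite mulrDr.
    rewrite big_split/= (bigD1 i)//= eqxx mul1r big1 => [|j /negbTE ->]; last first.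
      by rewrite mul0r mulr0.
    rewrite addr0 addrC; congr (_ + _); last by rewrite [_ *: _]mulrC.
    by rewrite [_ *: _]mulr_sumr; apply: eq_bigr => j _; rewrite mulrCA.
  + under eq_bigr do rewrite mulrDr; rewrite big_split/= (bigD1 i)//= eqxx mul1r.
    rewrite big1 => [|j /negbTE ->]; last by rewrite mul0r mulr0.
    under eq_bigr do rewrite mulrCA; rewrite -mulr_sumr G3 addr0 -natr1.
    ring.
Qed.

Lemma pd_gradient P (G : 'I_d -> 'rV[R]_d -> R) :
  (forall x v, is_derive x v P (\sum_i v 0 i * G i x)) -> forall i, pd i P = G i.
Proof.
move=> h i; apply/funext => x; rewrite /pd; have [_ ->] := h x (delta_mx 0 i).
rewrite (bigD1 i)//= mxE !eqxx mul1r big1 ?addr0// => j /negbTE ji.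
by rewrite mxE ji andbF mul0r.
Qed.

Lemma is_derive_hpoly k P x v : hpoly k P -> is_derive x v P (\sum_i v 0 i * pd i P x).
Proof.
move=> /hpoly_gradient[G [_ h _]]; have := h x v.
by under eq_bigr do rewrite -(pd_gradient h).
Qed.

Lemma hpoly_pd k i P : hpoly k.+1 P -> hpoly k (pd i P).
Proof. by move=> /hpoly_gradient[G [h0 h _]]; rewrite (pd_gradient h). Qed.

Lemma hpoly_pd0 i P : hpoly 0 P -> pd i P = fun=> 0.
Proof.
by move=> /hpoly_gradient[G [h0 h _]]; rewrite (pd_gradient h); exact/funext.
Qed.

Lemma hpoly_pd_weak k i P : hpoly k P -> exists k', hpoly k' (pd i P).
Proof.
case: k => [/hpoly_pd0 ->|k]; last by move=> h; exists k; exact: hpoly_pd.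
by exists 0; exact: hpoly0.
Qed.

Lemma euler k P x : hpoly k P -> \sum_i x 0 i * pd i P x = k%:R * P x.
Proof.
move=> /hpoly_gradient[G [_ h <-]]; apply: eq_bigr => i _.
by rewrite (pd_gradient h).
Qed.

Lemma pdD k l i P Q : hpoly k P -> hpoly l Q ->
  pd i (fun x => P x + Q x) = fun x => pd i P x + pd i Q x.
Proof.
move=> hP hQ; apply/funext => x; rewrite /pd.
have [dP _] := is_derive_hpoly x (delta_mx 0 i) hP.
have [dQ _] := is_derive_hpoly x (delta_mx 0 i) hQ.
exact: (deriveD dP dQ).
Qed.

Lemma pdZ k i c P : hpoly k P -> pd i (fun x => c * P x) = fun x => c * pd i P x.
Proof.
move=> hP; apply/funext => x; rewrite /pd.
have [dP _] := is_derive_hpoly x (delta_mx 0 i) hP.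
exact: (deriveZ c dP).
Qed.

Lemma pdX k i j P : hpoly k P ->
  pd i (fun x => x 0 j * P x) = fun x => (i == j)%:R * P x + x 0 j * pd i P x.
Proof.
move=> hP; apply/funext => x; rewrite /pd.
have hd := is_derive_hpoly x (delta_mx 0 i) hP.
have [_ ->] := is_deriveM (is_derive_coord x (delta_mx 0 i) j) hd.
have [_ <-] := hd.
by rewrite mxE eqxx/= addrC eq_sym; congr (_ + _); rewrite [_ *: _]mulrC.
Qed.

Lemma laplacianE P x : laplacian P x = \sum_i pd i (pd i P) x.
Proof. by []. Qed.

Lemma laplacian0 k P : hpoly k P -> (k < 2)%N -> forall x, laplacian P x = 0.
Proof.
move=> hP k2 x; rewrite laplacianE big1// => i _.
case: k k2 hP => [_ hP|[|]// _ hP].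
  by rewrite (hpoly_pd0 _ hP) (hpoly_pd0 _ (hpoly0 0)).
by rewrite (hpoly_pd0 _ (hpoly_pd i hP)).
Qed.

Lemma hpoly_laplacian k P : hpoly k.+2 P -> hpoly k (laplacian P).
Proof.
move=> hP; apply: hpoly_sum => i _.
by apply: hpoly_pd; exact: hpoly_pd.
Qed.

Lemma laplacianD k l P Q x : hpoly k P -> hpoly l Q ->
  laplacian (fun x => P x + Q x) x = laplacian P x + laplacian Q x.
Proof.
move=> hP hQ; rewrite !laplacianE -big_split/=; apply: eq_bigr => i _.
rewrite (pdD _ hP hQ); have [k' hP'] := hpoly_pd_weak i hP.
by have [l' hQ'] := hpoly_pd_weak i hQ; rewrite (pdD _ hP' hQ').
Qed.

Lemma laplacianZ k c P x : hpoly k P ->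
  laplacian (fun x => c * P x) x = c * laplacian P x.
Proof.
move=> hP; rewrite !laplacianE mulr_sumr; apply: eq_bigr => i _.
by rewrite (pdZ _ _ hP); have [k' hP'] := hpoly_pd_weak i hP; rewrite (pdZ _ _ hP').
Qed.

Lemma laplacian_sum (I : Type) (r : seq I) k (f : I -> 'rV[R]_d -> R) x :
  (forall i, hpoly k (f i)) ->
  laplacian (fun x => \sum_(i <- r) f i x) x = \sum_(i <- r) laplacian (f i) x.
Proof.
move=> hf; elim: r => [|i r IH].
  rewrite big_nil (_ : (fun x => _) = fun=> 0); last by apply/funext => y; rewrite big_nil.
  exact: (laplacian0 (hpoly0 0)).
rewrite big_cons -IH (_ : (fun x => _) = fun x => f i x + \sum_(j <- r) f j x).
  by apply: (@laplacianD k k) => //; exact: hpoly_sum.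
by apply/funext => y; rewrite big_cons.
Qed.

Lemma laplacianX k j P x : hpoly k P ->
  laplacian (fun x => x 0 j * P x) x = x 0 j * laplacian P x + 2 * pd j P x.
Proof.
move=> hP; rewrite !laplacianE mulr_sumr.
transitivity (\sum_i (x 0 j * pd i (pd i P) x + (i == j)%:R * (2 * pd j P x))).
  apply: eq_bigr => i _; rewrite (pdX _ _ hP).
  have [k' hP'] := hpoly_pd_weak i hP.
  have h1 : hpoly k (fun x => (i == j)%:R * P x) by exact: hpolyZ.
  rewrite (pdD _ h1 (hpolyX j hP')) (pdZ _ _ hP) (pdX _ _ hP').
  by case: eqP => [->|_] /=; ring.
rewrite big_split/=; congr (_ + _); rewrite (bigD1 j)//= eqxx mul1r big1 ?addr0//.
by move=> i /negbTE ->; rewrite mul0r.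
Qed.

Lemma laplacian_sqn k P x : hpoly k P ->
  laplacian (fun x => sqn x * P x) x =
  sqn x * laplacian P x + (2 * d%:R + 4 * k%:R) * P x.
Proof.
move=> hP.
have -> : (fun x => sqn x * P x) = fun x => \sum_j x 0 j * (x 0 j * P x).
  by apply/funext => y; rewrite mulr_suml; apply: eq_bigr => j _; rewrite mulrA.
rewrite (@laplacian_sum _ _ k.+2); last by move=> j; do 2 apply: hpolyX.
transitivity (\sum_j (x 0 j * x 0 j * laplacian P x + 4 * (x 0 j * pd j P x) + 2 * P x)).
  apply: eq_bigr => j _; rewrite (laplacianX _ _ (hpolyX j hP)) (laplacianX _ _ hP).
  by rewrite (pdX _ _ hP) eqxx /=; ring.
rewrite !big_split/= -mulr_suml -mulr_sumr (euler _ hP) sumr_const card_ord.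
by rewrite -[X in _ + X]mulr_natr; rewrite /sqn /dotv; ring.
Qed.

(** Each factor [sqn] contributes [2 d + 4 deg] as in [laplacian_sqn], and [sqn ^+ j * H] has degree
    [2 j + l] for [H] of degree [l]. The sum equals [2 i (2 i + 2 l + d - 2)]. *)
Definition hcoef (l i : nat) : R := \sum_(j < i) (2 * d%:R + 4 * (2 * j + l)%:R).

Lemma laplacian_sqnX l i P x : hpoly l P -> (forall x, laplacian P x = 0) ->
  laplacian (fun x => sqn x ^+ i.+1 * P x) x = hcoef l i.+1 * (sqn x ^+ i * P x).
Proof.
move=> hP P0; elim: i x => [|i IH] x.
  rewrite /hcoef big_ord1 muln0 add0n expr0 mul1r.
  by under eq_fun do rewrite expr1; rewrite (laplacian_sqn _ hP) P0 mulr0 add0r.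
have hQ := hpolyM (hpoly_exp i.+1 hpoly_sqn) hP.
rewrite (_ : (fun x => _) = fun x => sqn x * (sqn x ^+ i.+1 * P x)); last first.
  by apply/funext => y; rewrite exprS mulrA.
rewrite (laplacian_sqn _ hQ) IH /hcoef [in RHS]big_ord_recr/= exprS; ring.
Qed.

Lemma hcoef_gt0 l i : (0 < d)%N -> 0 < hcoef l i.+1.
Proof.
move=> d0; rewrite /hcoef big_ord_recl/= ltr_wpDr//.
  by apply: sumr_ge0 => j _; rewrite addr_ge0// mulr_ge0.
by rewrite ltr_wpDr ?mulr_ge0// mulr_gt0 ?ltr0n.
Qed.

(* The inverse of the Laplacian is explicit on [sqn ^ i * H] with [H] harmonic,
   hence a decomposition of [laplacian P] lifts to one of [P]. *)
Lemma harmonic_decomp k P : (0 < d)%N -> hpoly k P ->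
  exists n (e l : 'I_n -> nat) (H : 'I_n -> 'rV[R]_d -> R),
  [/\ forall t, hpoly (l t) (H t), forall t x, laplacian (H t) x = 0,
      forall t, (2 * e t + l t)%N = k &
      forall x, P x = \sum_t sqn x ^+ e t * H t x].
Proof.
move=> d0; elim/ltn_ind: k P => k IH P hP.
have [k2|k2] := ltnP k 2.
  exists 1%N, (fun=> 0%N), (fun=> k), (fun=> P); split => // [_|x].
    exact: (laplacian0 hP).
  by rewrite big_ord1 expr0 mul1r.
case: k k2 hP IH => [|[|k]]// _ hP IH.
have [|n [e [l [H [H1 H2 H3 H4]]]]] := IH k _ _ (hpoly_laplacian hP).
  by rewrite ltnS leqnSn.
pose T t x := (hcoef (l t) (e t).+1)^-1 * (sqn x ^+ (e t).+1 * H t x).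
have hT0 t : hpoly k.+2 (fun x => sqn x ^+ (e t).+1 * H t x).
  have := hpolyM (hpoly_exp (e t).+1 hpoly_sqn) (H1 t).
  by rewrite mulnS -addnA H3.
have hT t : hpoly k.+2 (T t) by exact: hpolyZ.
pose Q x := \sum_t T t x.
have hQ : hpoly k.+2 Q by exact: hpoly_sum.
have LQ x : laplacian Q x = laplacian P x.
  rewrite (@laplacian_sum _ _ k.+2)// H4; apply: eq_bigr => t _.
  rewrite (laplacianZ _ _ (hT0 t)) (laplacian_sqnX _ _ (H1 t))// mulrA mulVf ?mul1r//.
  by rewrite gt_eqF// hcoef_gt0.
(* Index 0 carries the harmonic remainder [P - Q]; the others are the pieces of [laplacian P] with
   exponent raised by one. *)
exists n.+1, (fun t => if unlift ord0 t is Some s then (e s).+1 else 0%N),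
  (fun t => if unlift ord0 t is Some s then l s else k.+2),
  (fun t => if unlift ord0 t is Some s
            then fun x => (hcoef (l s) (e s).+1)^-1 * H s x else fun x => P x - Q x).
split => [t|t x|t|x].
- case: unliftP => [s _|_]; [exact: hpolyZ|exact: hpolyB].
- case: unliftP => [s _|_]; first by rewrite (laplacianZ _ _ (H1 s)) H2 mulr0.
  rewrite (_ : (fun x => _) = fun x => P x + (-1) * Q x); last first.
    by apply/funext => y; rewrite mulN1r.
  rewrite (laplacianD _ hP (hpolyZ _ hQ)) (laplacianZ _ _ hQ) LQ.
  by rewrite mulN1r subrr.
- by case: unliftP => [s _|_]; [rewrite mulnS -addnA H3|rewrite muln0].
- rewrite big_ord_recl unlift_none expr0 mul1r [X in _ + X](_ : _ = Q x) ?subrK//.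
  by apply: eq_bigr => t _; rewrite liftK /T; ring.
Qed.

Lemma hpoly_continuous k P : hpoly k P -> continuous P.
Proof.
elim=> {k P} [k|c|k f g _ hf _ hg|k i f _ hf] x.
- exact: cst_continuous.
- exact: cst_continuous.
- by apply: continuousD; [exact: hf|exact: hg].
- by apply: continuousM; [exact: coord_continuous|exact: hf].
Qed.

Lemma sbm_hpoly k P : hpoly k P -> sbm P.
Proof.
elim=> {k P} [k|c|k f g _ hf _ hg|k i f _ hf].
- exact: sbm_cst.
- exact: sbm_cst.
- exact: sbmD.
- by apply: sbmM => //; exact: sbm_coord.
Qed.

Lemma hpoly_linear k P (L : 'rV[R]_d -> 'rV[R]_d) :
  (forall i, hpoly 1 (fun x => L x 0 i)) -> hpoly k P -> hpoly k (fun x => P (L x)).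
Proof.
move=> hL; elim=> {k P} [k|c|k f g _ hf _ hg|k i f _ hf].
- exact: hpoly0.
- exact: hpolyC.
- exact: hpolyD.
- exact: (hpolyM (hL i) hf).
Qed.

Lemma hpoly_refl k n P : hpoly k P -> hpoly k (fun x => P (refl n x)).
Proof.
apply: hpoly_linear => i.
have h : hpoly 1 (fun x => x 0 i - (2 * n 0 i) * dotv n x).
  by apply: hpolyB; [exact: hpoly_coord|apply: hpolyZ; exact: hpoly_dotv].
by apply: hpoly_ext h => x; rewrite /refl !mxE (dotvC n x); ring.
Qed.

Lemma derive_linear_comp P (L : 'rV[R]_d -> 'rV[R]_d) x v :
  (forall a x y, L (a *: x + y) = a *: L x + L y) ->
  'D_v (fun y => P (L y)) x = 'D_(L v) P (L x).
Proof. by move=> hL; rewrite /derive; under eq_fun do rewrite /= hL. Qed.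

(* The rows of an orthogonal map are orthonormal, so that the second order
   part of the chain rule is again the Laplacian. *)
Lemma laplacian_refl k n P x : enorm n = 1 -> hpoly k P ->
  laplacian (fun y => P (refl n y)) x = laplacian P (refl n x).
Proof.
move=> n1 hP; have lin := @refl_linear R d n.
pose S i z := \sum_j refl n (delta_mx 0 i) 0 j * pd j P z.
have pdr i : pd i (fun y => P (refl n y)) = fun y => S i (refl n y).
  apply/funext => y; rewrite /pd derive_linear_comp//.
  by have [_ ->] := is_derive_hpoly (refl n y) (refl n (delta_mx 0 i)) hP.
have [k' hk] : exists k', forall j, hpoly k' (pd j P).
  case: k hP => [|k] hP; last by exists k => j; exact: hpoly_pd.
  by exists 0%N => j; rewrite (hpoly_pd0 j hP); exact: hpoly0.
have hs i : hpoly k' (S i).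
  by apply: hpoly_sum => j _; exact: hpolyZ.
have E i : pd i (pd i (fun y => P (refl n y))) x =
    \sum_l \sum_j refl n (delta_mx 0 i) 0 l * refl n (delta_mx 0 i) 0 j * pd l (pd j P) (refl n x).
  rewrite pdr [LHS](@derive_linear_comp (S i) (refl n) x _ lin).
  have [_ ->] := is_derive_hpoly (refl n x) (refl n (delta_mx 0 i)) (hs i).
  apply: eq_bigr => l _.
  have -> : pd l (S i) (refl n x) =
     \sum_j refl n (delta_mx 0 i) 0 j * pd l (pd j P) (refl n x).
    rewrite /S; elim: (index_enum _) => [|j r IH].
      rewrite big_nil (_ : (fun z => _) = fun=> 0) ?(hpoly_pd0 _ (hpoly0 0))//.
      by apply/funext => z; rewrite big_nil.
    rewrite big_cons -IH (_ : (fun z => _) =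
      fun z => refl n (delta_mx 0 i) 0 j * pd j P z +
        \sum_(j <- r) refl n (delta_mx 0 i) 0 j * pd j P z); last first.
      by apply/funext => z; rewrite big_cons.
    rewrite (@pdD k' k'); [|exact: hpolyZ|by apply: hpoly_sum => j' _; exact: hpolyZ].
    by rewrite (pdZ _ _ (hk j)).
  by rewrite mulr_sumr; apply: eq_bigr => j _; rewrite mulrA.
pose a i l := refl n (delta_mx 0 i) 0 l.
pose b l j := pd l (pd j P) (refl n x).
transitivity (\sum_i \sum_l \sum_j a i l * a i j * b l j).
  by apply: eq_bigr => i _; exact: E.
transitivity (\sum_l b l l); last by [].
(* The matrix of a reflection is symmetric, so the sums over [i] are inner products of images of
   coordinate vectors, known from [dotv_refl]. *)
have ac i l : a i l = a l i.
  have de i' : dotv (delta_mx 0 i') n = n 0 i'.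
    rewrite /dotv (bigD1 i')//= mxE !eqxx mul1r big1 ?addr0// => m /negbTE mi.
    by rewrite mxE mi andbF mul0r.
  by rewrite /a /refl !mxE !de eqxx/= eq_sym; congr (_ - _); ring.
have orth l j : \sum_i a i l * a i j = (l == j)%:R.
  transitivity (dotv (refl n (delta_mx 0 l)) (refl n (delta_mx 0 j))).
    by apply: eq_bigr => i _; rewrite (ac i l) (ac i j).
  rewrite dotv_refl// /dotv (bigD1 l)//= !mxE !eqxx mul1r big1 ?addr0//.
  by move=> m /negbTE ml; rewrite mxE ml andbF mul0r.
clearbody a b; rewrite exchange_big; apply: eq_bigr => l _; rewrite exchange_big.
rewrite (bigD1 l)//= -mulr_suml orth eqxx mul1r big1 ?addr0// => j /negbTE jl.
by rewrite -mulr_suml orth eq_sym jl mul0r.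
Qed.

(** * Spherical harmonics and restrictions of polynomials *)

Lemma sph_harmP k Y : sph_harm k Y <-> exists P, [/\ hpoly k P,
  forall x, laplacian P x = 0 & forall u, enorm u = 1 -> Y u = P u].
Proof.
split=> [[P [/homog_poly_hpoly hP [LP YP]]]|[P [hP LP YP]]]; exists P => //.
by split; first exact: hpoly_homog_poly.
Qed.

Lemma sph_harm_ext k Y (Y' : 'rV[R]_d -> R) : (forall u, enorm u = 1 -> Y u = Y' u) ->
  sph_harm k Y -> sph_harm k Y'.
Proof.
move=> YY' /sph_harmP[P [h1 h2 h3]]; apply/sph_harmP; exists P; split=> // u u1.
by rewrite -YY'// h3.
Qed.

Lemma sph_harmD k Y (Y' : 'rV[R]_d -> R) : sph_harm k Y -> sph_harm k Y' -> sph_harm k (fun u => Y u + Y' u).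
Proof.
move=> /sph_harmP[P [h1 h2 h3]] /sph_harmP[Q [h4 h5 h6]]; apply/sph_harmP.
exists (fun x => P x + Q x); split=> [|x|u u1]; first exact: hpolyD.
  by rewrite (laplacianD _ h1 h4) h2 h5 addr0.
by rewrite h3// h6.
Qed.

Lemma sph_harmZ k c Y : sph_harm k Y -> sph_harm k (fun u => c * Y u).
Proof.
move=> /sph_harmP[P [h1 h2 h3]]; apply/sph_harmP.
exists (fun x => c * P x); split=> [|x|u u1]; first exact: hpolyZ.
  by rewrite (laplacianZ _ _ h1) h2 mulr0.
by rewrite h3.
Qed.

Lemma sph_harm_sum (I : finType) k (Y : I -> 'rV[R]_d -> R) :
  (forall i, sph_harm k (Y i)) -> sph_harm k (fun u => \sum_i Y i u).
Proof.
move=> hY; elim: (index_enum I) => [|i r IH].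
  apply/sph_harmP; exists (fun=> 0); split=> [|x|u _]; first exact: hpoly0.
    exact: (laplacian0 (hpoly0 0)).
  by rewrite big_nil.
by apply: sph_harm_ext (sph_harmD (hY i) IH) => u _; rewrite big_cons.
Qed.

Lemma sph_harm_refl k n Y : enorm n = 1 -> sph_harm k Y ->
  sph_harm k (fun u => Y (refl n u)).
Proof.
move=> n1 /sph_harmP[P [h1 h2 h3]]; apply/sph_harmP.
exists (fun x => P (refl n x)); split=> [|x|u u1]; first exact: hpoly_refl.
  by rewrite (laplacian_refl _ n1 h1) h2.
by rewrite h3// enorm_refl.
Qed.

Lemma sbm_sph_harm k Y : sph_harm k Y -> sbm Y.
Proof.
move=> /sph_harmP[P [h1 _ h3]]; apply: sbm_ext (sbm_hpoly h1) => u u1.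
by rewrite h3.
Qed.

(** On the sphere the powers of [sqn] in [harmonic_decomp] equal 1. *)
Lemma sph_harm_decomp k P : (0 < d)%N -> hpoly k P ->
  exists n (l : 'I_n -> nat) (H : 'I_n -> 'rV[R]_d -> R),
  [/\ forall t, (l t <= k)%N, forall t, sph_harm (l t) (H t) &
      forall u, enorm u = 1 -> P u = \sum_t H t u].
Proof.
move=> d0 /(harmonic_decomp d0)[n [e [l [H [H1 H2 H3 H4]]]]].
exists n, l, H; split=> [t|t|u u1]; first by rewrite -(H3 t) leq_addl.
  by apply/sph_harmP; exists (H t).
rewrite H4; apply: eq_bigr => t _.
by rewrite /sqn dotvv// expr1n mul1r.
Qed.

(** Replacing [s ^+ 2] by [1 - t ^+ 2] leaves at most one factor [s]. The witnesses in the last case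
    reduce [(t e_i + s f_i) (A + s B)] in this way. *)
Lemma hpoly_plane k P (e f : 'rV[R]_d) : hpoly k P ->
  exists A B : {poly R}, [/\ (size A <= k.+1)%N, (size B <= k)%N &
    forall t s, t ^+ 2 + s ^+ 2 = 1 -> P (t *: e + s *: f) = A.[t] + s * B.[t]].
Proof.
elim=> {k P} [k|c|k g h _ [A [B [A1 B1 h1]]] _ [A' [B' [A1' B1' h1']]]|k i g _ [A [B [A1 B1 h1]]]].
- exists 0, 0; split; rewrite ?size_poly0// => t s _.
  by rewrite !horner0 mulr0 addr0.
- exists c%:P, 0; split; rewrite ?size_poly0// ?size_polyC_leq1// => t s _.
  by rewrite hornerC horner0 mulr0 addr0.
- exists (A + A'), (B + B'); split.
  + by rewrite (leq_trans (size_polyD _ _))// geq_max A1.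
  + by rewrite (leq_trans (size_polyD _ _))// geq_max B1.
  + by move=> t s ts; rewrite h1// h1'// !hornerD; ring.
- exists ((e 0 i)%:P * ('X * A) + (f 0 i)%:P * ((1 - 'X^2) * B)),
    ((f 0 i)%:P * A + (e 0 i)%:P * ('X * B)).
  have sC (c : R) (Q : {poly R}) m : (size Q <= m)%N -> (size (c%:P * Q)%R <= m)%N.
    by move=> sQ; rewrite mul_polyC (leq_trans (size_scale_leq _ _)).
  have sX (Q : {poly R}) m : (size Q <= m)%N -> (size ('X * Q)%R <= m.+1)%N.
    move=> sQ; rewrite (leq_trans (size_polyMleq _ _))// size_polyX.
    by rewrite add2n /= ltnS.
  have sX2 : (size (1 - 'X^2 : {poly R})%R <= 3)%N.
    rewrite (leq_trans (size_polyD _ _))// geq_max size_polyN size_polyXn.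
    by rewrite (leq_trans (size_polyC_leq1 _)).
  split.
  + rewrite (leq_trans (size_polyD _ _))// geq_max; apply/andP; split.
      by apply: sC; exact: sX.
    apply: sC; rewrite (leq_trans (size_polyMleq _ _))//.
    rewrite -subn1 leq_subLR (leq_trans (leq_add sX2 B1))//.
  + rewrite (leq_trans (size_polyD _ _))// geq_max; apply/andP; split.
      exact: sC.
    by apply: sC; exact: sX.
  + move=> t s ts; rewrite h1// !mxE.
    rewrite !(hornerD, hornerN, hornerM, hornerC, hornerX, hornerXn).
    have -> : 1 - t ^+ 2 = s ^+ 2 by rewrite -ts; ring.
    ring.
Qed.
End homogeneous.

(** * The Funk-Hecke formula *)

Section capcont.
Variables (R : realType) (d : nat).
Implicit Types (u v w : 'rV[R]_d) (f : 'rV[R]_d -> R).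

(** Neighbourhoods are measured by the cosine, the form used in [savg_gt0] and in the estimates on
    [gk]. *)
Definition capcont f u := forall e : R, 0 < e -> exists2 dl, 0 < dl &
  forall v, enorm v = 1 -> 1 - dl <= dotv u v -> `|f v - f u| <= e.

Lemma cap_dist u v (dl : R) : enorm u = 1 -> enorm v = 1 -> 0 <= dl ->
  1 - dl ^+ 2 / 2 <= dotv u v -> enorm (v - u) <= dl.
Proof.
move=> u1 v1 dl0 uv; rewrite -(ler_sqr (x := enorm _)) ?nnegrE ?enorm_ge0//.
rewrite sqr_enorm !(dotvBl, dotvBr) (dotvC v u) !dotvv//; lra.
Qed.

Lemma capcont_hpoly k f u : hpoly k f -> enorm u = 1 -> capcont f u.
Proof.
move=> hf u1 e e0; have /cvgrPdist_le/(_ _ e0) := @hpoly_continuous _ _ _ _ hf u.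
move=> /nbhs_ballP[r /= r0 hr]; exists ((r / 2) ^+ 2 / 2).
  by rewrite divr_gt0// exprn_gt0// divr_gt0.
move=> v v1 uv; rewrite distrC; apply: hr; split=> // i j; rewrite ord1.
rewrite /ball/= (@le_lt_trans _ _ (r / 2))//; last by lra.
have := cap_dist u1 v1 (ltW (divr_gt0 r0 (ltr0n _ 2))) uv.
apply: le_trans; have := coord_le_enorm (v - u) j.
by rewrite !mxE distrC.
Qed.

Lemma capcont_ext f g u : enorm u = 1 -> (forall v, enorm v = 1 -> f v = g v) ->
  capcont f u -> capcont g u.
Proof.
move=> u1 fg hf e /hf[dl dl0 h]; exists dl => // v v1 uv.
by rewrite -!fg// h.
Qed.

Lemma capcont_zonal (kappa : R -> R) u v : enorm u = 1 -> enorm v = 1 ->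
  {within `[-1, 1], continuous kappa} -> capcont (fun w => kappa (dotv u w)) v.
Proof.
move=> u1 v1 /subspace_continuousP ck e e0.
have tI : `[-1, 1]%classic (dotv u v) by rewrite /= in_itv/=; exact: dotv_le1.
have /cvgrPdist_le/(_ _ e0) := ck _ tI.
move=> /nbhs_ballP[r /= r0 hr]; exists ((r / 2) ^+ 2 / 2).
  by rewrite divr_gt0// exprn_gt0// divr_gt0.
move=> w w1 vw; rewrite distrC; apply: hr; last first.
  by rewrite /= in_itv/=; exact: dotv_le1.
rewrite /ball/= (@le_lt_trans _ _ (r / 2))//; last by lra.
have := cap_dist v1 w1 (ltW (divr_gt0 r0 (ltr0n _ 2))) vw; apply: le_trans.
rewrite -dotvBr (le_trans (dotv_le_enorm _ _))// u1 mul1r.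
by rewrite -opprB -scaleN1r enormZ normrN normr1 mul1r.
Qed.

End capcont.

(** * Orthogonality, zonal harmonics and multipliers *)

Section funk_hecke.
Variables (R : realType) (d : nat).
Hypothesis d2 : (2 <= d)%N.
Variables (N : nat -> nat) (Y : nat -> nat -> 'rV[R]_d -> R).
Hypothesis basis : sph_harm_basis N Y.
Implicit Types (u v w n e : 'rV[R]_d) (f g : 'rV[R]_d -> R).

Let d0 : (0 < d)%N. Proof. exact: ltnW. Qed.

Lemma basis_harm k j : (j < N k)%N -> sph_harm k (Y k j).
Proof. by case: basis => h _ _; exact: h. Qed.

Lemma basis_sbm k j : (j < N k)%N -> sbm (Y k j).
Proof. by move=> /basis_harm; exact: sbm_sph_harm. Qed.

Lemma basis_sbmo k (j : 'I_(N k)) : sbm (Y k j).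
Proof. exact: basis_sbm. Qed.

Lemma basis_orth k j k' j' : (j < N k)%N -> (j' < N k')%N ->
  savg (fun u => Y k j u * Y k' j' u) = ((k == k') && (j == j'))%:R.
Proof.
case: basis => _ h _ jk jk'; rewrite /savg h//=.
by case: ifP.
Qed.

(** Inherited from the basis, which spans each degree and is orthogonal across degrees. *)
Lemma savg_orth k l f g : sph_harm k f -> sph_harm l g -> k != l ->
  savg (fun u => f u * g u) = 0.
Proof.
case: basis => _ _ sp hf hg kl; have [c fc] := sp _ _ hf; have [c' gc'] := sp _ _ hg.
rewrite (@savg_ext _ _ d0 _ (fun u => \sum_(i < N k) \sum_(j < N l)
    c i * c' j * (Y k i u * Y l j u))); first last.
- by apply: sbmM; [exact: sbm_sph_harm hf|exact: sbm_sph_harm hg].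
- move=> u u1; rewrite fc// gc'// mulr_suml; apply: eq_bigr => i _.
  by rewrite mulr_sumr; apply: eq_bigr => j _; ring.
have s (i : 'I_(N k)) (j : 'I_(N l)) : sbm (fun u => c i * c' j * (Y k i u * Y l j u)).
  by apply: sbmZ; apply: sbmM; exact: basis_sbmo.
rewrite savg_sum//; last by move=> i; exact: sbm_sum.
rewrite big1// => i _; rewrite savg_sum// big1// => j _.
rewrite savgZ//; last by apply: sbmM; exact: basis_sbmo.
by rewrite basis_orth// (negbTE kl) mulr0.
Qed.

Lemma savg_coef k (c : nat -> R) j : (j < N k)%N ->
  savg (fun u => (\sum_(i < N k) c i * Y k i u) * Y k j u) = c j.
Proof.
move=> jk; have s (i : 'I_(N k)) : sbm (fun u => c i * (Y k i u * Y k j u)).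
  by apply: sbmZ; apply: sbmM; [exact: basis_sbmo|exact: basis_sbm].
rewrite (@savg_ext _ _ d0 _ (fun u => \sum_(i < N k) c i * (Y k i u * Y k j u))); first last.
- by apply: sbmM; [apply: sbm_sum => i _; apply: sbmZ; exact: basis_sbmo|exact: basis_sbm].
- by move=> u u1; rewrite mulr_suml; apply: eq_bigr => i _; rewrite mulrA.
rewrite savg_sum// (bigD1 (Ordinal jk))//= big1 => [|i ij].
  rewrite addr0 savgZ//; last by apply: sbmM; exact: basis_sbm.
  by rewrite basis_orth// !eqxx mulr1.
rewrite savgZ//; last by apply: sbmM; [exact: basis_sbmo|exact: basis_sbm].
rewrite basis_orth// eqxx/= (_ : _ == j = false) ?mulr0//.
by apply/negbTE; apply: contra ij => /eqP ij; apply/eqP/val_inj.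
Qed.

Lemma savg_sqr_eq0 k f : sph_harm k f -> savg (fun u => f u * f u) = 0 ->
  forall u, enorm u = 1 -> f u = 0.
Proof.
move=> hf f0 u u1; apply/eqP; apply: contraT => fu0.
have sf := sbm_sph_harm hf.
have cf : capcont f u.
  move: hf => /sph_harmP[P [hP _ fP]]; apply: capcont_ext (capcont_hpoly hP u1) => //.
  by move=> v v1; rewrite fP.
have fu : 0 < `|f u| / 2 by rewrite divr_gt0// normr_gt0.
have [dl dl0 h] := cf _ fu.
suff : 0 < savg (fun u => f u * f u) by rewrite f0 ltxx.
apply: (savg_gt0 d0 (dl := dl) (c := (`|f u| / 2) ^+ 2) (sbmM sf sf) u1) => //.
- by move=> v _; rewrite -expr2 sqr_ge0.
- by rewrite exprn_gt0.
- move=> v v1 uv; rewrite -expr2 -[leRHS]real_normK ?num_real//.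
  rewrite lerXn2r ?nnegrE ?(ltW fu)//.
  have := h _ v1 uv; have := lerB_dist (f u) (f v); rewrite [`|f u - _|]distrC; lra.
Qed.

(** Each power of the cosine of exponent [i < k] is a homogeneous polynomial, hence on the sphere a
    sum of harmonics of degree at most [i]. *)
Lemma savg_zonal_poly_orth k f e (q : {poly R}) : enorm e = 1 -> sph_harm k f ->
  (size q <= k)%N -> savg (fun v => q.[dotv e v] * f v) = 0.
Proof.
move=> e1 hf qk; have sf := sbm_sph_harm hf.
have hd i : hpoly i (fun v => dotv e v ^+ i).
  by have := hpoly_exp i (hpoly_dotv e); rewrite mul1n.
have sd (i : 'I_(size q)) : sbm (fun v => q`_i * (dotv e v ^+ i * f v)).
  by apply: sbmZ; apply: sbmM => //; exact: sbm_hpoly (hd i).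
rewrite (@savg_ext _ _ d0 _ (fun v => \sum_(i < size q) q`_i * (dotv e v ^+ i * f v))); first last.
- apply: sbm_ext (sbm_sum _ (P := xpredT) (fun i _ => sd i)) => v _.
  by rewrite horner_coef mulr_suml; apply: eq_bigr => i _; rewrite mulrA.
- by move=> v _; rewrite horner_coef mulr_suml; apply: eq_bigr => i _; rewrite mulrA.
rewrite savg_sum// big1// => i _; rewrite savgZ//; last first.
  by apply: sbmM => //; exact: sbm_hpoly (hd i).
have [m [l [H [H1 H2 H3]]]] := sph_harm_decomp d0 (hd i).
have sH t : sbm (fun v => H t v * f v).
  by apply: sbmM => //; exact: sbm_sph_harm (H2 t).
rewrite (@savg_ext _ _ d0 _ (fun v => \sum_t H t v * f v)); first last.
- by apply: sbmM => //; exact: sbm_hpoly (hd i).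
- by move=> v v1; rewrite H3// mulr_suml.
rewrite savg_sum// big1 ?mulr0// => t _; apply: savg_orth (H2 t) hf _.
by rewrite neq_ltn (leq_ltn_trans (H1 t))// (leq_trans (ltn_ord i)).
Qed.

Definition zonal_about e f :=
  forall v w, enorm v = 1 -> enorm w = 1 -> dotv e v = dotv e w -> f v = f w.

(** Gram-Schmidt on a coordinate vector not parallel to [e]: as [d >= 2], two coordinates of a unit
    vector cannot both have square at least 1. *)
Lemma exists_orth e : enorm e = 1 -> exists2 e', enorm e' = 1 & dotv e e' = 0.
Proof.
move=> e1.
have [i ei] : exists i, e 0 i ^+ 2 < 1.
  pose i0 : 'I_d := Ordinal d0; pose i1 : 'I_d := Ordinal d2.
  have [h|h] := ltP (e 0 i0 ^+ 2) 1; first by exists i0.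
  exists i1; have := dotvv e1; rewrite /dotv (bigD1 i0)//= (bigD1 i1)//= -!expr2 => E.
  have : 0 <= \sum_(i < d | (i != i0) && (i != i1)) e 0 i * e 0 i.
    by apply: sumr_ge0 => i _; rewrite -expr2 sqr_ge0.
  lra.
have ed : dotv e (delta_mx 0 i) = e 0 i.
  rewrite /dotv (bigD1 i)//= mxE !eqxx mulr1 big1 ?addr0// => j /negbTE ji.
  by rewrite mxE ji andbF mulr0.
have dd : dotv (delta_mx 0 i) (delta_mx 0 i) = 1 :> R.
  rewrite /dotv (bigD1 i)//= !mxE !eqxx mulr1 big1 ?addr0// => j /negbTE ji.
  by rewrite !mxE ji andbF mulr0.
pose w := delta_mx 0 i - e 0 i *: e.
have w0 : w != 0.
  apply: contraTneq isT => w0; have : dotv w w = 0 by rewrite w0 dot0v.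
  rewrite !(dotvBl, dotvBr, dotvZl, dotvZr) dd (dotvC _ e) ed dotvv//; lra.
exists (hatv w); first exact: enorm_hat.
by rewrite dotvZr dotvBr dotvZr ed dotvv// mulr1 subrr mulr0.
Qed.

(** The points [t e + s e'] and [t e - s e'] have the same cosine with [e], so the part of
    [hpoly_plane] that is odd in [s] cancels. *)
Lemma zonal_poly k f e : enorm e = 1 -> sph_harm k f -> zonal_about e f ->
  exists2 A : {poly R}, (size A <= k.+1)%N &
    forall v, enorm v = 1 -> f v = A.[dotv e v].
Proof.
move=> e1 /sph_harmP[P [hP _ fP]] zf; have [e' e'1 ee'] := exists_orth e1.
have [A [B [sA _ AB]]] := hpoly_plane e e' hP.
exists A => // v v1; set t := dotv e v.
have /andP[t1 t2] : -1 <= t <= 1 by exact: dotv_le1.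
have s0 : 0 <= 1 - t ^+ 2 by nra.
pose s := Num.sqrt (1 - t ^+ 2).
have ts : t ^+ 2 + s ^+ 2 = 1 by rewrite sqr_sqrtr//; ring.
have ts' : t ^+ 2 + (- s) ^+ 2 = 1 by rewrite sqrrN.
have key r : t ^+ 2 + r ^+ 2 = 1 -> f v = A.[t] + r * B.[t].
  move=> tr; rewrite -AB//.
  have n1 : enorm (t *: e + r *: e') = 1.
    apply: dotvv_enorm; rewrite !(dotvDl, dotvDr, dotvZl, dotvZr) (dotvC e' e) ee'.
    rewrite !dotvv//; lra.
  rewrite -fP//; apply: zf => //.
  by rewrite dotvDr !dotvZr ee' dotvv// mulr1 mulr0 addr0.
have := key _ ts; have := key _ ts'; lra.
Qed.

(** Such an [f] is orthogonal to itself. *)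
Lemma zonal_low_eq0 k f e (q : {poly R}) : enorm e = 1 -> sph_harm k f ->
  (size q <= k)%N -> (forall v, enorm v = 1 -> f v = q.[dotv e v]) ->
  forall v, enorm v = 1 -> f v = 0.
Proof.
move=> e1 hf qk fq; apply: (savg_sqr_eq0 hf); have sf := sbm_sph_harm hf.
rewrite (@savg_ext _ _ d0 _ (fun v => q.[dotv e v] * f v)); last exact: sbmM.
  exact: savg_zonal_poly_orth hf qk.
by move=> u u1; rewrite {1}fq.
Qed.

(* Zonal harmonics of degree [k] about [e] are orthogonal to all zonal polynomials
   of lower degree, hence proportional. *)
Lemma zonal_proportional k f g e : enorm e = 1 -> sph_harm k f -> sph_harm k g ->
  zonal_about e f -> zonal_about e g ->
  (exists v, enorm v = 1 /\ g v != 0) ->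
  exists a, forall v, enorm v = 1 -> f v = a * g v.
Proof.
move=> e1 hf hg zf zg [v0 [v01 gv0]].
have [A sA fA] := zonal_poly e1 hf zf; have [B sB gB] := zonal_poly e1 hg zg.
have sz (C : {poly R}) : (size C <= k.+1)%N -> C`_k = 0 -> (size C <= k)%N.
  move=> sC Ck; apply/leq_sizeP => j; rewrite leq_eqVlt => /orP[/eqP <-//|kj].
  by apply/leq_sizeP: kj.
have Bk : B`_k != 0.
  apply: contra_neq gv0 => Bk.
  exact: (zonal_low_eq0 e1 hg (sz _ sB Bk) gB v01).
exists (A`_k / B`_k) => v v1; apply/eqP; rewrite -subr_eq0; apply/eqP.
pose q := A - (A`_k / B`_k) *: B.
apply: (@zonal_low_eq0 k (fun v => f v - A`_k / B`_k * g v) e q) => //.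
- apply: sph_harm_ext (sph_harmD hf (sph_harmZ (- (A`_k / B`_k)) hg)) => u _.
  by rewrite mulNr.
- apply: sz; last by rewrite coefB coefZ divfK// subrr.
  rewrite (leq_trans (size_polyD _ _))// geq_max sA size_polyN.
  by rewrite (leq_trans (size_scale_leq _ _)).
- by move=> u u1; rewrite fA// gB// hornerD hornerN hornerZ.
Qed.

(** The reproducing kernel of degree [k]. *)
Definition zker k u v := \sum_(j < N k) Y k j u * Y k j v.

Definition hecke (kappa : R -> R) k j u := savg (fun w => kappa (dotv u w) * Y k j w).

Section one_kernel.
Variable kappa : R -> R.
Hypothesis ck : {within `[-1, 1], continuous kappa}.
Variable k : nat.

Let sk u : enorm u = 1 -> sbm (fun w => kappa (dotv u w)).
Proof. by move=> u1; exact: sbm_zonal. Qed.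

Let skY u j : enorm u = 1 -> (j < N k)%N -> sbm (fun w => kappa (dotv u w) * Y k j w).
Proof. by move=> u1 jk; apply: sbmM; [exact: sk|exact: basis_sbm]. Qed.

(** Harmonics of degree [k] and spherical averages are both invariant under [refl n], so the
    reflected basis is again orthonormal. *)
Lemma basis_refl n : enorm n = 1 -> exists O : 'M[R]_(N k),
  (forall (j : 'I_(N k)) u, enorm u = 1 ->
     Y k j (refl n u) = \sum_(l < N k) O j l * Y k l u) /\
  O^T *m O = 1%:M.
Proof.
move=> n1; case: basis => _ _ sp.
have hj (j : 'I_(N k)) : exists c : nat -> R, forall u, enorm u = 1 ->
    Y k j (refl n u) = \sum_(l < N k) c l * Y k l u.
  by apply: (sp k (fun u => Y k j (refl n u))); apply: sph_harm_refl => //; exact: basis_harm.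
have [c hc] := choice hj; pose O : 'M[R]_(N k) := \matrix_(j, l) c j l.
exists O; split=> [j u u1|]; first by rewrite hc//; apply: eq_bigr => l _; rewrite mxE.
apply: mulmx1C; apply/matrixP => i j; rewrite !mxE.
have -> : (i == j)%:R = savg (fun u => Y k i (refl n u) * Y k j (refl n u)).
  rewrite (savg_refl n1 (g := fun u => Y k i u * Y k j u)); last first.
    by apply: sbmM; exact: basis_sbmo.
  by rewrite basis_orth// eqxx.
have s (l : 'I_(N k)) : sbm (fun u => c j l * ((\sum_(m < N k) c i m * Y k m u) * Y k l u)).
  apply: sbmZ; apply: sbmM; last exact: basis_sbmo.
  by apply: sbm_sum => m _; apply: sbmZ; exact: basis_sbmo.
rewrite (@savg_ext _ _ d0 _ (fun u => \sum_(l < N k) c j l *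
   ((\sum_(m < N k) c i m * Y k m u) * Y k l u))); first last.
- by apply: sbmM; apply: sbm_refl => //; exact: basis_sbmo.
- move=> u u1; rewrite !hc// mulr_sumr; apply: eq_bigr => l _; ring.
rewrite savg_sum//; apply: eq_bigr => l _; rewrite savgZ//; last first.
  apply: sbmM; last exact: basis_sbmo.
  by apply: sbm_sum => m _; apply: sbmZ; exact: basis_sbmo.
by rewrite savg_coef// !mxE mulrC.
Qed.

Lemma orth_bilinear (O : 'M[R]_(N k)) (a b a' b' : 'I_(N k) -> R) :
  O^T *m O = 1%:M -> (forall j, a' j = \sum_l O j l * a l) ->
  (forall j, b' j = \sum_l O j l * b l) -> \sum_j a' j * b' j = \sum_j a j * b j.
Proof.
move=> OO ha hb.
transitivity (\sum_l \sum_m (O^T *m O) l m * (a l * b m)).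
  transitivity (\sum_j \sum_l \sum_m O j l * O j m * (a l * b m)).
    apply: eq_bigr => j _; rewrite ha hb mulr_suml; apply: eq_bigr => l _.
    by rewrite mulr_sumr; apply: eq_bigr => m _; ring.
  rewrite exchange_big; apply: eq_bigr => l _; rewrite exchange_big.
  apply: eq_bigr => m _; rewrite mxE mulr_suml; apply: eq_bigr => j _.
  by rewrite mxE.
apply: eq_bigr => l _; rewrite OO (bigD1 l)//= mxE eqxx mul1r big1 ?addr0// => m ml.
by rewrite mxE eq_sym (negbTE ml) mul0r.
Qed.

Lemma hecke_refl n (O : 'M[R]_(N k)) : enorm n = 1 ->
  (forall (j : 'I_(N k)) u, enorm u = 1 ->
     Y k j (refl n u) = \sum_(l < N k) O j l * Y k l u) ->
  forall (j : 'I_(N k)) u, enorm u = 1 ->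
  hecke kappa k j (refl n u) = \sum_(l < N k) O j l * hecke kappa k l u.
Proof.
move=> n1 hO j u u1; have ru1 : enorm (refl n u) = 1 by rewrite enorm_refl.
rewrite /hecke -(savg_refl n1); last exact: skY.
have s (l : 'I_(N k)) : sbm (fun w => O j l * (kappa (dotv u w) * Y k l w)).
  by apply: sbmZ; exact: skY.
rewrite (@savg_ext _ _ d0 _ (fun w => \sum_l O j l * (kappa (dotv u w) * Y k l w))); first last.
- exact: (sbm_refl n1 (g := fun w => kappa (dotv (refl n u) w) * Y k j w) (skY ru1 (ltn_ord j))).
- move=> w w1; rewrite dotv_refl// hO// mulr_sumr.
  by apply: eq_bigr => l _; ring.
rewrite savg_sum//; apply: eq_bigr => l _; rewrite savgZ//; exact: skY.
Qed.

(** The zonal operator applied to [zker] in its first variable. In [v] it is a harmonic of degree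
    [k] by its form, although nothing is known yet of [hecke] as a function of [u]. *)
Definition hker u v := \sum_(j < N k) hecke kappa k j u * Y k j v.

Lemma zker_refl n u v : enorm n = 1 -> enorm u = 1 -> enorm v = 1 ->
  zker k (refl n u) (refl n v) = zker k u v.
Proof.
move=> n1 u1 v1; have [Om [hO OO]] := basis_refl n1.
by apply: (orth_bilinear OO) => j; exact: hO.
Qed.

Lemma hker_refl n u v : enorm n = 1 -> enorm u = 1 -> enorm v = 1 ->
  hker (refl n u) (refl n v) = hker u v.
Proof.
move=> n1 u1 v1; have [Om [hO OO]] := basis_refl n1.
by apply: (orth_bilinear OO) => j; [exact: (hecke_refl n1 hO)|exact: hO].
Qed.

(** If [v] and [w] have equal cosine with [e], the reflection exchanging them fixes [e]. *)
Lemma invariant_zonal (F : 'rV[R]_d -> 'rV[R]_d -> R) e :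
  (forall n u v, enorm n = 1 -> enorm u = 1 -> enorm v = 1 ->
     F (refl n u) (refl n v) = F u v) -> enorm e = 1 -> zonal_about e (F e).
Proof.
move=> hF e1 v w v1 w1 vw; have [->//|nvw] := eqVneq v w.
have n1 : enorm (hatv (v - w)) = 1 by rewrite enorm_hat// subr_eq0.
rewrite -(hF _ _ _ n1 e1 v1) refl_swap ?dotvv// refl_fix//.
by rewrite dotvZr dotvBr vw subrr mulr0.
Qed.

Lemma funk_hecke : exists lam, forall j u, (j < N k)%N -> enorm u = 1 ->
  hecke kappa k j u = lam * Y k j u.
Proof.
pose e : 'rV[R]_d := delta_mx 0 (Ordinal d0).
have e1 : enorm e = 1.
  apply: dotvv_enorm; rewrite /dotv (bigD1 (Ordinal d0))//= !mxE !eqxx mulr1 big1 ?addr0//.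
  by move=> j /negbTE ji; rewrite !mxE ji andbF mulr0.
have to_e u : enorm u = 1 -> u != e -> exists2 n, enorm n = 1 & refl n u = e.
  move=> u1 ue; exists (hatv (u - e)); first by rewrite enorm_hat// subr_eq0.
  by apply: refl_swap => //; rewrite !dotvv.
have hZ u : sph_harm k (zker k u).
  by apply: sph_harm_sum => j; apply: sph_harmZ; exact: basis_harm.
have hP u : sph_harm k (hker u).
  by apply: sph_harm_sum => j; apply: sph_harmZ; exact: basis_harm.
have [[v0 v01]|Z0] := pselect (exists v, enorm v = 1 /\ zker k e v != 0).
  have [lam hlam] := zonal_proportional e1 (hP e) (hZ e)
    (invariant_zonal hker_refl e1) (invariant_zonal zker_refl e1) (ex_intro _ v0 v01).
  exists lam => j u jk u1.
  (* A reflection taking [u] to [e] carries the proportionality to every pole with the same [lam];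
     taking coefficients along [Y k j] then isolates [hecke]. *)
  have E v : enorm v = 1 -> hker u v = lam * zker k u v.
    move=> v1; have [->|/(to_e _ u1)[n n1 nu]] := eqVneq u e; first exact: hlam.
    by rewrite -(hker_refl n1 u1 v1) -(zker_refl n1 u1 v1) nu hlam// enorm_refl.
  rewrite -(savg_coef (fun j => hecke kappa k j u) jk).
  rewrite -(savg_coef (fun j => lam * Y k j u) jk); apply: savg_ext => //.
    move=> v v1; congr (_ * _); rewrite [LHS](E _ v1) mulr_sumr.
    by apply: eq_bigr => i _; rewrite mulrA.
  apply: sbmM; last exact: basis_sbm.
  by apply: sbm_sum => i _; apply: sbmZ; exact: basis_sbmo.
(* Otherwise [zker k e e = 0], a sum of squares, and by reflection all [Y k j] vanish on the sphere:
   any multiplier would do. *)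
exists 0 => j u jk u1; rewrite mul0r.
have Ze : zker k e e = 0.
  by apply/eqP; apply: contraT => h; exfalso; apply: Z0; exists e.
have Zu v : enorm v = 1 -> zker k v v = 0.
  move=> v1; have [->//|/(to_e _ v1)[n n1 nv]] := eqVneq v e.
  by rewrite -(zker_refl n1 v1 v1) nv.
have Y0 v : enorm v = 1 -> Y k j v = 0.
  move=> v1; have := Zu v v1; rewrite /zker => /eqP; rewrite psumr_eq0 => [/allP h|i _].
    have := h (Ordinal jk) (mem_index_enum _); rewrite /= -expr2 sqrf_eq0.
    by move=> /eqP.
  by rewrite -expr2 sqr_ge0.
rewrite /hecke (@savg_ext _ _ d0 _ (cst 0)) ?savg_cst//; last exact: skY.
by move=> w w1; rewrite Y0// mulr0.
Qed.

End one_kernel.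
End funk_hecke.

(** * Pointwise Mercer expansion of zonal kernels *)

Section mercer.
Variables (R : realType) (d : nat).
Hypothesis d2 : (2 <= d)%N.
Variables (N : nat -> nat) (Y : nat -> nat -> 'rV[R]_d -> R).
Hypothesis basis : sph_harm_basis N Y.
Implicit Types (u v w : 'rV[R]_d) (f g : 'rV[R]_d -> R).

Let d0 : (0 < d)%N. Proof. exact: ltnW. Qed.
Let bY := basis_sbm basis.
Let bYo := basis_sbmo basis.

(** When [N k = 0] every scalar satisfies the condition and the chosen one carries no information,
    whence the separate case in the lemmas below. *)
Definition fhlam (kappa : R -> R) k : R := xget 0 [set lam : R |
  forall j u, (j < N k)%N -> enorm u = 1 -> hecke Y kappa k j u = lam * Y k j u].

Lemma fhlamP (kappa : R -> R) k j u : {within `[-1, 1], continuous kappa} ->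
  (j < N k)%N -> enorm u = 1 ->
  savg (fun w => kappa (dotv u w) * Y k j w) = fhlam kappa k * Y k j u.
Proof.
move=> ck jk u1; rewrite -[LHS]/(hecke Y kappa k j u).
have := xgetPex 0 (funk_hecke d2 basis ck k); rewrite -/(fhlam kappa k) /=.
exact.
Qed.

(* Averaging the quadratic form of [kappa] over [n] random points [w] with weights
   [Y w], one point at a time, gives [n (n - 1) lam + n kappa(1) >= 0]. *)
Lemma fhlam_ge0 (kappa : R -> R) k : {within `[-1, 1], continuous kappa} -> sph_pd d kappa ->
  (0 < N k)%N -> 0 <= fhlam kappa k.
Proof.
move=> ck pk k0; set l := fhlam kappa k; pose y := Y k 0%N.
have sy : sbm y by exact: bY.
have skY u : enorm u = 1 -> sbm (fun w => kappa (dotv u w) * y w).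
  by move=> u1; apply: sbmM => //; exact: sbm_zonal.
have yy : savg (fun w => y w * y w) = 1 by rewrite (basis_orth basis)// !eqxx.
(* Expectation of the quadratic form with [m] fixed points and [n] random ones. Averaging over the
   fixed point of index 0 turns the bound for [m.+1] and [n] into the one for [m] and [n.+1]. *)
have P n : forall m (u : 'I_m -> 'rV[R]_d) (c : 'I_m -> R), (forall i, enorm (u i) = 1) ->
    0 <= \sum_i \sum_j c i * c j * kappa (dotv (u i) (u j))
         + 2 * n%:R * (\sum_i c i * (l * y (u i))) + n%:R * (n%:R - 1) * l + n%:R * kappa 1.
  elim: n => [|n IH] m u c u1.
    by rewrite mulr0 !mul0r !addr0; exact: pk.
  set S0 := \sum_i \sum_j _; set S1 := \sum_i _.
  pose K := S0 + 2 * n%:R * S1 + n%:R * (n%:R - 1) * l + n%:R * kappa 1.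
  pose h w := K + (\sum_i (2 * c i) * (kappa (dotv (u i) w) * y w)
              + (kappa 1 + 2 * n%:R * l) * (y w * y w)).
  have s1 i : sbm (fun w => (2 * c i) * (kappa (dotv (u i) w) * y w)).
    by apply: sbmZ; exact: skY.
  have s2 : sbm (fun w => \sum_i (2 * c i) * (kappa (dotv (u i) w) * y w)).
    by apply: sbm_sum => i _; exact: s1.
  have s3 : sbm (fun w => (kappa 1 + 2 * n%:R * l) * (y w * y w)).
    by apply: sbmZ; exact: sbmM.
  have sh : sbm h by apply: sbmD; [exact: sbm_cst|exact: sbmD].
  have h0 w : enorm w = 1 -> 0 <= h w.
    move=> w1.
    pose u' (t : 'I_m.+1) := if unlift ord0 t is Some s then u s else w.
    pose c' (t : 'I_m.+1) := if unlift ord0 t is Some s then c s else y w.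
    have u'1 t : enorm (u' t) = 1 by rewrite /u'; case: unliftP.
    have := IH _ u' c' u'1; congr (0 <= _).
    have c'0 : c' ord0 = y w by rewrite /c' unlift_none.
    have u'0 : u' ord0 = w by rewrite /u' unlift_none.
    have c'S i : c' (lift ord0 i) = c i by rewrite /c' liftK.
    have u'S i : u' (lift ord0 i) = u i by rewrite /u' liftK.
    have E1 : \sum_i c' i * (l * y (u' i)) = l * (y w * y w) + S1.
      rewrite big_ord_recl c'0 u'0; congr (_ + _); first by ring.
      by apply: eq_bigr => i _; rewrite c'S u'S.
    have E2 : \sum_i \sum_j c' i * c' j * kappa (dotv (u' i) (u' j)) =
        S0 + \sum_i (2 * c i) * (kappa (dotv (u i) w) * y w) + kappa 1 * (y w * y w).
      rewrite big_ord_recl big_ord_recl c'0 u'0 dotvv//.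
      have -> : \sum_(i < m) y w * c' (lift ord0 i) * kappa (dotv w (u' (lift ord0 i))) =
          \sum_(i < m) c i * (kappa (dotv (u i) w) * y w).
        by apply: eq_bigr => i _; rewrite c'S u'S (dotvC w); ring.
      have -> : \sum_(i < m) \sum_(j < m.+1) c' (lift ord0 i) * c' j *
            kappa (dotv (u' (lift ord0 i)) (u' j)) =
          \sum_(i < m) c i * (kappa (dotv (u i) w) * y w) + S0.
        rewrite -big_split; apply: eq_bigr => i _ /=.
        rewrite big_ord_recl c'S u'S c'0 u'0; congr (_ + _); first by ring.
        by apply: eq_bigr => j _; rewrite c'S u'S.
      have -> : \sum_i (2 * c i) * (kappa (dotv (u i) w) * y w) =
          2 * \sum_i c i * (kappa (dotv (u i) w) * y w).
        by rewrite mulr_sumr; apply: eq_bigr => i _; ring.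
      ring.
    by rewrite E1 E2 /h /K; ring.
  have := savg_ge0 d0 sh h0; congr (0 <= _).
  rewrite /h savgD//; [|exact: (sbm_cst d K)|exact: sbmD].
  rewrite (savg_cst d0 K) savgD// savg_sum// savgZ ?yy//; last exact: sbmM.
  have -> : \sum_i savg (fun w => (2 * c i) * (kappa (dotv (u i) w) * y w)) = 2 * S1.
    rewrite mulr_sumr; apply: eq_bigr => i _; rewrite savgZ//; last exact: skY.
    by rewrite (fhlamP ck k0 (u1 i)) -/l; rewrite /y; ring.
  by rewrite /K -natr1; ring.
have P0 n : 0 <= n%:R * l + kappa 1.
  have := P n.+1 0%N (fun=> 0) (fun=> 0); rewrite !big_ord0 mulr0 !add0r => /(_ _)/wrap[].
    by case.
  rewrite -mulrA -mulrDr pmulr_rge0 ?ltr0n// -natr1.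
  by rewrite addrK.
rewrite leNgt; apply/negP => l0.
have := P0 (Num.bound (`|kappa 1| / - l)).
have := archi_boundP (divr_ge0 (normr_ge0 (kappa 1)) (ltW (_ : 0 < - l))).
rewrite oppr_gt0 => /(_ l0); rewrite ltr_pdivrMr ?oppr_gt0// => h1 h2.
have := ler_norm (kappa 1); nra.
Qed.

(** * An approximate identity of zonal polynomials *)

Definition gk m (t : R) : R := ((1 + t) / 2) ^+ m.

Lemma gk_continuous m : {within `[-1, 1], continuous (gk m)}.
Proof.
apply: continuous_subspaceT => t; rewrite /gk.
apply: (@continuous_comp _ _ _ (fun t : R => (1 + t) / 2) (fun t => t ^+ m)).
  apply: cvgM; last exact: cvg_cst.
  by apply: cvgD; [exact: cvg_cst|exact: cvg_id].
exact: exprn_continuous.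
Qed.

(** A Schur product by hand: the extra factor [dotv (u i) (u j)] is a sum over coordinates, each
    absorbed into the weights [c i * u i 0 l]. *)
Lemma gk_pd m : sph_pd d (gk m).
Proof.
elim: m => [|m IH] n u c u1.
  have -> : \sum_i \sum_j c i * c j * gk 0 (dotv (u i) (u j)) = (\sum_i c i) ^+ 2.
    rewrite expr2 mulr_suml; apply: eq_bigr => i _; rewrite mulr_sumr.
    by apply: eq_bigr => j _; rewrite /gk expr0 mulr1.
  exact: sqr_ge0.
have -> : \sum_i \sum_j c i * c j * gk m.+1 (dotv (u i) (u j)) =
    2^-1 * (\sum_i \sum_j c i * c j * gk m (dotv (u i) (u j)) +
    \sum_l \sum_i \sum_j (c i * u i 0 l) * (c j * u j 0 l) * gk m (dotv (u i) (u j))).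
  rewrite [X in _ + X]exchange_big -big_split mulr_sumr; apply: eq_bigr => i _ /=.
  rewrite exchange_big -big_split mulr_sumr; apply: eq_bigr => j _ /=.
  rewrite /gk exprS -/(gk m (dotv (u i) (u j))).
  have -> : \sum_l (c i * u i 0 l) * (c j * u j 0 l) * gk m (dotv (u i) (u j)) =
     c i * c j * gk m (dotv (u i) (u j)) * dotv (u i) (u j).
    by rewrite /dotv mulr_sumr; apply: eq_bigr => l _; ring.
  by field.
rewrite mulr_ge0 ?invr_ge0// addr_ge0 ?IH//.
by apply: sumr_ge0 => l _; exact: (IH n u (fun i => c i * u i 0 l)).
Qed.

Let e0 : 'rV[R]_d := delta_mx 0 (Ordinal d0).

Let e01 : enorm e0 = 1.
Proof.
apply: dotvv_enorm; rewrite /dotv (bigD1 (Ordinal d0))//= !mxE !eqxx mulr1 big1 ?addr0//.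
by move=> j /negbTE ji; rewrite !mxE ji andbF mulr0.
Qed.

Definition cm m : R := savg (fun w => gk m (dotv e0 w)).

Lemma sbm_gk m u : enorm u = 1 -> sbm (fun w => gk m (dotv u w)).
Proof. by move=> u1; apply: sbm_zonal => //; exact: gk_continuous. Qed.

Lemma cmE m u : enorm u = 1 -> savg (fun w => gk m (dotv u w)) = cm m.
Proof.
move=> u1; have [->//|ue] := eqVneq u e0.
have n1 : enorm (hatv (u - e0)) = 1 by rewrite enorm_hat// subr_eq0.
rewrite -(savg_refl n1); last exact: sbm_gk.
apply: savg_ext => //; last exact: (sbm_refl n1 (sbm_gk m u1)).
move=> w w1 /=; rewrite -(dotv_refl _ _ n1) reflK//.
by rewrite refl_swap// !dotvv.
Qed.

Lemma gk_ge0 m u v : enorm u = 1 -> enorm v = 1 -> 0 <= gk m (dotv u v).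
Proof.
move=> u1 v1; have /andP[h1 h2] := dotv_le1 u1 v1.
by rewrite /gk exprn_ge0// divr_ge0//; lra.
Qed.

(** [s] is the mass of the cap where the cosine is at least [1 - 2 dl]; there [gk m] is at least
    [(1 - dl) ^+ m]. *)
Lemma cm_ge_cap (dl : R) : 0 < dl -> dl <= 1 ->
  exists2 s, 0 < s & forall m, s * (1 - dl) ^+ m <= cm m.
Proof.
move=> dl0 dl1; pose ind w : R := if 1 - dl *+ 2 <= dotv e0 w then 1 else 0.
have si : sbm ind.
  split; last by exists 1 => u _; rewrite /ind; case: ifP; rewrite ?normr1 ?normr0.
  exists ind => //; apply: measurable_fun_ifT => //.
  by apply: measurable_fun_ler => //; exact: measurable_dotv.
exists (savg ind).
  apply: (savg_gt0 d0 (dl := dl *+ 2) (c := 1) si e01) => //.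
  - by move=> u _; rewrite /ind; case: ifP.
  - by rewrite pmulrn_lgt0.
  - by move=> u _ h; rewrite /ind h.
move=> m; rewrite mulrC -savgZ//; apply: savg_le => //.
- exact: sbmZ.
- exact: sbm_gk.
move=> w w1; rewrite /ind; case: ifPn => [h|_]; last by rewrite mulr0 gk_ge0.
have /andP[h1 h2] := dotv_le1 e01 w1.
have hle : 1 - dl <= (1 + dotv e0 w) / 2 by lra.
have h0 : 0 <= 1 - dl by lra.
by rewrite mulr1 /gk lerXn2r ?nnegrE// (le_trans h0).
Qed.

Lemma cm_gt0 m : 0 < cm m.
Proof.
have h1 : (0 : R) < 1 / 2 by lra.
have h2 : (1 / 2 : R) <= 1 by lra.
have [s s0 /(_ m)] := cm_ge_cap h1 h2.
by apply: lt_le_trans; rewrite mulr_gt0// exprn_gt0//; lra.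
Qed.

Lemma approx_identity f u (e : R) : sbm f -> enorm u = 1 -> capcont f u -> 0 < e ->
  \forall m \near \oo, `|savg (fun w => gk m (dotv u w) * f w) / cm m - f u| <= e.
Proof.
move=> sf u1 cf ep; have e2 : 0 < e / 2 by rewrite divr_gt0.
have [dl' dl'0 hdl'] := cf _ e2.
pose dl := Num.min dl' 1; have dl0 : 0 < dl by rewrite lt_min dl'0 ltr01.
have dl1 : dl <= 1 by rewrite ge_min lexx orbT.
have hdl v : enorm v = 1 -> 1 - dl <= dotv u v -> `|f v - f u| <= e / 2.
  move=> v1 h; apply: hdl' => //; apply: le_trans h.
  by rewrite lerD2l lerN2 ge_min lexx.
have [C fC] : exists C, forall w, enorm w = 1 -> `|f w| <= C by case: sf.
have C0 : 0 <= C by rewrite (le_trans _ (fC _ u1)).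
have dl4 : 0 < dl / 4 by rewrite divr_gt0.
have dl41 : dl / 4 <= 1 by lra.
have [s s0 hs] := cm_ge_cap dl4 dl41.
(* Outside the cap [gk m] is at most [a ^+ m], while [cm m] is at least [s * b ^+ m]; the relative
   error there is of order [(a / b) ^+ m], which tends to 0. *)
pose a := 1 - dl / 2; pose b := 1 - dl / 4.
have a0 : 0 <= a by rewrite /a; lra.
have b0 : 0 < b by rewrite /b; lra.
have ab : a / b < 1 by rewrite ltr_pdivrMr// /a /b; lra.
pose D := 2 * C / s.
have D0 : 0 <= D by rewrite divr_ge0 ?(ltW s0)// mulr_ge0.
have lim : (fun m => D * (a / b) ^+ m) @ \oo --> (0 : R).
  rewrite -(mulr0 D); apply: cvgM; first exact: cvg_cst.
  by apply: cvg_expr; rewrite ger0_norm// divr_ge0// ltW.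
move/cvgrPdist_le : lim => /(_ _ e2); apply: filterS => m.
rewrite sub0r normrN ger0_norm; last by rewrite mulr_ge0// exprn_ge0// divr_ge0// ltW.
move=> hm.
have cm0 := cm_gt0 m.
have sg := sbm_gk m u1.
have sgf : sbm (fun w => gk m (dotv u w) * f w) by exact: sbmM.
have -> : savg (fun w => gk m (dotv u w) * f w) / cm m - f u =
    savg (fun w => gk m (dotv u w) * (f w + (- f u))) / cm m.
  have sff : sbm (fun w => f w + (- f u)).
    by apply: sbmD => //; exact: sbm_cst.
  rewrite [in RHS](@savg_ext _ _ d0 _ (fun w => gk m (dotv u w) * f w + (- f u) * gk m (dotv u w))).
  - rewrite savgD//; last exact: sbmZ.
    rewrite savgZ// (cmE m u1) mulrDl mulfK ?gt_eqF//.
  - by move=> w _; ring.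
  - exact: sbmM.
have sff : sbm (fun w => f w + (- f u)).
  by apply: sbmD => //; exact: sbm_cst.
rewrite normrM normfV (gtr0_norm cm0) ler_pdivrMr//.
apply: (le_trans (savg_norm d0 (sbmM sg sff))).
apply: (@le_trans _ _ (savg (fun w => (e / 2) * gk m (dotv u w) + (2 * C * a ^+ m)))).
  apply: savg_le => //; first exact/sbm_norm/sbmM.
    by apply: sbmD; [exact: sbmZ|exact: sbm_cst].
  move=> w w1; have g0 := gk_ge0 m u1 w1; rewrite normrM (ger0_norm g0).
  have [h|h] := lerP (1 - dl) (dotv u w).
    rewrite mulrC (le_trans (ler_wpM2r g0 (hdl _ w1 h)))// lerDl.
    by rewrite mulr_ge0 ?exprn_ge0// mulr_ge0.
  have ga : gk m (dotv u w) <= a ^+ m.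
    have /andP[h1 h2] := dotv_le1 u1 w1.
    have hle : (1 + dotv u w) / 2 <= a by rewrite /a; lra.
    have hge : 0 <= (1 + dotv u w) / 2 by lra.
    by rewrite /gk lerXn2r ?nnegrE.
  have ff : `|f w - f u| <= 2 * C.
    rewrite (le_trans (ler_normB _ _))//; have := fC _ w1; have := fC _ u1; lra.
  rewrite mulrC (le_trans (ler_pM _ _ ff ga))//.
  by rewrite lerDr mulr_ge0// ltW.
rewrite [leLHS](savgD (sbmZ (e / 2) sg) (sbm_cst d (2 * C * a ^+ m))).
rewrite (savgZ (e / 2) sg) (cmE m u1) (savg_cst d0 (2 * C * a ^+ m)).
have h1 : D * (a / b) ^+ m * (s * b ^+ m) = 2 * C * a ^+ m.
  by rewrite /D expr_div_n; field; rewrite expf_neq0 gt_eqF// gt_eqF.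
have h2 : 2 * C * a ^+ m <= e / 2 * cm m.
  rewrite -h1; apply: (ler_pM _ _ hm (hs m)).
    by rewrite mulr_ge0// exprn_ge0// divr_ge0// ltW.
  by rewrite mulr_ge0 ?(ltW s0)// exprn_ge0// ltW.
lra.
Qed.

Definition gam m k : R := fhlam (gk m) k / cm m.

Lemma gam_ge0 m k : (0 < N k)%N -> 0 <= gam m k.
Proof.
move=> k0; rewrite divr_ge0 ?(ltW (cm_gt0 m))//.
by apply: fhlam_ge0 => //; [exact: gk_continuous|exact: gk_pd].
Qed.

Lemma basis_neq0 k j : (j < N k)%N -> exists2 u, enorm u = 1 & Y k j u != 0.
Proof.
move=> jk; apply: contrapT => h.
have Y0 u : enorm u = 1 -> Y k j u = 0.
  by move=> u1; apply/eqP; apply: contraT => Yu; exfalso; apply: h; exists u.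
have := basis_orth basis jk jk; rewrite !eqxx (@savg_ext _ _ d0 _ (cst 0)).
- by rewrite savg_cst// => /esym/eqP; rewrite oner_eq0.
- by move=> u u1; rewrite Y0// mulr0.
- by apply: sbmM; exact: bY.
Qed.

(** A weighted average of [Y k 0] with nonnegative weights of total mass 1 cannot exceed the
    supremum of its absolute value, which is positive and finite. *)
Lemma gam_le1 m k : (0 < N k)%N -> gam m k <= 1.
Proof.
move=> k0; have sy := bY k0; have [u u1 yu] := basis_neq0 k0.
have [C hC] : exists C, forall w, enorm w = 1 -> `|Y k 0 w| <= C by case: sy.
pose A := [set `|Y k 0 w| | w in [set w | enorm w = 1]].
have hA : has_sup A.
  split; first by exists `|Y k 0 u|; exists u.
  by exists C => _ [w w1 <-]; exact: hC.
have ubA w : enorm w = 1 -> `|Y k 0 w| <= sup A.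
  by move=> w1; apply: ub_le_sup; [case: hA|exists w].
have A0 : 0 < sup A.
  by rewrite (lt_le_trans _ (ubA _ u1))// normr_gt0.
have g0 := gam_ge0 m k0; have cm0 := cm_gt0 m.
suff : gam m k * sup A <= sup A by rewrite ger_pMl.
have [->|gn] := eqVneq (gam m k) 0; first by rewrite mul0r ltW.
have gp : 0 < gam m k by rewrite lt_neqAle eq_sym gn.
rewrite mulrC -ler_pdivlMr//; apply: ge_sup; first by case: hA.
move=> _ [w w1 <-]; rewrite ler_pdivlMr//.
have sgY : sbm (fun v => gk m (dotv w v) * Y k 0 v) by apply: sbmM => //; exact: sbm_gk.
have -> : `|Y k 0 w| * gam m k = `|savg (fun v => gk m (dotv w v) * Y k 0 v)| / cm m.
  rewrite (fhlamP (@gk_continuous m) k0)// normrM mulrC /gam ger0_norm.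
    by rewrite mulrAC.
  by apply: fhlam_ge0 => //; [exact: gk_continuous|exact: gk_pd].
rewrite ler_pdivrMr// (le_trans (savg_norm d0 sgY))// -(cmE m w1) -savgZ//; last exact: sbm_gk.
apply: savg_le => //; [exact: sbm_norm|by apply: sbmZ; exact: sbm_gk|].
move=> v v1; rewrite normrM (ger0_norm (gk_ge0 m w1 v1)) mulrC.
by rewrite ler_wpM2r ?gk_ge0// ubA.
Qed.

(** The approximate identity is tested on [Y k 0] at a point where it does not vanish. *)
Lemma gam_cvg k : (0 < N k)%N -> gam ^~ k @ \oo --> (1 : R).
Proof.
move=> k0; have [u u1 yu] := basis_neq0 k0; apply/cvgrPdist_le => e ep.
have ey : 0 < e * `|Y k 0 u| by rewrite mulr_gt0// normr_gt0.
have cY : capcont (Y k 0) u.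
  have /sph_harmP[P [hP _ fP]] := basis_harm basis k0.
  by apply: capcont_ext (capcont_hpoly hP u1) => // v v1; rewrite fP.
apply: filterS (approx_identity (bY k0) u1 cY ey) => m.
rewrite (fhlamP (@gk_continuous m) k0)// mulrAC -/(gam m k) -[X in _ - X]mul1r.
by rewrite -mulrBl normrM ler_pM2r ?normr_gt0// distrC.
Qed.

(** * Finite sums of harmonics *)

Definition inspan M f := exists c : nat -> nat -> R, forall w, enorm w = 1 ->
  f w = \sum_(k < M) \sum_(j < N k) c k j * Y k j w.

Lemma inspan0 M : inspan M (fun=> 0).
Proof.
exists (fun _ _ => 0) => w _; rewrite big1// => k _; rewrite big1// => j _.
by rewrite mul0r.
Qed.

Lemma inspanD M f g : inspan M f -> inspan M g -> inspan M (fun w => f w + g w).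
Proof.
move=> [c hc] [c' hc']; exists (fun k j => c k j + c' k j) => w w1.
rewrite hc// hc'// -big_split; apply: eq_bigr => k _; rewrite -big_split.
by apply: eq_bigr => j _; rewrite mulrDl.
Qed.

Lemma inspanZ M a f : inspan M f -> inspan M (fun w => a * f w).
Proof.
move=> [c hc]; exists (fun k j => a * c k j) => w w1.
rewrite hc// mulr_sumr; apply: eq_bigr => k _; rewrite mulr_sumr.
by apply: eq_bigr => j _; rewrite mulrA.
Qed.

Lemma inspan_ext M f g : (forall w, enorm w = 1 -> f w = g w) -> inspan M f -> inspan M g.
Proof. by move=> fg [c hc]; exists c => w w1; rewrite -fg// hc. Qed.

Lemma inspan_sum (I : Type) (r : seq I) M (f : I -> 'rV[R]_d -> R) :
  (forall i, inspan M (f i)) -> inspan M (fun w => \sum_(i <- r) f i w).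
Proof.
move=> hf; elim: r => [|i r IH].
  by apply: inspan_ext (inspan0 M) => w _; rewrite big_nil.
by apply: inspan_ext (inspanD (hf i) IH) => w _; rewrite big_cons.
Qed.

Lemma inspan_harm M l f : (l < M)%N -> sph_harm l f -> inspan M f.
Proof.
case: basis => _ _ sp lM /sp[c hc].
exists (fun k j => if k == l then c j else 0) => w w1.
rewrite (bigD1 (Ordinal lM))//= eqxx [X in _ + X]big1 ?addr0; first exact: hc.
move=> k kl; rewrite big1// => j _; rewrite ifF ?mul0r//.
by apply/negbTE; apply: contra kl => /eqP kl; apply/eqP/val_inj.
Qed.

Lemma inspan_coef M f : inspan M f -> forall w, enorm w = 1 ->
  f w = \sum_(k < M) \sum_(j < N k) savg (fun v => f v * Y k j v) * Y k j w.
Proof.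
move=> [c hc] w w1; rewrite [LHS]hc//; apply: eq_bigr => k _; apply: eq_bigr => j _.
congr (_ * _).
have s1 (l : 'I_M) : sbm (fun v => \sum_(i < N l) c l i * Y l i v).
  by apply: sbm_sum => i _; apply: sbmZ; exact: bYo.
have s2 (l : 'I_M) : sbm (fun v => (\sum_(i < N l) c l i * Y l i v) * Y k j v).
  by apply: sbmM => //; exact: bYo.
rewrite -(@savg_ext _ _ d0 (fun v => \sum_(l < M) (\sum_(i < N l) c l i * Y l i v) * Y k j v)).
- rewrite savg_sum// (bigD1 k)//= (savg_coef d2 basis)// big1 ?addr0// => l lk.
  apply: (savg_orth d2 basis (k := l) (l := k)) => //.
  + by apply: sph_harm_sum => i; apply: sph_harmZ; exact: (basis_harm basis).
  + exact: (basis_harm basis).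
- by move=> v v1; rewrite hc// mulr_suml.
- by apply: sbm_sum => l _; exact: s2.
Qed.

Lemma inspan_gk m u : enorm u = 1 -> inspan m.+1 (fun w => gk m (dotv u w)).
Proof.
move=> u1.
have h i : (i < m.+1)%N -> inspan m.+1 (fun w => dotv u w ^+ i).
  move=> im; have hd : hpoly i (fun v => dotv u v ^+ i).
    by have := hpoly_exp i (hpoly_dotv u); rewrite mul1n.
  have [n [l [H [H1 H2 H3]]]] := sph_harm_decomp d0 hd.
  apply: inspan_ext (inspan_sum (index_enum _) (f := H) _) => [w w1|t].
    by rewrite H3.
  by apply: inspan_harm (H2 t); exact: leq_ltn_trans (H1 t) im.
apply: inspan_ext (inspan_sum (index_enum _)
  (f := fun (i : 'I_m.+1) w => (2^-1 ^+ m *+ 'C(m, i)) * dotv u w ^+ i) _) => [w w1|i].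
  rewrite /gk expr_div_n exprDn mulr_suml; apply: eq_bigr => i _.
  by rewrite expr1n mul1r exprVn; ring.
by apply: inspanZ; exact: h.
Qed.

(** * Smoothed kernels and passage to the limit *)

Section expansion.
Variable kappa : R -> R.
Hypotheses (ck : {within `[-1, 1], continuous kappa}) (pk : sph_pd d kappa).
Local Notation lam := (fhlam kappa).

(** [gk m] involves only degrees at most [m], so its average against [kappa] is a finite sum in
    which the multipliers are multiplied. *)
Lemma smoothed_expansion m u v : enorm u = 1 -> enorm v = 1 ->
  savg (fun w => gk m (dotv v w) * kappa (dotv u w)) / cm m =
  \sum_(k < m.+1) gam m k * (lam k * zker N Y k u v).
Proof.
move=> u1 v1; have sk := sbm_zonal u1 ck.
have s1 (k : 'I_m.+1) (j : 'I_(N k)) : sbm (fun w => (fhlam (gk m) k * Y k j v) * (kappa (dotv u w) * Y k j w)).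
  by apply: sbmZ; apply: sbmM => //; exact: bYo.
have s2 (k : 'I_m.+1) : sbm (fun w => \sum_(j < N k)
    (fhlam (gk m) k * Y k j v) * (kappa (dotv u w) * Y k j w)).
  by apply: sbm_sum => j _; exact: s1.
rewrite (@savg_ext _ _ d0 _ (fun w => \sum_(k < m.+1) \sum_(j < N k)
    (fhlam (gk m) k * Y k j v) * (kappa (dotv u w) * Y k j w))); first last.
- by apply: sbmM => //; exact: sbm_gk.
- move=> w w1; rewrite (inspan_coef (inspan_gk m v1) w1) mulr_suml.
  apply: eq_bigr => k _; rewrite mulr_suml; apply: eq_bigr => j _.
  by rewrite (fhlamP (@gk_continuous m) (ltn_ord j) v1); ring.
rewrite savg_sum// mulr_suml; apply: eq_bigr => k _; rewrite savg_sum//.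
rewrite /zker mulr_sumr mulr_sumr mulr_suml; apply: eq_bigr => j _.
rewrite savgZ//; last by apply: sbmM => //; exact: bYo.
by rewrite (fhlamP ck (ltn_ord j) u1) /gam; ring.
Qed.

Lemma zker_diag_ge0 k u : 0 <= zker N Y k u u.
Proof. by apply: sumr_ge0 => j _; rewrite -expr2 sqr_ge0. Qed.

Lemma zker_eq0 k u v : N k = 0%N -> zker N Y k u v = 0.
Proof. by move=> k0; rewrite /zker big1// => j _; have := ltn_ord j; rewrite {2}k0. Qed.

Lemma lam_zker_ge0 k u : 0 <= lam k * zker N Y k u u.
Proof.
have [k0|k0] := posnP (N k); first by rewrite zker_eq0// mulr0.
by rewrite mulr_ge0 ?zker_diag_ge0// fhlam_ge0.
Qed.

Lemma zker_le k u v : `|zker N Y k u v| <= (zker N Y k u u + zker N Y k v v) / 2.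
Proof.
rewrite (le_trans (ler_norm_sum _ _ _))// /zker -big_split mulr_suml ler_sum// => j _ /=.
have h (a : R) : a * a = `|a| * `|a| by rewrite -normrM ger0_norm// -expr2 sqr_ge0.
rewrite ler_pdivlMr// normrM (h (Y k j u)) (h (Y k j v)).
have := sqr_ge0 (`|Y k j u| - `|Y k j v|); nra.
Qed.

Let term m u v k := gam m k * (lam k * zker N Y k u v).

Lemma term_cvg u v k : (fun m => term m u v k) @ \oo --> lam k * zker N Y k u v.
Proof.
have [k0|k0] := posnP (N k).
  by rewrite /term zker_eq0// mulr0; under eq_fun do rewrite mulr0; exact: cvg_cst.
rewrite -[X in _ --> X]mul1r; apply: cvgM; first exact: gam_cvg.
exact: cvg_cst.
Qed.

Lemma sum_term_cvg u v n :
  (fun m => \sum_(k < n) term m u v k) @ \oo --> \sum_(k < n) lam k * zker N Y k u v.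
Proof.
elim: n => [|n IH].
  by rewrite big_ord0; under eq_fun do rewrite big_ord0; exact: cvg_cst.
rewrite big_ord_recr/=; under eq_fun do rewrite big_ord_recr/=.
by apply: cvgD => //; exact: term_cvg.
Qed.

Lemma term_ge0 m u k : 0 <= term m u u k.
Proof.
have [k0|k0] := posnP (N k); first by rewrite /term zker_eq0// !mulr0.
by rewrite mulr_ge0 ?gam_ge0// lam_zker_ge0.
Qed.

(** A bound on the terms uniform in [m], with partial sums controlled by [diag_bound]. *)
Let dom u v k := (lam k * zker N Y k u u + lam k * zker N Y k v v) / 2.

Lemma dom_ge0 u v k : 0 <= dom u v k.
Proof. by rewrite divr_ge0// addr_ge0// lam_zker_ge0. Qed.

Lemma term_le m u v k : `|term m u v k| <= dom u v k.
Proof.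
have [k0|k0] := posnP (N k).
  by rewrite /term zker_eq0// !mulr0 normr0 dom_ge0.
have l0 : 0 <= lam k by exact: fhlam_ge0.
rewrite /term normrM (ger0_norm (gam_ge0 m k0)).
apply: (@le_trans _ _ `|lam k * zker N Y k u v|).
  by rewrite ler_piMl// gam_le1.
rewrite normrM (ger0_norm l0) (le_trans (ler_wpM2l l0 (zker_le k u v)))//.
by rewrite /dom -mulrDr mulrA.
Qed.

(** On the diagonal all terms are nonnegative, so a truncation is at most the whole smoothed kernel,
    an average of values of [kappa]; then [m] tends to infinity with [n] fixed. *)
Lemma diag_bound u (C : R) n : enorm u = 1 ->
  (forall w, enorm w = 1 -> `|kappa (dotv u w)| <= C) ->
  \sum_(k < n) lam k * zker N Y k u u <= C.
Proof.
move=> u1 hC.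
apply: (ler_cvg_to (@sum_term_cvg u u n) (cvg_cst C)); near=> m.
have nm : (n <= m.+1)%N by rewrite leqW//; near: m; exact: nbhs_infty_ge.
apply: (@le_trans _ _ (\sum_(k < m.+1) term m u u k)).
  rewrite -(big_mkord xpredT (term m u u)) -(big_mkord xpredT (term m u u)).
  rewrite [leRHS](big_cat_nat (n := n))//= lerDl.
  by apply: sumr_ge0 => k _; exact: term_ge0.
rewrite -smoothed_expansion// ler_pdivrMr ?cm_gt0// -(cmE m u1).
have sg := sbm_gk m u1; have sk := sbm_zonal u1 ck.
rewrite -savgZ//; apply: savg_le => //; [exact: sbmM|exact: sbmZ|].
move=> w w1; rewrite mulrC ler_wpM2r ?gk_ge0//.
by rewrite (le_trans (ler_norm _))// hC.
Unshelve. all: by end_near. Qed.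

Lemma mercer_expansion u v : enorm u = 1 -> enorm v = 1 ->
  (fun n => \sum_(k < n) lam k * zker N Y k u v) @ \oo --> kappa (dotv u v).
Proof.
move=> u1 v1.
have bounded x : enorm x = 1 -> exists C, forall w, enorm w = 1 -> `|kappa (dotv x w)| <= C.
  by move=> x1; have [_] := sbm_zonal x1 ck.
have [Cu hCu] := bounded u u1; have [Cv hCv] := bounded v v1.
pose tau n := \sum_(0 <= k < n) dom u v k.
have ndtau : nondecreasing_seq tau.
  move=> n m nm; rewrite /tau [leRHS](big_cat_nat (n := n))//= lerDl.
  by apply: sumr_ge0 => k _; exact: dom_ge0.
have tau_le n : tau n <= (Cu + Cv) / 2.
  rewrite /tau /dom -mulr_suml ler_pM2r ?invr_gt0// big_split/= !big_mkord.
  by rewrite lerD// diag_bound.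
have ctau : cvgn tau.
  apply: nondecreasing_is_cvgn => //; exists ((Cu + Cv) / 2) => _ [n _ <-].
  exact: tau_le.
have tau_lim := nondecreasing_cvgn_le ndtau ctau.
apply/cvgrPdist_le => e ep; have e3 : 0 < e / 3 by rewrite divr_gt0.
(* Dominated convergence for series: [n] makes the tail of [tau] small uniformly in [m], and only
   then [m], depending on [n], brings the first [n] terms and the smoothed kernel to their
   limits. *)
near=> n.
have tn : limn tau - tau n <= e / 3.
  rewrite (le_trans (ler_norm _))//; near: n.
  by move/cvgrPdist_le : ctau => /(_ _ e3).
near \oo => m.
have nm : (n <= m.+1)%N by rewrite leqW//; near: m; exact: nbhs_infty_ge.
have h1 : `|\sum_(k < n) lam k * zker N Y k u v - \sum_(k < n) term m u v k| <= e / 3.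
  near: m; move/cvgrPdist_le : (@sum_term_cvg u v n) => /(_ _ e3).
  exact: filterS.
have h2 : `|\sum_(k < m.+1) term m u v k - kappa (dotv u v)| <= e / 3.
  near: m; have := approx_identity (sbm_zonal u1 ck) v1 (capcont_zonal u1 v1 ck) e3.
  by apply: filterS => m; rewrite smoothed_expansion.
have h3 : `|\sum_(k < m.+1) term m u v k - \sum_(k < n) term m u v k| <= e / 3.
  rewrite -(big_mkord xpredT (term m u v)) -(big_mkord xpredT (term m u v)).
  rewrite (big_cat_nat (n := n) (p := m.+1))//= addrAC subrr add0r.
  apply: (le_trans (ler_norm_sum _ _ _)); apply: (@le_trans _ _ (tau m.+1 - tau n)).
    rewrite /tau [X in _ <= X - _](big_cat_nat (n := n))//= addrAC subrr add0r.
    by apply: ler_sum => k _; exact: term_le.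
  by rewrite (le_trans _ tn)// lerD2r.
set s := \sum_(k < n) lam k * _ in h1 *; set K := \sum_(k < m.+1) _ in h2 h3.
set sm := \sum_(k < n) term m u v k in h1 h3.
have -> : kappa (dotv u v) - s = - (K - kappa (dotv u v)) + (K - sm) - (s - sm) by ring.
rewrite (le_trans (ler_normB _ _))// (le_trans (lerD (ler_normD _ _) (lexx _)))//.
rewrite normrN; lra.
Unshelve. all: by end_near. Qed.

End expansion.
End mercer.

(** * Moments and the two-dimensional eigenproblem *)

Lemma sym2_spectral (R : realType) (al be de : R) : exists c t m1 m2 : R,
  [/\ c ^+ 2 + t ^+ 2 = 1, al = m1 * c ^+ 2 + m2 * t ^+ 2, be = (m1 - m2) * (c * t) &
      de = m1 * t ^+ 2 + m2 * c ^+ 2].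
Proof.
have [->|b0] := eqVneq be 0; first by exists 1, 0, al, de; split; ring.
pose D := Num.sqrt ((al - de) ^+ 2 + 4 * be ^+ 2).
have D2 : D ^+ 2 = (al - de) ^+ 2 + 4 * be ^+ 2.
  by rewrite sqr_sqrtr// addr_ge0 ?sqr_ge0// mulr_ge0 ?sqr_ge0.
(* [(be, q)] is an eigenvector of the symmetric matrix with entries [al], [be], [de], for the
   eigenvalue [al + q]; [qE] is its characteristic equation. *)
pose q := (de - al + D) / 2.
have qE : q * (q + al - de) = be ^+ 2.
  transitivity ((D ^+ 2 - (al - de) ^+ 2) / 4); first by rewrite /q; field.
  by rewrite D2; field.
have n0 : 0 < be ^+ 2 + q ^+ 2.
  by rewrite ltr_pwDl ?sqr_ge0// lt_neqAle sqr_ge0 andbT eq_sym sqrf_eq0.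
pose r := Num.sqrt (be ^+ 2 + q ^+ 2).
have r2 : r ^+ 2 = be ^+ 2 + q ^+ 2 by rewrite sqr_sqrtr// ltW.
have r0 : r != 0 by rewrite -sqrf_eq0 r2 gt_eqF.
have n0' : be ^+ 2 + q ^+ 2 != 0 by rewrite gt_eqF.
have c2 : (be / r) ^+ 2 = be ^+ 2 / (be ^+ 2 + q ^+ 2) by rewrite expr_div_n r2.
have t2 : (q / r) ^+ 2 = q ^+ 2 / (be ^+ 2 + q ^+ 2) by rewrite expr_div_n r2.
have ct : be / r * (q / r) = be * q / (be ^+ 2 + q ^+ 2).
  by rewrite -r2; field.
have ct1 : (be / r) ^+ 2 + (q / r) ^+ 2 = 1 by rewrite c2 t2 -mulrDl divff.
have E1 : al = (al + q) * (be / r) ^+ 2 + (de - q) * (q / r) ^+ 2.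
  rewrite c2 t2; apply: (mulIf n0').
  have -> : ((al + q) * (be ^+ 2 / (be ^+ 2 + q ^+ 2)) +
     (de - q) * (q ^+ 2 / (be ^+ 2 + q ^+ 2))) * (be ^+ 2 + q ^+ 2) =
     (al + q) * be ^+ 2 + (de - q) * q ^+ 2 by field.
  by rewrite -qE; ring.
exists (be / r), (q / r), (al + q), (de - q); split => //.
- rewrite ct; apply: (mulIf n0').
  have -> : (al + q - (de - q)) * (be * q / (be ^+ 2 + q ^+ 2)) * (be ^+ 2 + q ^+ 2) =
     be * (q * (q + al - de) + q ^+ 2) by field.
  by rewrite qE.
- have : (al + q) * ((be / r) ^+ 2 + (q / r) ^+ 2) + (de - q) * ((be / r) ^+ 2 + (q / r) ^+ 2)
    = al + de by rewrite ct1; ring.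
  by move: E1; set c := be / r; set t := q / r; move=> E1 h; lra.
Qed.

(* In the coordinates [(s a, m1 a + b)], [s^2 = m2 - m1^2], the Gram form of the pair
   [(r, 1)] is Euclidean and the operator becomes symmetric. *)
Lemma gram_eigenbasis (R : realType) (m1 m2 l0 l1 : R) : 0 < m2 - m1 ^+ 2 ->
  exists A B M : 'I_2 -> R,
  [/\ forall i, l0 * (A i * m2 + B i * m1) = M i * A i,
      forall i, l1 * (A i * m1 + B i) = M i * B i,
      forall i i', A i * A i' * m2 + (A i * B i' + B i * A i') * m1 + B i * B i' = (i == i')%:R &
      [/\ \sum_i M i * (A i * A i) = l0, \sum_i M i * (A i * B i) = 0 &
          \sum_i M i * (B i * B i) = l1]].
Proof.
move=> g0; pose s := Num.sqrt (m2 - m1 ^+ 2).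
have s2 : s ^+ 2 = m2 - m1 ^+ 2 by rewrite sqr_sqrtr// ltW.
have s0 : s != 0 by rewrite -sqrf_eq0 s2 gt_eqF.
have m2E : m2 = s ^+ 2 + m1 ^+ 2 by rewrite s2; ring.
(* In these coordinates the operator is [l0] times the square of the vector [(s, m1)] plus [l1]
   times the square of [(0, 1)], as rank-one symmetric matrices. *)
have [c [t [u1 [u2 [ct E1 E2 E3]]]]] :=
  sym2_spectral (l0 * s ^+ 2) (l0 * s * m1) (l0 * m1 ^+ 2 + l1).
have v1 : (u1 * c ^+ 2 + u2 * t ^+ 2) * c + (u1 - u2) * (c * t) * t = u1 * c.
  by transitivity (u1 * c * (c ^+ 2 + t ^+ 2)); [ring|rewrite ct mulr1].
have v2 : (u1 - u2) * (c * t) * c + (u1 * t ^+ 2 + u2 * c ^+ 2) * t = u1 * t.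
  by transitivity (u1 * t * (c ^+ 2 + t ^+ 2)); [ring|rewrite ct mulr1].
have v3 : (u1 * c ^+ 2 + u2 * t ^+ 2) * - t + (u1 - u2) * (c * t) * c = u2 * - t.
  by transitivity (u2 * - t * (c ^+ 2 + t ^+ 2)); [ring|rewrite ct mulr1].
have v4 : (u1 - u2) * (c * t) * - t + (u1 * t ^+ 2 + u2 * c ^+ 2) * c = u2 * c.
  by transitivity (u2 * c * (c ^+ 2 + t ^+ 2)); [ring|rewrite ct mulr1].
pose X (i : 'I_2) := if i == 0 then c else - t.
pose Z (i : 'I_2) := if i == 0 then t else c.
pose M (i : 'I_2) := if i == 0 then u1 else u2.
have h1 i : l0 * s ^+ 2 * X i + l0 * s * m1 * Z i = M i * X i.
  by rewrite E1 E2 /X /Z /M; case: ifP.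
have h2 i : l0 * s * m1 * X i + (l0 * m1 ^+ 2 + l1) * Z i = M i * Z i.
  by rewrite E2 E3 /X /Z /M; case: ifP.
have h3 i i' : X i * X i' + Z i * Z i' = (i == i')%:R.
  rewrite /X /Z; case: i => -[|[|//]] ?; case: i' => -[|[|//]] ? /=.
  - by rewrite -!expr2 ct.
  - by rewrite mulrN addrC [t * c]mulrC subrr.
  - by rewrite mulNr addrC [t * c]mulrC subrr.
  - by rewrite mulrNN -!expr2 addrC ct.
have sum2 (f : 'I_2 -> R) : \sum_i f i = f 0 + f 1.
  by rewrite big_ord_recl big_ord1; congr (_ + f _); exact: val_inj.
(* The spectral resolution of the matrix, entry by entry; it becomes the expansion of the kernel in
   the variables [A], [B]. *)
have S1 : \sum_i M i * (X i * X i) = l0 * s ^+ 2.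
  by rewrite sum2 E1 /M /X/=; ring.
have S2 : \sum_i M i * (X i * Z i) = l0 * s * m1.
  by rewrite sum2 E2 /M /X /Z/=; ring.
have S3 : \sum_i M i * (Z i * Z i) = l0 * m1 ^+ 2 + l1.
  by rewrite sum2 E3 /M /Z/=; ring.
clearbody X Z M.
exists (fun i => X i / s), (fun i => Z i - m1 * (X i / s)), M; split => [i|i|i i'|].
- by rewrite [RHS]mulrA -(h1 i) m2E; field.
- have -> : M i * (Z i - m1 * (X i / s)) = M i * Z i - m1 * (M i * X i) / s by field.
  by rewrite -(h1 i) -(h2 i); field.
- by rewrite -h3 m2E; field.
- split.
  + have -> : \sum_i M i * (X i / s * (X i / s)) = (\sum_i M i * (X i * X i)) / s ^+ 2.
      by rewrite mulr_suml; apply: eq_bigr => i _; field.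
    by rewrite S1 mulfK// expf_neq0.
  + have -> : \sum_i M i * (X i / s * (Z i - m1 * (X i / s))) =
        (\sum_i M i * (X i * Z i)) / s - m1 * ((\sum_i M i * (X i * X i)) / s ^+ 2).
      by rewrite !mulr_suml mulr_sumr -sumrB; apply: eq_bigr => i _; field.
    by rewrite S1 S2; field.
  + have -> : \sum_i M i * ((Z i - m1 * (X i / s)) * (Z i - m1 * (X i / s))) =
        \sum_i M i * (Z i * Z i) - 2 * m1 * ((\sum_i M i * (X i * Z i)) / s) +
        m1 ^+ 2 * ((\sum_i M i * (X i * X i)) / s ^+ 2).
      rewrite !mulr_suml !mulr_sumr -sumrB -big_split; apply: eq_bigr => i _ /=.
      by field.
    by rewrite S1 S2 S3; field.
Qed.

(** * Moments of the radial density *)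

Section moments.
Variables (R : realType) (p : R -> R).
Local Notation mu := (@lebesgue_measure R).
Hypotheses (mp : measurable_fun (`[0%R, +oo[ : set R) p)
  (p0 : forall r, 0 <= r -> 0 <= p r)
  (p1 : (\int[mu]_(r in `[0%R, +oo[) (p r)%:E = 1)%E)
  (p2 : (0 < \int[mu]_(r in `[0%R, +oo[) (p r * r ^+ 2)%:E < +oo)%E).

Definition mom (i : nat) : R := \int[mu]_(r in `[0%R, +oo[) (p r * r ^+ i).

Let mD : measurable (`[0%R, +oo[%classic : set (measurableTypeR R)).
Proof. exact: measurable_itv. Qed.

Let mpr i : measurable_fun (`[0%R, +oo[ : set R) (fun r => p r * r ^+ i).
Proof. by apply: measurable_funM => //; exact: measurable_funX. Qed.

Let inD (r : R) : `[0%R, +oo[%classic r -> 0 <= r.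
Proof. by rewrite /= in_itv/= andbT. Qed.

Let pr_ge0 i r : `[0%R, +oo[%classic r -> 0 <= p r * r ^+ i.
Proof. by move=> /inD r0; rewrite mulr_ge0 ?p0// exprn_ge0. Qed.

Let mom_int_ge0 i : (\int[mu]_(r in `[0%R, +oo[) (p r * r ^+ i)%:E < +oo)%E ->
  mu.-integrable `[0%R, +oo[ (EFin \o (fun r => p r * r ^+ i)).
Proof.
move=> h; apply/integrableP; split; first by apply/measurable_EFinP; exact: mpr.
apply: le_lt_trans h; rewrite le_eqVlt; apply/orP; left; apply/eqP.
by apply: eq_integral => r; rewrite inE => rD; rewrite /= ger0_norm// pr_ge0.
Qed.

Lemma mom0_integrable : mu.-integrable `[0%R, +oo[ (EFin \o (fun r => p r * r ^+ 0)).
Proof.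
by apply: mom_int_ge0; under eq_integral do rewrite expr0 mulr1; rewrite p1 ltry.
Qed.

Lemma mom2_integrable : mu.-integrable `[0%R, +oo[ (EFin \o (fun r => p r * r ^+ 2)).
Proof. by apply: mom_int_ge0; case/andP: p2. Qed.

(** Dominated by the moments of order 0 and 2, since [(r - 1/2) ^+ 2 >= 0]. *)
Lemma mom1_integrable : mu.-integrable `[0%R, +oo[ (EFin \o (fun r => p r * r ^+ 1)).
Proof.
have sumi := integrableD mD mom0_integrable mom2_integrable.
apply: le_integrable sumi => //.
  by apply/measurable_EFinP; exact: mpr.
move=> r rD /=; have r0 := inD rD; have pr := p0 r0.
rewrite lee_fin (ger0_norm (pr_ge0 1 rD)) ger0_norm; last first.
  by rewrite addr_ge0//; exact: pr_ge0.
rewrite expr0 expr1 mulr1; have := mulr_ge0 pr (sqr_ge0 (r - 1 / 2)); nra.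
Qed.

Lemma mom0 : mom 0 = 1.
Proof. by rewrite /mom /Rintegral; under eq_integral do rewrite expr0 mulr1; rewrite p1. Qed.

Lemma mom2_gt0 : 0 < mom 2.
Proof. by rewrite /mom /Rintegral fine_gt0. Qed.

Lemma quad_integrable (a b c : R) : mu.-integrable `[0%R, +oo[
  (EFin \o (fun r => (a * r ^+ 2 + b * r + c) * p r)).
Proof.
have h1 := integrableZl mD a mom2_integrable.
have h2 := integrableZl mD b mom1_integrable.
have h3 := integrableZl mD c mom0_integrable.
have := integrableD mD (integrableD mD h1 h2) h3.
apply: eq_integrable => // r _ /=; rewrite -!EFinM -!EFinD; congr EFin; ring.
Qed.

Lemma quad_mom (a b c : R) :
  \int[mu]_(r in `[0%R, +oo[) ((a * r ^+ 2 + b * r + c) * p r) =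
  a * mom 2 + b * mom 1 + c.
Proof.
have h1 := integrableZl mD a mom2_integrable.
have h2 := integrableZl mD b mom1_integrable.
have h3 := integrableZl mD c mom0_integrable.
rewrite -[X in _ = _ + X]mulr1 -[X in _ = _ + c * X]mom0 /mom.
rewrite -(RintegralZl _ mD mom2_integrable).
rewrite -(RintegralZl _ mD mom1_integrable).
rewrite -(RintegralZl _ mD mom0_integrable).
rewrite -(RintegralD mD h1 h2).
rewrite -(RintegralD mD (integrableD mD h1 h2) h3).
by apply: eq_Rintegral => r _; ring.
Qed.

Lemma gram_gt0 : 0 < mom 2 - mom 1 ^+ 2.
Proof.
set m := mom 1.
pose f r := (1 * r ^+ 2 + (- 2 * m) * r + m ^+ 2) * p r.
have fE r : f r = (r - m) ^+ 2 * p r by rewrite /f; ring.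
have -> : mom 2 - m ^+ 2 = \int[mu]_(r in `[0%R, +oo[) f r.
  by rewrite quad_mom -/m; ring.
have fi : mu.-integrable `[0%R, +oo[ (EFin \o f) by exact: quad_integrable.
have f0 r : `[0%R, +oo[%classic r -> 0 <= f r.
  by move=> /inD r0; rewrite fE mulr_ge0 ?sqr_ge0// p0.
rewrite lt_neqAle Rintegral_ge0// andbT; apply/negP => /eqP f1.
have : (\int[mu]_(r in `[0%R, +oo[) `|(EFin \o f) r| = 0)%E.
  transitivity (\int[mu]_(r in `[0%R, +oo[) (f r)%:E)%E.
    by apply: eq_integral => r; rewrite inE => rD; rewrite /= ger0_norm// f0.
  by rewrite -[LHS]fineK ?(integrable_fin_num _ fi)// -[fine _]/(\int[mu]_(r in `[0%R, +oo[) f r) -f1.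
have mf : measurable_fun (`[0%R, +oo[ : set R) (EFin \o f) by case/integrableP: fi.
move=> /(ae_eq_integral_abs _ mD mf) aef.
have : (\int[mu]_(r in `[0%R, +oo[) (p r)%:E = \int[mu]_(r in `[0%R, +oo[) cst 0 r)%E.
  apply: ae_eq_integral => //; first exact/measurable_EFinP.
  have nm : \forall r \ae mu, r != m.
    exists [set m]; split; [exact: measurable_set1|exact: lebesgue_measure_set1|].
    by move=> r /= /negP; rewrite negbK => /eqP.
  apply: filterS2 aef nm => r /= h rm rD; have := h rD; rewrite fE => -[/eqP].
  rewrite mulf_eq0 sqrf_eq0 subr_eq0 (negbTE rm)/= => /eqP ->//.
by rewrite p1 integral0 => /eqP; rewrite onee_eq0.
Qed.

End moments.

Lemma iintD (R : realType) d (f g : 'rV[R]_d -> R) :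
  (leb R d).-integrable setT (EFin \o f) -> (leb R d).-integrable setT (EFin \o g) ->
  iint (fun x => f x + g x) = (iint f + iint g)%E.
Proof.
move=> fi gi; rewrite !iintE//; last first.
  by have := integrableD measurableT fi gi; apply: eq_integrable.
by rewrite -integralD//; apply: eq_integral => x _; rewrite EFinD.
Qed.

Lemma quadratic_sum (R : realType) (I : finType) (A B M : I -> R) (x z y y' : R) :
  \sum_i M i * ((A i * x + B i) * y) * ((A i * z + B i) * y') =
  (x * z * (\sum_i M i * (A i * A i)) + (x + z) * (\sum_i M i * (A i * B i)) +
   \sum_i M i * (B i * B i)) * (y * y').
Proof.
rewrite !mulr_sumr -!big_split mulr_suml; apply: eq_bigr => i _ /=; ring.
Qed.

(** * Integrals of quadratic radial factors *)

Section radial_integrals.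
Variables (R : realType) (d : nat) (p : R -> R).
Hypothesis d0 : (0 < d)%N.
Hypotheses (mp : measurable_fun (`[0%R, +oo[ : set R) p)
  (p0 : forall r, 0 <= r -> 0 <= p r)
  (p1 : (\int[@lebesgue_measure R]_(r in `[0%R, +oo[) (p r)%:E = 1)%E)
  (p2 : (0 < \int[@lebesgue_measure R]_(r in `[0%R, +oo[) (p r * r ^+ 2)%:E < +oo)%E).
Implicit Types g : 'rV[R]_d -> R.

Let polarE (a b c : R) g : (fun z => (a * enorm z ^+ 2 + b * enorm z + c) * g (hatv z) * pbar p z) =
  fun z => (fun r => (a * r ^+ 2 + b * r + c) * p r) (enorm z)
     / sphere_area d (enorm z) * g (hatv z).
Proof. by apply/funext => z; rewrite /pbar; ring. Qed.

Lemma quad_iint (a b c : R) g : sbm g ->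
  iint (fun z => (a * enorm z ^+ 2 + b * enorm z + c) * g (hatv z) * pbar p z) =
  ((a * mom p 2 + b * mom p 1 + c) * savg g)%:E.
Proof.
move=> gs; rewrite polarE (polar_iint d0 (quad_integrable mp p0 p1 p2 a b c) gs).
by rewrite (quad_mom mp p0 p1 p2).
Qed.

Lemma quad_iint2 (a b c a' b' c' : R) g g' : sbm g -> sbm g' ->
  iint (fun z => ((a * enorm z ^+ 2 + b * enorm z + c) * g (hatv z) +
    (a' * enorm z ^+ 2 + b' * enorm z + c') * g' (hatv z)) * pbar p z) =
  ((a * mom p 2 + b * mom p 1 + c) * savg g +
   (a' * mom p 2 + b' * mom p 1 + c') * savg g')%:E.
Proof.
move=> gs gs'; rewrite EFinD -!quad_iint// -iintD; first last.
- by rewrite polarE; exact: (polar_integrable d0 (quad_integrable mp p0 p1 p2 a' b' c') gs').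
- by rewrite polarE; exact: (polar_integrable d0 (quad_integrable mp p0 p1 p2 a b c) gs).
by congr iint; apply/funext => z; rewrite mulrDl.
Qed.

End radial_integrals.

(** * Eigenfunctions and expansions of the two kernels *)

Theorem theorem6 (R : realType) (d : nat) (p : R -> R) (kappa0 kappa1 : R -> R)
    (N : nat -> nat) (Y : nat -> nat -> 'rV[R]_d -> R) :
  (2 <= d)%N ->
  measurable_fun (`[0%R, +oo[ : set R) p ->
  (forall r, 0 <= r -> 0 <= p r) ->
  (\int[@lebesgue_measure R]_(r in `[0%R, +oo[) (p r)%:E = 1)%E ->
  (0 < \int[@lebesgue_measure R]_(r in `[0%R, +oo[) (p r * r ^+ 2)%:E < +oo)%E ->
  {within `[-1, 1], continuous kappa0} ->
  {within `[-1, 1], continuous kappa1} ->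
  sph_pd d kappa0 -> sph_pd d kappa1 ->
  sph_harm_basis N Y ->
  let k0 := fun x z : 'rV[R]_d => enorm x * enorm z * kappa0 (dotv (hatv x) (hatv z)) in
  let k1 := fun x z : 'rV[R]_d => kappa1 (dotv (hatv x) (hatv z)) in
  (* (1) *)
  (exists (a : R) (lam : nat -> R), 0 < a /\
     (forall k j, (j < N k)%N -> forall x,
        Top p k0 (radial_sh a 0 (Y k j)) x = (lam k * radial_sh a 0 (Y k j) x)%:E) /\
     (forall k j k' j', (j < N k)%N -> (j' < N k')%N ->
        L2ip p (radial_sh a 0 (Y k j)) (radial_sh a 0 (Y k' j'))
        = (if (k == k') && (j == j') then 1 else 0)%:E) /\
     (forall x z : 'rV[R]_d,
        (fun n => \sum_(k < n) lam k *
            \sum_(j < N k) radial_sh a 0 (Y k j) x * radial_sh a 0 (Y k j) z)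
        @ \oo --> k0 x z))
  /\
  (* (2) *)
  ((forall k j, (j < N k)%N -> forall a b : R, exists a' b' : R,
      forall x : 'rV[R]_d, x != 0 ->
        Top p (fun x z => k0 x z + k1 x z) (radial_sh a b (Y k j)) x
        = (radial_sh a' b' (Y k j) x)%:E) /\
   (exists (A B M : nat -> nat -> 'I_2 -> R),
     (forall k j (i : 'I_2), (j < N k)%N -> forall x : 'rV[R]_d, x != 0 ->
        Top p (fun x z => k0 x z + k1 x z) (radial_sh (A k j i) (B k j i) (Y k j)) x
        = (M k j i * radial_sh (A k j i) (B k j i) (Y k j) x)%:E) /\
     (forall k j (i : 'I_2) k' j' (i' : 'I_2), (j < N k)%N -> (j' < N k')%N ->
        L2ip p (radial_sh (A k j i) (B k j i) (Y k j))
               (radial_sh (A k' j' i') (B k' j' i') (Y k' j'))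
        = (if [&& k == k', j == j' & i == i'] then 1 else 0)%:E) /\
     (forall x z : 'rV[R]_d, x != 0 -> z != 0 ->
        (fun n => \sum_(k < n) \sum_(j < N k) \sum_(i < 2) M k j i *
            radial_sh (A k j i) (B k j i) (Y k j) x *
            radial_sh (A k j i) (B k j i) (Y k j) z)
        @ \oo --> k0 x z + k1 x z))).
Proof.
move=> d2 mp p0 p1 p2 ck0 ck1 pk0 pk1 basis k0 k1.
have d0 : (0 < d)%N by exact: ltnW.
pose m1 := mom p 1; pose m2 := mom p 2.
have m20 : 0 < m2 by exact: mom2_gt0.
pose l0 := fhlam N Y kappa0; pose l1 := fhlam N Y kappa1.
have bY := basis_sbm basis.
have Q := @quad_iint R d p d0 mp p0 p1 p2.
have Q2 := @quad_iint2 R d p d0 mp p0 p1 p2.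
(* [k0] integrates [(a r + b) r] and [k1] integrates [a r + b], which produces the Gram entries;
   each angular part contributes its own multiplier. *)
have T k j a b x : (j < N k)%N -> x != 0 ->
    Top p (fun x z => k0 x z + k1 x z) (radial_sh a b (Y k j)) x =
    (radial_sh (l0 k * (a * m2 + b * m1)) (l1 k * (a * m1 + b)) (Y k j) x)%:E.
  move=> jk x0; have x1 := enorm_hat x0.
  pose g0 w := kappa0 (dotv (hatv x) w) * Y k j w.
  pose g1 w := kappa1 (dotv (hatv x) w) * Y k j w.
  have s0 : sbm g0 by apply: sbmM; [exact: sbm_zonal|exact: bY].
  have s1 : sbm g1 by apply: sbmM; [exact: sbm_zonal|exact: bY].
  have := Q2 (enorm x * a) (enorm x * b) 0 0 a b g0 g1 s0 s1.
  rewrite (fhlamP d2 basis ck0 jk x1) (fhlamP d2 basis ck1 jk x1) => E.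
  transitivity (iint (fun z => ((enorm x * a * enorm z ^+ 2 + enorm x * b * enorm z + 0) *
      g0 (hatv z) + (0 * enorm z ^+ 2 + a * enorm z + b) * g1 (hatv z)) * pbar p z)).
    congr iint; apply/funext => z.
    by rewrite /k0 /k1 /g0 /g1 /radial_sh; ring.
  by rewrite E; congr EFin; rewrite /radial_sh /l0 /l1 /m1 /m2; ring.
have L k j k' j' a b a' b' : (j < N k)%N -> (j' < N k')%N ->
    L2ip p (radial_sh a b (Y k j)) (radial_sh a' b' (Y k' j')) =
    ((a * a' * m2 + (a * b' + b * a') * m1 + b * b') * ((k == k') && (j == j'))%:R)%:E.
  move=> jk jk'; rewrite -(basis_orth basis jk jk') -Q; last by apply: sbmM; exact: bY.
  by congr iint; apply/funext => z; rewrite /radial_sh; ring.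
pose Sn (l : nat -> R) x z n := \sum_(k < n) l k * zker N Y k (hatv x) (hatv z).
split; last split.
(* The squared norm of [r Y] is [m2], which fixes [a] independently of the harmonic and leaves the
   factor [m2] in the eigenvalue. *)
- exists (Num.sqrt m2)^-1, (fun k => m2 * l0 k).
  have a2 : (Num.sqrt m2)^-1 * (Num.sqrt m2)^-1 * m2 = 1.
    by rewrite -invfM -expr2 sqr_sqrtr ?(ltW m20)// mulVf// gt_eqF.
  set a := (Num.sqrt m2)^-1 in a2 *.
  split; first by rewrite invr_gt0 sqrtr_gt0.
  split; [|split].
  + move=> k j jk x; have [->|x0] := eqVneq x 0.
      have := Q 0 0 0 (cst 0) (sbm_cst d 0); rewrite !mul0r !addr0 mul0r => E.
      transitivity (0%:E : \bar R); last by rewrite /radial_sh enorm0 mulr0 addr0 mul0r mulr0.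
      rewrite -E; congr iint; apply/funext => z.
      by rewrite /k0 /radial_sh enorm0 /=; ring.
    have x1 := enorm_hat x0.
    have s0 : sbm (fun w => kappa0 (dotv (hatv x) w) * Y k j w).
      by apply: sbmM; [exact: sbm_zonal|exact: bY].
    have := Q (enorm x * a) 0 0 _ s0; rewrite (fhlamP d2 basis ck0 jk x1) => E.
    transitivity (iint (fun z => (enorm x * a * enorm z ^+ 2 + 0 * enorm z + 0) *
       (kappa0 (dotv (hatv x) (hatv z)) * Y k j (hatv z)) * pbar p z)).
      by congr iint; apply/funext => z; rewrite /k0 /radial_sh; ring.
    by rewrite E; congr EFin; rewrite /radial_sh /l0 /m2; ring.
  + move=> k j k' j' jk jk'; rewrite L//.
    have -> : a * a * m2 + (a * 0 + 0 * a) * m1 + 0 * 0 = 1 by rewrite a2; ring.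
    by rewrite mul1r; case: ifP.
  + move=> x z; rewrite [X in X @ _ --> _](_ : _ =
        fun n => enorm x * enorm z * Sn l0 x z n); last first.
      apply/funext => n; rewrite /Sn mulr_sumr; apply: eq_bigr => k _.
      rewrite /zker !mulr_sumr; apply: eq_bigr => j _; rewrite /radial_sh.
      transitivity (a * a * m2 * (enorm x * enorm z *
        (l0 k * (Y k j (hatv x) * Y k j (hatv z))))); first by ring.
      by rewrite a2 mul1r.
    have [->|x0] := eqVneq x 0.
      rewrite /k0 enorm0 !mul0r; under eq_fun do rewrite !mul0r.
      exact: cvg_cst.
    have [->|z0] := eqVneq z 0.
      rewrite /k0 enorm0 !mulr0 !mul0r; under eq_fun do rewrite !mul0r.
      exact: cvg_cst.
    apply: cvgM; first exact: cvg_cst.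
    exact: (mercer_expansion d2 basis ck0 pk0 (enorm_hat x0) (enorm_hat z0)).
- move=> k j jk a b.
  exists (l0 k * (a * m2 + b * m1)), (l1 k * (a * m1 + b)) => x x0.
  exact: T.
(* Multipliers depend on the degree only, so one choice of [(A, B, M)] per [k] serves all [j]. *)
have [F hF] : exists F : nat -> ('I_2 -> R) * ('I_2 -> R) * ('I_2 -> R), forall k,
    [/\ forall i, l0 k * ((F k).1.1 i * m2 + (F k).1.2 i * m1) = (F k).2 i * (F k).1.1 i,
      forall i, l1 k * ((F k).1.1 i * m1 + (F k).1.2 i) = (F k).2 i * (F k).1.2 i,
      forall i i', (F k).1.1 i * (F k).1.1 i' * m2 + ((F k).1.1 i * (F k).1.2 i' +
        (F k).1.2 i * (F k).1.1 i') * m1 + (F k).1.2 i * (F k).1.2 i' = (i == i')%:R &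
      [/\ \sum_i (F k).2 i * ((F k).1.1 i * (F k).1.1 i) = l0 k,
          \sum_i (F k).2 i * ((F k).1.1 i * (F k).1.2 i) = 0 &
          \sum_i (F k).2 i * ((F k).1.2 i * (F k).1.2 i) = l1 k]].
  have /choice[F hF] : forall k, exists t : ('I_2 -> R) * ('I_2 -> R) * ('I_2 -> R),
    [/\ forall i, l0 k * (t.1.1 i * m2 + t.1.2 i * m1) = t.2 i * t.1.1 i,
      forall i, l1 k * (t.1.1 i * m1 + t.1.2 i) = t.2 i * t.1.2 i,
      forall i i', t.1.1 i * t.1.1 i' * m2 + (t.1.1 i * t.1.2 i' +
        t.1.2 i * t.1.1 i') * m1 + t.1.2 i * t.1.2 i' = (i == i')%:R &
      [/\ \sum_i t.2 i * (t.1.1 i * t.1.1 i) = l0 k,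
          \sum_i t.2 i * (t.1.1 i * t.1.2 i) = 0 &
          \sum_i t.2 i * (t.1.2 i * t.1.2 i) = l1 k]].
    move=> k; have [A [B [M hM]]] := gram_eigenbasis (l0 k) (l1 k) (gram_gt0 mp p0 p1 p2).
    by exists (A, B, M).
  by exists F.
exists (fun k _ i => (F k).1.1 i), (fun k _ i => (F k).1.2 i), (fun k _ i => (F k).2 i).
split; [|split].
- move=> k j i jk x x0; rewrite T//; have [h1 h2 _ _] := hF k.
  by rewrite h1 h2 /radial_sh; congr EFin; ring.
- move=> k j i k' j' i' jk jk'; rewrite L//.
  have [kk'|kk'] := eqVneq k k'; last by rewrite /= mulr0.
  rewrite -kk' /=; have [_ _ -> _] := hF k.
  by case: (j == j'); case: (i == i'); rewrite /= ?mulr1 ?mulr0.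
(* The sum over the two eigenfunctions of a harmonic collapses to [l0 k * r_x * r_z + l1 k], the
   mixed coefficient being 0, and the two Mercer series separate. *)
- move=> x z x0 z0; rewrite [X in X @ _ --> _](_ : _ =
      fun n => enorm x * enorm z * Sn l0 x z n + Sn l1 x z n); last first.
    apply/funext => n; rewrite /Sn mulr_sumr -big_split; apply: eq_bigr => k _ /=.
    rewrite /zker !mulr_sumr -big_split; apply: eq_bigr => j _ /=.
    rewrite /radial_sh quadratic_sum; have [_ _ _ [-> -> ->]] := hF k.
    by ring.
  apply: cvgD; last first.
    exact: (mercer_expansion d2 basis ck1 pk1 (enorm_hat x0) (enorm_hat z0)).
  apply: cvgM; first exact: cvg_cst.
  exact: (mercer_expansion d2 basis ck0 pk0 (enorm_hat x0) (enorm_hat z0)).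
Qed.
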